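(* Let $n\ge 1$ and let $h:[0,\infty)\to[0,\infty)$ be a continuous function with $\int_0^\infty r^{2m+2n-1}e^{-2h(r)}\,dr<\infty$ for every $m\in\mathbb{N}_0$. Let $\varphi\in L^{\infty}(\mathbb{C}^n)$ be $\mathrm{U}(n)$-invariant, and write $\varphi(z)=\mathbf{a}_\varphi(|z|)$ for almost every $z\in\mathbb{C}^n$. Then, for every $m\in\mathbb{N}_0$, $$T_\varphi|_{P^m(\mathbb{C}^n)}=\lambda_{\varphi,m}\,\mathrm{I},$$ where $$\lambda_{\varphi,m}=\frac{\displaystyle\int_0^\infty \mathbf{a}_\varphi(\rho)\,\rho^{2m+2n-1}e^{-2h(\rho)}\,d\rho}{\displaystyle\int_0^\infty \rho^{2m+2n-1}e^{-2h(\rho)}\,d\rho}.$$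
   Context: $\mathbb{N}_0=\{0,1,2,\dots\}$. Put $h(z):=h(|z|)$ for $z\in\mathbb{C}^n$. $L^2_h(\mathbb{C}^n)$ is the Hilbert space of (classes of) Lebesgue measurable functions $f$ on $\mathbb{C}^n$ with $\|f\|_h^2=\int_{\mathbb{C}^n}|f(z)|^2e^{-2h(z)}\,dz<\infty$, where $dz$ is Lebesgue measure. The radially weighted Fock space $\mathcal{A}_h(\mathbb{C}^n)$ is the closed subspace of entire functions in $L^2_h(\mathbb{C}^n)$, and $P:L^2_h(\mathbb{C}^n)\to\mathcal{A}_h(\mathbb{C}^n)$ is the orthogonal projection. For $\varphi\in L^\infty(\mathbb{C}^n)$ the Toeplitz operator on $\mathcal{A}_h(\mathbb{C}^n)$ is $T_\varphi f=P(\varphi f)$. $\varphi$ is $\mathrm{U}(n)$-invariant if $\varphi(A^{-1}z)=\varphi(z)$ (as elements of $L^\infty(\mathbb{C}^n)$) for all $A\in\mathrm{U}(n)$; it is well known that this holds if and only if there is a (measurable) function $\mathbf{a}_\varphi:\mathbb{R}^+\to\mathbb{C}$ with $\varphi(z)=\mathbf{a}_\varphi(|z|)$ for almost every $z$. $P^m(\mathbb{C}^n)\subset\mathcal{A}_h(\mathbb{C}^n)$ is the space of homogeneous holomorphic polynomials of degree $m$, and $\mathrm{I}$ is the identity operator. *)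

(* Defs.v *)
From HB Require Import structures.
From mathcomp Require Import all_boot all_order all_algebra.
From mathcomp Require Import complex.
From mathcomp Require Import -(notations) mpoly.
From mathcomp Require Import all_classical all_reals all_analysis.
From mathcomp Require Import ess_sup_inf.

(* Over MathComp-Analysis. mpoly is imported without its notations, which clash
   with those of MathComp-Analysis. *)

Set Implicit Arguments.
Unset Strict Implicit.
Unset Printing Implicit Defensive.

Import Order.TTheory GRing.Theory Num.Theory.
Import numFieldNormedType.Exports.

Local Open Scope classical_set_scope.
Local Open Scope complex_scope.
Local Open Scope ring_scope.

(* The library puts a topology and a norm on abstract numFieldTypes and on the
   alias R[i]^o, but not on R[i] itself; without these instances 'cV[R[i]]_n is
   not a normed space over R[i]. *)
#[non_forgetful_inheritance]
HB.instance Definition _ (R : realType) := PseudoPointedMetric.copy R[i] R[i]^o.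
#[non_forgetful_inheritance]
HB.instance Definition _ (R : realType) := GRing.ComAlgebra.copy R[i] R[i]^o.
#[non_forgetful_inheritance]
HB.instance Definition _ (R : realType) := Vector.copy R[i] R[i]^o.
#[non_forgetful_inheritance]
HB.instance Definition _ (R : realType) := NormedModule.copy R[i] R[i]^o.
HB.instance Definition _ (R : realType) := Num.ClosedField.on R[i].

Section LebesgueMeasureCn.
Variable R : realType.

Local Notation Rb := (measurableTypeR R).
Local Notation lambda1 := (@lebesgue_measure R).

Definition cons_pair n (p : n.-tuple (Rb * Rb) * Rb * Rb) :
    n.+1.-tuple (Rb * Rb)%type :=
  [tuple of (p.1.2, p.2) :: p.1.1].

Lemma measurable_cons_pair n : measurable_fun setT (@cons_pair n).
Proof.
apply: measurable_cons.
  apply: measurable_fun_pair => //.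
  exact: (measurableT_comp measurable_snd measurable_fst).
exact: (measurableT_comp measurable_fst measurable_fst).
Qed.

(* The product Lebesgue measure on the Borel sets of (R x R)^n. The long
   constant is the measure structure of a pushforward; it has to be named
   because it takes the measurability proof as an argument. *)
Fixpoint product_lebesgue (n : nat) :
    {measure set (n.-tuple (Rb * Rb)%type) -> \bar R} :=
  match n with
  | 0%N => \d_ [tuple]
  | n'.+1 => measure_function_pushforward__canonical__measure_function_Measure
      (product_lebesgue n' \x lambda1 \x lambda1)%E (@measurable_cons_pair n')
  end.

Variable n : nat.

Definition Cn_of_pairs (t : n.-tuple (Rb * Rb)%type) : 'cV[R[i]]_n :=
  \col_j (((tnth t j).1 : R) +i* ((tnth t j).2 : R)).

Definition lebesgue_outer (A : set 'cV[R[i]]_n) : \bar R :=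
  (product_lebesgue n)^*%mu (Cn_of_pairs @^-1` A).

Let lebesgue_outer0 : lebesgue_outer set0 = 0%E.
Proof. by rewrite /lebesgue_outer preimage_set0 outer_measure0. Qed.

Let lebesgue_outer_ge0 A : (0 <= lebesgue_outer A)%E.
Proof. exact: outer_measure_ge0. Qed.

Let le_lebesgue_outer : {homo lebesgue_outer : A B / A `<=` B >-> (A <= B)%E}.
Proof. by move=> A B AB; apply: le_outer_measure => t /AB. Qed.

Let lebesgue_outer_sigma_subadditive : sigma_subadditive lebesgue_outer.
Proof.
move=> F; rewrite /lebesgue_outer preimage_bigcup.
exact: outer_measure_sigma_subadditive.
Qed.

HB.instance Definition _ := isOuterMeasure.Build R 'cV[R[i]]_n lebesgue_outer
  lebesgue_outer0 lebesgue_outer_ge0 le_lebesgue_outer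
  lebesgue_outer_sigma_subadditive.

(* C^n with the sigma-algebra of Lebesgue (not just Borel) measurable sets *)
Definition Cn : measurableType _ := caratheodory_type lebesgue_outer.

Definition lebesgue_Cn : set Cn -> \bar R := lebesgue_outer.

Let lebesgue_Cn0 : lebesgue_Cn set0 = 0%E.
Proof. exact: lebesgue_outer0. Qed.

Let lebesgue_Cn_ge0 A : (0 <= lebesgue_Cn A)%E.
Proof. exact: lebesgue_outer_ge0. Qed.

Let lebesgue_Cn_semi_sigma_additive : semi_sigma_additive lebesgue_Cn.
Proof. by move=> F mF tF mUF; exact: caratheodory_measure_sigma_additive. Qed.

HB.instance Definition _ := isMeasure.Build _ _ _ lebesgue_Cn
  lebesgue_Cn0 lebesgue_Cn_ge0 lebesgue_Cn_semi_sigma_additive.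

End LebesgueMeasureCn.

Arguments lebesgue_Cn : clear implicits.

(* The real line with the sigma-algebra of Lebesgue measurable sets, i.e. the
   domain of completed_lebesgue_measure *)
Definition lebesgueTypeR (R : realType) : measurableType _ :=
  caratheodory_type ((@wlength R idfun)^*)%mu.

Section ComplexIntegration.
Context d (T : measurableType d) (R : realType).
Variable mu : {measure set T -> \bar R}.

Definition cmeasurable_fun (D : set T) (f : T -> R[i]) : Prop :=
  measurable_fun D (fun x => complex.Re (f x)) /\
  measurable_fun D (fun x => complex.Im (f x)).

Definition cintegral (D : set T) (f : T -> R[i]) : R[i] :=
  (\int[mu]_(x in D) complex.Re (f x)) +i*
  (\int[mu]_(x in D) complex.Im (f x)).

End ComplexIntegration.

Section FockSpace.
Variables (R : realType) (n : nat) (h : R -> R).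

Implicit Types (f g phi : 'cV[R[i]]_n -> R[i]) (z : 'cV[R[i]]_n).

(* The Euclidean norm: the library norm on 'cV[R[i]]_n is the sup norm. *)
Definition enorm z : R := Num.sqrt (\sum_j ComplexField.Normc.normc (z j 0) ^+ 2).

Definition weight z : R := expR (- 2 * h (enorm z)).

(* L^2_h, Linfty and the Fock space are given as sets of functions; equality of
   classes is equality almost everywhere. *)
Definition L2h : set ('cV[R[i]]_n -> R[i]) :=
  [set f | cmeasurable_fun [set: Cn R n] f /\
    (\int[lebesgue_Cn R n]_z (ComplexField.Normc.normc (f z) ^+ 2 * weight z)%:E
       < +oo)%E].

Definition inner_h f g : R[i] :=
  cintegral (lebesgue_Cn R n) setT (fun z => f z * (g z)^* * (weight z)%:C).

Definition Linfty : set ('cV[R[i]]_n -> R[i]) :=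
  [set phi | cmeasurable_fun [set: Cn R n] phi /\
    (ess_sup (lebesgue_Cn R n) (fun z => (ComplexField.Normc.normc (phi z))%:E)
       < +oo)%E].

(* differentiable is Frechet differentiability over the scalar field R[i] *)
Definition entire f : Prop := forall z, differentiable f z.

Definition fock : set ('cV[R[i]]_n -> R[i]) := [set f | entire f /\ L2h f].

(* Two entire functions equal almost everywhere are equal, so the entire
   representative of the orthogonal projection is unique; the default value of
   xget is irrelevant on L^2_h. *)
Definition fock_projection f : 'cV[R[i]]_n -> R[i] :=
  xget (fun=> 0)
    [set g | fock g /\ forall k, fock k -> inner_h (fun z => f z - g z) k = 0].

Definition toeplitz phi f : 'cV[R[i]]_n -> R[i] :=
  fock_projection (fun z => phi z * f z).

Definition homog_poly (m : nat) : set ('cV[R[i]]_n -> R[i]) :=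
  [set f | exists2 p : mpoly n R[i],
    p \is ishomog1 m mdeg &
    f = (fun z => meval (fun j => z j 0) p)].

Definition unitary_invariant phi : Prop :=
  forall A : 'M[R[i]]_n, A \is unitarymx ->
    {ae lebesgue_Cn R n, forall z, phi (invmx A *m z) = phi z}.

End FockSpace.

Definition eigenvalue_h (R : realType) (n : nat) (h : R -> R) (a : R -> R[i])
    (m : nat) : R[i] :=
  let w (r : R) : R := r ^+ (2 * m + 2 * n - 1) * expR (- 2 * h r) in
  cintegral (@completed_lebesgue_measure R) `[0, +oo[
    (fun r => a r * (w r)%:C) /
  (\int[@completed_lebesgue_measure R]_(r in `[0, +oo[) w r)%:C.

(* Main.v *)
Require Import Defs.
From HB Require Import structures.
From mathcomp Require Import all_boot all_order all_algebra.
From mathcomp Require Import complex.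
From mathcomp Require Import -(notations) mpoly.
From mathcomp Require Import all_classical all_reals all_analysis.
From mathcomp Require Import ess_sup_inf measurable_realfun.
From mathcomp Require Import ring lra zify.

(* It suffices to show that (phi - lambda) p is orthogonal to every k in the
   Fock space. Write q = p k^bar. Since k is entire and p is homogeneous of
   degree m, the average of q over the circle {e^{it} z} is homogeneous of degree
   2m under real dilations: after removing |e^{zeta}|^{2m}, it is the integral over
   a period of the holomorphic function k(e^zeta z) e^{-m zeta}, which by Goursat's
   theorem does not depend on Re zeta. Measures are invariant under z -> e^{it} z,
   so q can be replaced by this average, and a homogeneous density of degree 2m
   integrates radial functions like C r^{2m+2n-1} dr. Hence the inner product
   is C times the integral of (a - lambda) r^{2m+2n-1} e^{-2h}, which is 0 by the
   choice of lambda. Neither the monomial basis nor its orthogonality is used. *)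

Set Implicit Arguments.
Unset Strict Implicit.
Unset Printing Implicit Defensive.

Import Order.TTheory GRing.Theory Num.Theory.
Import numFieldNormedType.Exports.
Import ComplexField.Normc.

Local Open Scope classical_set_scope.
Local Open Scope complex_scope.
Local Open Scope ring_scope.

(** * Lebesgue measure on C^n *)

(** [entire] asserts differentiability at each point and nothing about the derivative as a function,
    so bisection of rectangles is the tool that turns it into an equality of integrals. The polar
    formula compares positive measures, whereas the circle average is signed; its positive and
    negative parts are again homogeneous, and each is pushed forward under the norm, its constant
    being fixed by the mass of the unit ball. The resulting C depends on p and k but not on the
    radial factor, which is why a and lambda can be compared under it. A second obstacle is the
    presence of two sigma-algebras. Tonelli and the uniqueness of measures work on Borel sets of
    real coordinates, while phi and a are only Lebesgue measurable. Hence a is replaced by bounded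
    Borel functions b1 + i b2 of the radius, and null sets of radii are matched with null sets of
    C^n in both directions. The projection enters only through its characterisation: lambda p lies
    in the Fock space, (phi - lambda) p is orthogonal to that space, and at most one entire function
    has both properties. *)

Section LebesgueAffine.
Context {R : realType}.
Local Notation Rb := (measurableTypeR R).
Local Notation lambda := (@lebesgue_measure R).

Lemma measurable_affine (a b : R) :
  measurable_fun [set: Rb] ((fun x => a * x + b) : Rb -> Rb).
Proof. by apply: measurable_funD => //; exact: measurable_funM. Qed.

(** The intervals []u, v]] are those on which [lebesgue_measure_unique] tests a measure. A negative
    a reverses the order, so the preimage is closed at the other end; its length is not affected. *)
Lemma preimage_affine_itv (a b u v : R) : a != 0 ->
  lambda ((fun x => a * x + b) @^-1` `]u, v]) =
  ((`|a|^-1)%:E * lambda `]u, v]%classic)%E.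
Proof.
move=> a0.
have := a0; rewrite neq_lt => /orP[an|ap].
- rewrite (_ : _ @^-1` _ = `[(v - b) / a, (u - b) / a[%classic); last first.
    apply/seteqP; split => x /=; rewrite !in_itv/= ler_ndivrMr// ltr_ndivlMr//;
      by move=> /andP[? ?]; apply/andP; split; lra.
  rewrite !lebesgue_measure_itv/= !lte_fin.
  rewrite ltr_ndivrMr// divfK// ltrD2r.
  case: ifPn => uv; last by rewrite mule0.
  rewrite -EFinD -EFinD -EFinM; congr EFin.
  by rewrite ltr0_norm//; field.
- rewrite (_ : _ @^-1` _ = `](u - b) / a, (v - b) / a]%classic); last first.
    apply/seteqP; split => x /=; rewrite !in_itv/= ler_pdivlMr// ltr_pdivrMr//;
      by move=> /andP[? ?]; apply/andP; split; lra.
  rewrite !lebesgue_measure_itv/= !lte_fin.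
  rewrite ltr_pdivlMr// divfK// ltrD2r.
  case: ifPn => uv; last by rewrite mule0.
  rewrite -EFinD -EFinD -EFinM; congr EFin.
  by rewrite gtr0_norm//; field.
Qed.

(** [|a|] times the pushforward of Lebesgue measure under the affine map agrees with Lebesgue
    measure on half-open intervals, hence equals it. *)
Lemma lebesgue_measure_affine (a b : R) (A : set Rb) : a != 0 -> measurable A ->
  lambda ((fun x => a * x + b) @^-1` A) = ((`|a|^-1)%:E * lambda A)%E.
Proof.
move=> a0 mA.
have na : 0 <= `|a| by [].
pose nu := measure_function_pushforward__canonical__measure_function_Measure
  lambda (measurable_affine a b).
pose k : {nonneg R} := NngNum na.
have -> : lambda A = mscale k nu A.
  apply: (@lebesgue_measure_unique R (mscale k nu)) => //= _ [[u v]] _ <-.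
  rewrite /mscale/= /pushforward preimage_affine_itv// muleA -EFinM.
  by rewrite divff ?normr_eq0// mul1e.
rewrite /mscale/= /pushforward muleA -EFinM mulVf ?normr_eq0// mul1e//.
Qed.

Lemma ge0_integral_affine (a b : R) (f : R -> \bar R) : a != 0 ->
  measurable_fun [set: Rb] f -> (forall x, 0 <= f x)%E ->
  (\int[lambda]_x f (a * x + b)%R = (`|a|^-1)%:E * \int[lambda]_x f x)%E.
Proof.
move=> a0 mf f0.
have na : 0 <= `|a|^-1 by rewrite invr_ge0.
pose k : {nonneg R} := NngNum na.
rewrite -[RHS](@ge0_integral_mscale _ _ _ lambda setT _ k)//.
have /= := @ge0_integral_pushforward _ _ Rb Rb R _
  (measurable_affine a b) lambda setT f measurableT mf (fun y _ => f0 y).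
rewrite preimage_setT => <-.
apply: (eq_measure_integral (mscale k lambda)) => [|mp A mA _].
  exact: measurable_affine.
exact: (lebesgue_measure_affine _ a0 mA).
Qed.

(** Multiplication by a + ib is a real linear map of determinant a^2 + b^2. Tonelli reduces it to
    affine substitutions in one variable at a time. *)
Lemma ge0_integral_complex_mul (a b : R) (g : R * R -> \bar R) :
  a ^+ 2 + b ^+ 2 != 0 ->
  measurable_fun [set: (Rb * Rb)%type] g -> (forall x, 0 <= g x)%E ->
  (\int[lambda]_x \int[lambda]_y g (a * x - b * y, b * x + a * y)%R =
   ((a ^+ 2 + b ^+ 2)^-1)%:E * \int[lambda]_x \int[lambda]_y g (x, y))%E.
Proof.
move=> ab0 mg g0.
have mgx (f1 f2 : Rb * Rb -> Rb) : measurable_fun setT f1 ->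
    measurable_fun setT f2 ->
    measurable_fun [set: (Rb * Rb)%type] (fun z => g (f1 z, f2 z)).
  by move=> m1 m2; apply: (measurableT_comp mg); exact: measurable_fun_pair.
have mX (c d : R) : measurable_fun [set: (Rb * Rb)%type]
    ((fun z => c * z.1 + d * z.2) : Rb * Rb -> Rb).
  by apply: measurable_funD; exact: measurable_funM.
have m2 (f1 f2 : Rb -> Rb) : measurable_fun setT f1 ->
    measurable_fun setT f2 -> measurable_fun [set: Rb] (fun z => g (f1 z, f2 z)).
  by move=> h1 h2; apply: (measurableT_comp mg); exact: measurable_fun_pair.
have ml c d : measurable_fun [set: Rb] ((fun x => c * x + d) : Rb -> Rb).
  exact: measurable_affine.
(* For a = 0 the map exchanges the two axes up to scale and sign, so the order of integration is
   swapped between the two substitutions. *)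
have [a0|a0] := eqVneq a 0.
  have b0 : b != 0 by apply: contraNneq ab0 => ->; rewrite a0 expr0n/= addr0.
  transitivity (\int[lambda]_x ((`|b|^-1)%:E * \int[lambda]_y g (y, b * x)%R))%E.
    apply: eq_integral => x _.
    rewrite -normrN -(@ge0_integral_affine (- b) 0 (fun y => g (y, b * x))) ?oppr_eq0//.
      by apply: eq_integral => y _; rewrite a0; congr (g (_, _)); ring.
    by apply: m2 => //.
  rewrite ge0_integralZl//; first last.
  - by move=> x _; exact: integral_ge0.
  - have := @measurable_fun_fubini_tonelli_F _ _ Rb Rb R lambda
        (fun z => g (z.2, b * z.1)) _ (fun z => g0 _).
    apply; apply: mgx => //.
    by rewrite (_ : (fun _ => _) = (fun z : Rb * Rb => b * z.1 + 0 * z.2))//;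
      apply/funext => z; rewrite mul0r addr0.
  have := @fubini_tonelli _ _ Rb Rb R lambda lambda
     (fun z => g (z.2, b * z.1)) _ (fun z => g0 _).
  rewrite /= => ->; last first.
    apply: mgx => //.
    by rewrite (_ : (fun _ => _) = (fun z : Rb * Rb => b * z.1 + 0 * z.2))//;
      apply/funext => z; rewrite mul0r addr0.
  transitivity ((`|b|^-1)%:E * \int[lambda]_y ((`|b|^-1)%:E * \int[lambda]_x g (y, x)%R))%E.
    congr (_ * _)%E; apply: eq_integral => y _.
    rewrite -(@ge0_integral_affine b 0 (fun x => g (y, x)))//.
      by apply: eq_integral => x _; rewrite addr0.
    exact: m2.
  rewrite ge0_integralZl//; first last.
  - by move=> x _; exact: integral_ge0.
  - exact: measurable_fun_fubini_tonelli_F.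
  rewrite muleA -EFinM -invfM; congr (_%:E * _)%E.
  by rewrite a0 -normrM ger0_norm -?expr2 ?sqr_ge0// expr0n/= add0r.
have := @fubini_tonelli _ _ Rb Rb R lambda lambda
   (fun z => g (a * z.1 - b * z.2, b * z.1 + a * z.2)) _ (fun z => g0 _).
rewrite /= => ->; last first.
  apply: mgx => //.
  by rewrite (_ : (fun _ => _) = (fun z : Rb * Rb => a * z.1 + (- b) * z.2))//;
      apply/funext => z; rewrite mulNr.
(* With u = a x - b y in place of x, the second coordinate b x + a y becomes (b / a) u + ((a^2 +
   b^2) / a) y. The scales a and (a^2 + b^2) / a multiply to the determinant. *)
transitivity (\int[lambda]_y ((`|a|^-1)%:E * \int[lambda]_x
    g (x, (b / a) * x + ((a ^+ 2 + b ^+ 2) / a) * y)%R))%E.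
  apply: eq_integral => y _.
  rewrite -(@ge0_integral_affine a (- (b * y))
    (fun x => g (x, (b / a) * x + ((a ^+ 2 + b ^+ 2) / a) * y)))//.
    by apply: eq_integral => x _; congr (g (_, _)); field.
  by apply: m2.
have mk : measurable_fun [set: (Rb * Rb)%type]
    (fun z => g (z.1, (b / a) * z.1 + ((a ^+ 2 + b ^+ 2) / a) * z.2)).
  exact: mgx.
have mk' : measurable_fun [set: (Rb * Rb)%type]
    (fun z => g (z.2, (b / a) * z.2 + ((a ^+ 2 + b ^+ 2) / a) * z.1)).
  apply: mgx => //.
  by under eq_fun do rewrite addrC; exact: mX.
rewrite ge0_integralZl//; first last.
- by move=> x _; exact: integral_ge0.
- have := @measurable_fun_fubini_tonelli_F _ _ Rb Rb R lambda
    (fun z => g (z.2, (b / a) * z.2 + ((a ^+ 2 + b ^+ 2) / a) * z.1)) _ (fun z => g0 _).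
  exact.
have := @fubini_tonelli _ _ Rb Rb R lambda lambda
   (fun z => g (z.1, (b / a) * z.1 + ((a ^+ 2 + b ^+ 2) / a) * z.2)) mk (fun z => g0 _).
rewrite /= => <-.
transitivity ((`|a|^-1)%:E * \int[lambda]_x
   ((`|(a ^+ 2 + b ^+ 2) / a|^-1)%:E * \int[lambda]_y g (x, y)%R))%E.
  congr (_ * _)%E; apply: eq_integral => x _.
  rewrite -(@ge0_integral_affine ((a ^+ 2 + b ^+ 2) / a) ((b / a) * x) (fun y => g (x, y)))//.
  - by apply: eq_integral => y _; rewrite addrC.
  - by rewrite mulf_neq0// invr_neq0.
  - exact: m2.
rewrite ge0_integralZl//; first last.
- by move=> x _; exact: integral_ge0.
- exact: measurable_fun_fubini_tonelli_F.
rewrite muleA -EFinM; congr (_%:E * _)%E.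
rewrite normf_div invf_div mulrA mulVf ?normr_eq0// mul1r ger0_norm//.
by rewrite addr_ge0 ?sqr_ge0.
Qed.

End LebesgueAffine.

Section TupleLebesgue.
Context {R : realType}.
Local Notation Rb := (measurableTypeR R).
Local Notation lambda := (@lebesgue_measure R).
Local Notation Tn n := (n.-tuple (Rb * Rb)%type).

(** A constant of its own, to which the sigma-finite structure is attached. *)
Definition tuple_lebesgue n : set (Tn n) -> \bar R := product_lebesgue R n.

HB.instance Definition _ n :=
  Measure.copy (@tuple_lebesgue n) (product_lebesgue R n).

(** Cubes in real coordinates. They give sigma-finiteness, bound the unit ball from inside and from
    outside, and serve as neighbourhoods of positive measure. *)
Definition tuple_box n (c : Tn n) (d : R) : set (Tn n) :=
  [set t | forall j, (tnth c j).1 - d <= (tnth t j).1 <= (tnth c j).1 + d /\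
                     (tnth c j).2 - d <= (tnth t j).2 <= (tnth c j).2 + d].

Lemma measurable_tuple_box n (c : Tn n) d : measurable (tuple_box c d).
Proof.
have -> : tuple_box c d = \bigcap_(j in [set: 'I_n])
    ((fun t => tnth t j) @^-1` (`[(tnth c j).1 - d, (tnth c j).1 + d] `*`
       `[(tnth c j).2 - d, (tnth c j).2 + d])).
  apply/seteqP; split => t /=.
    by move=> tb j _ /=; rewrite !in_itv/=; exact: tb.
  by move=> tb j; have /= := tb j I; rewrite !in_itv/=.
apply: fin_bigcap_measurable => // j _.
rewrite -[X in measurable X]setTI; apply: measurable_tnth => //.
by apply: measurableX; exact: measurable_itv.
Qed.

Lemma tuple_lebesgue_box n (c : Tn n) d : 0 <= d ->
  tuple_lebesgue (tuple_box c d) = (((d *+ 2) ^+ 2) ^+ n)%:E.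
Proof.
move=> d0; elim: n => [|n IH] in c *.
  rewrite /tuple_lebesgue/= diracE expr0.
  by rewrite mem_set// => -[].
have lI (x : R) : lambda `[x - d, x + d]%classic = (d *+ 2)%:E.
  rewrite lebesgue_measure_itv/= lte_fin.
  case: ltP => h; rewrite -?EFinB; congr EFin; lra.
case/tupleP: c => c0 c.
rewrite /tuple_lebesgue/= /pushforward.
have -> : @cons_pair R n @^-1` tuple_box [tuple of c0 :: c] d =
    ((tuple_box c d `*` `[c0.1 - d, c0.1 + d]) `*` `[c0.2 - d, c0.2 + d]).
  apply/seteqP; split => -[[t x] y] /=; rewrite !in_itv/=.
    move=> tb; split; last by have [_] := tb ord0.
    split; last by have [] := tb ord0.
    move=> j; have := tb (lift ord0 j).
    by rewrite !tnthS.
  move=> [[tb xb] yb] j; case: (unliftP ord0 j) => [k|] -> //.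
  by rewrite !tnthS; exact: tb.
rewrite product_measure1E//; last first.
  by apply: measurableX => //; exact: measurable_tuple_box.
rewrite [X in (X * _)%E]product_measure1E//; last exact: measurable_tuple_box.
have := IH c; rewrite /tuple_lebesgue => ->.
transitivity (((d *+ 2) ^+ 2 ^+ n)%:E * (d *+ 2)%:E * (d *+ 2)%:E)%E.
  by congr (_ * _ * _)%E; exact: lI.
by rewrite -!EFinM -mulrA -expr2 -exprSr.
Qed.

Definition tuple_origin n : Tn n := [tuple of nseq n (0 : R, 0 : R)].

Lemma sigma_finite_tuple_lebesgue n : sigma_finite setT (@tuple_lebesgue n).
Proof.
exists (fun k : nat => tuple_box (tuple_origin n) k%:R).
  apply/seteqP; split => // t _.
  (* M dominates every coordinate of t, so the cube of half side an integer above M contains t. *)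
  pose M := \sum_(j < n) (`|(tnth t j).1| + `|(tnth t j).2|).
  exists (Num.truncn M).+1 => // j.
  have Mj : `|(tnth t j).1| + `|(tnth t j).2| <= M.
    rewrite /M (bigD1 j)//= lerDl sumr_ge0// => k _; exact: addr_ge0.
  have MN : M < (Num.truncn M).+1%:R by exact: truncnS_gt.
  have := normr_ge0 (tnth t j).1; have := normr_ge0 (tnth t j).2.
  rewrite tnth_nseq/= => h1 h2; split; rewrite sub0r add0r -ler_norml; lra.
move=> k; split; first exact: measurable_tuple_box.
by rewrite tuple_lebesgue_box// ltry.
Qed.

HB.instance Definition _ n := Measure_isSigmaFinite.Build _ _ _
  (@tuple_lebesgue n) (sigma_finite_tuple_lebesgue n).

(* Product measures carry no canonical sigma-finite instance; this name holds
   one. *)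
Definition tuple_line_lebesgue n : set (Tn n * Rb) -> \bar R :=
  (@tuple_lebesgue n \x lambda)%E.

HB.instance Definition _ n :=
  Measure.copy (@tuple_line_lebesgue n) (@tuple_lebesgue n \x lambda)%E.

Lemma sigma_finite_tuple_line_lebesgue n :
  sigma_finite setT (@tuple_line_lebesgue n).
Proof.
have /sigma_finiteP[F [TF ndF Foo]] := @sigma_finite_tuple_lebesgue n.
have /sigma_finiteP[G [TG ndG Goo]] := sigma_finiteT lambda.
exists (fun k => F k `*` G k).
  apply/seteqP; split => // -[t x] _.
  have /= [i _ Fi] : (\bigcup_k F k) t by rewrite -TF.
  have /= [j _ Gj] : (\bigcup_k G k) x by rewrite -TG.
  exists (maxn i j) => //; split => /=.
    by move: t Fi; exact/subsetPset/ndF/leq_maxl.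
  by move: x Gj; exact/subsetPset/ndG/leq_maxr.
move=> k; have [mF Fk] := Foo k; have [mG Gk] := Goo k.
split; first exact: measurableX.
rewrite /tuple_line_lebesgue product_measure1E//.
by rewrite lte_mul_pinfty// ge0_fin_numE.
Qed.

HB.instance Definition _ n := Measure_isSigmaFinite.Build _ _ _
  (@tuple_line_lebesgue n) (sigma_finite_tuple_line_lebesgue n).

End TupleLebesgue.

Section TupleIntegral.
Context {R : realType}.
Local Notation Rb := (measurableTypeR R).
Local Notation lambda := (@lebesgue_measure R).
Local Notation Tn n := (n.-tuple (Rb * Rb)%type).

(** [product_lebesgue] is a pushforward of (tuples x line) x line, so Tonelli is applied twice, the
    first time with [tuple_line_lebesgue] as left factor. *)
Lemma ge0_integral_tuple_lebesgueS n (f : Tn n.+1 -> \bar R) :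
  measurable_fun setT f -> (forall t, 0 <= f t)%E ->
  (\int[@tuple_lebesgue R n.+1]_t f t =
   \int[@tuple_lebesgue R n]_t \int[lambda]_x \int[lambda]_y
     f [tuple of (x, y) :: t])%E.
Proof.
move=> mf f0.
have mfc : measurable_fun [set: (Tn n * Rb * Rb)%type] (f \o @cons_pair R n).
  by apply: measurableT_comp => //; exact: measurable_cons_pair.
transitivity (\int[(@tuple_lebesgue R n \x lambda \x lambda)%E]_p
    (f (@cons_pair R n p)))%E.
  have /= := @ge0_integral_pushforward _ _ _ _ R _
   (@measurable_cons_pair R n) (@tuple_lebesgue R n \x lambda \x lambda)%E
   setT f measurableT mf (fun y _ => f0 y).
  by rewrite preimage_setT => <-.
have fc0 p : (0 <= (f \o @cons_pair R n) p)%E by exact: f0.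
have mF := measurable_fun_fubini_tonelli_F (m2 := lambda) _ mfc fc0.
have F0 p : (0 <= fubini_F lambda (f \o @cons_pair R n) p)%E.
  by apply: integral_ge0 => y _; exact: f0.
have e1 := @fubini_tonelli1 _ _ _ _ R
  (@tuple_line_lebesgue R n) lambda _ mfc fc0.
have e2 := @fubini_tonelli1 _ _ _ _ R (@tuple_lebesgue R n) lambda _ mF F0.
exact: etrans e1 e2.
Qed.

(** Multiplication by the scalar a + ib in real coordinates: b = 0 gives the real dilations, (cos,
    sin) the rotations. *)
Definition tuple_mul n (a b : R) (t : Tn n) : Tn n :=
  [tuple of map (fun p => (a * p.1 - b * p.2, b * p.1 + a * p.2)) t].

Lemma measurable_complex_mul (a b : R) : measurable_fun [set: (Rb * Rb)%type]
  ((fun p => (a * p.1 - b * p.2, b * p.1 + a * p.2)) : Rb * Rb -> Rb * Rb).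
Proof.
apply: measurable_fun_pair.
  by apply: measurable_funB; exact: measurable_funM.
by apply: measurable_funD; exact: measurable_funM.
Qed.

Lemma measurable_tuple_mul n (a b : R) : measurable_fun setT (@tuple_mul n a b).
Proof.
apply/measurable_fun_tnthP => j.
rewrite (_ : _ \o _ = (fun p => (a * p.1 - b * p.2, b * p.1 + a * p.2)) \o
   (fun t : Tn n => tnth t j)); last by apply/funext => t /=; rewrite tnth_map.
apply: measurableT_comp; first exact: measurable_complex_mul.
exact: measurable_tnth.
Qed.

(** Each complex coordinate contributes one planar Jacobian; induction peels off the head of the
    tuple. *)
Lemma ge0_integral_tuple_mul n (a b : R) (f : Tn n -> \bar R) :
  a ^+ 2 + b ^+ 2 != 0 ->
  measurable_fun setT f -> (forall t, 0 <= f t)%E ->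
  (\int[@tuple_lebesgue R n]_t f (tuple_mul a b t) =
   (((a ^+ 2 + b ^+ 2)^-1) ^+ n)%:E * \int[@tuple_lebesgue R n]_t f t)%E.
Proof.
move=> ab0; elim: n f => [|n IH] f mf f0.
  rewrite expr0 mul1e; apply: eq_integral => t _.
  by congr f; rewrite tuple0 [RHS]tuple0.
have c0 : 0 <= (a ^+ 2 + b ^+ 2)^-1 by rewrite invr_ge0 addr_ge0 ?sqr_ge0.
have mfm : measurable_fun setT (f \o @tuple_mul n.+1 a b).
  by apply: measurableT_comp => //; exact: measurable_tuple_mul.
rewrite [LHS](ge0_integral_tuple_lebesgueS mfm); last by move=> t; exact: f0.
rewrite [X in (_ * X)%E](ge0_integral_tuple_lebesgueS mf)//.
pose F (t : Tn n) := (\int[lambda]_x \int[lambda]_y f [tuple of (x, y) :: t])%E.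
have mF : measurable_fun setT F.
  have h : measurable_fun [set: (Tn n * Rb * Rb)%type] (f \o @cons_pair R n).
    by apply: measurableT_comp => //; exact: measurable_cons_pair.
  have h1 := measurable_fun_fubini_tonelli_F (m2 := lambda) _ h (fun t => f0 _).
  apply: (measurable_fun_fubini_tonelli_F (m2 := lambda) _ h1) => t.
  by apply: integral_ge0 => y _; exact: f0.
have F0 t : (0 <= F t)%E by apply: integral_ge0 => x _; apply: integral_ge0.
transitivity (\int[@tuple_lebesgue R n]_t (((a ^+ 2 + b ^+ 2)^-1)%:E *
    F (tuple_mul a b t)))%E.
  apply: eq_integral => t _ /=.
  have mft : measurable_fun [set: (Rb * Rb)%type]
      (fun p => f [tuple of p :: tuple_mul a b t]).
    by apply: (measurableT_comp mf); exact: measurable_cons.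
  have := @ge0_integral_complex_mul R a b _ ab0 mft (fun p => f0 _).
  apply: etrans; apply: eq_integral => x _; apply: eq_integral => y _.
  by congr f; exact/val_inj.
have mFm : measurable_fun setT (F \o @tuple_mul n a b).
  by apply: (measurableT_comp mF); exact: measurable_tuple_mul.
transitivity (((a ^+ 2 + b ^+ 2)^-1)%:E *
    \int[@tuple_lebesgue R n]_t F (tuple_mul a b t))%E.
  exact: (@ge0_integralZl_EFin _ _ _ (@tuple_lebesgue R n) setT measurableT
    _ (fun t _ => F0 (tuple_mul a b t)) mFm _ c0).
by rewrite (IH F mF F0) muleA -EFinM -exprS.
Qed.

End TupleIntegral.

(** * Transfer of integrals from [Cn R n] to real coordinates *)

Section CnTransfer.
Context {R : realType} (n : nat).
Local Notation Rb := (measurableTypeR R).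
Local Notation Tn := (n.-tuple (Rb * Rb)%type).
Local Notation mun := (@tuple_lebesgue R n).
Local Notation muC := (lebesgue_Cn R n).

Definition pairs_of_Cn (z : 'cV[R[i]]_n) : Tn :=
  [tuple (complex.Re (z j 0), complex.Im (z j 0)) | j < n].

Lemma pairs_of_CnK : cancel pairs_of_Cn (@Cn_of_pairs R n).
Proof.
move=> z; apply/matrixP => i j; rewrite ord1 !mxE tnth_mktuple /=.
by case: (z i 0).
Qed.

Lemma Cn_of_pairsK : cancel (@Cn_of_pairs R n) pairs_of_Cn.
Proof.
move=> t; apply: eq_from_tnth => j; rewrite tnth_mktuple !mxE/=.
by case: (tnth t j).
Qed.

Lemma preimage_pairs_of_Cn A :
  @Cn_of_pairs R n @^-1` (pairs_of_Cn @^-1` A) = A.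
Proof. by apply/seteqP; split => t /=; rewrite Cn_of_pairsK. Qed.

(** The outer measure on C^n is transported from the outer extension of [product_lebesgue], for
    which Borel sets are Caratheodory measurable. *)
Lemma measurable_pairs_of_Cn :
  measurable_fun [set: Cn R n] (pairs_of_Cn : Cn R n -> Tn).
Proof.
move=> _ A mA; rewrite setTI.
suff : caratheodory_measurable (@lebesgue_outer R n) (pairs_of_Cn @^-1` A).
  by [].
move=> X; rewrite /lebesgue_outer !preimage_setI preimage_setC.
rewrite !preimage_pairs_of_Cn.
have mA' : (<<s measurable >>) A by exact: sub_sigma_algebra.
have h := sub_caratheodory mun mA' (@Cn_of_pairs R n @^-1` X).
exact: h.
Qed.

Lemma lebesgue_Cn_pairs A : measurable A -> muC (pairs_of_Cn @^-1` A) = mun A.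
Proof.
move=> mA; rewrite /lebesgue_Cn /lebesgue_outer preimage_pairs_of_Cn.
exact: (measurable_mu_extE mun).
Qed.

(** The pushforward of [lebesgue_Cn] to tuples is the product measure. Borel integrands on C^n are
    thereby moved to where Tonelli applies. *)
Lemma ge0_integral_Cn (f : Tn -> \bar R) : measurable_fun setT f ->
  (forall t, 0 <= f t)%E ->
  (\int[muC]_z f (pairs_of_Cn z) = \int[mun]_t f t)%E.
Proof.
move=> mf f0.
have /= := @ge0_integral_pushforward _ _ (Cn R n) _ R _
  measurable_pairs_of_Cn muC setT f measurableT mf (fun y _ => f0 y).
rewrite preimage_setT => <-.
apply: eq_measure_integral => [|mp A mA _].
  exact: measurable_pairs_of_Cn.
exact: lebesgue_Cn_pairs.
Qed.

Lemma integral_Cn (f : Tn -> \bar R) : measurable_fun setT f ->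
  (\int[muC]_z f (pairs_of_Cn z) = \int[mun]_t f t)%E.
Proof.
move=> mf; rewrite -[LHS]/(\int[muC]_z (f \o pairs_of_Cn) z)%E.
rewrite integralE [RHS]integralE.
have mp : measurable_fun setT f^\+%E by exact: measurable_funepos.
have mn : measurable_fun setT f^\-%E by exact: measurable_funeneg.
rewrite -(ge0_integral_Cn mp (funepos_ge0 f)).
rewrite -(ge0_integral_Cn mn (funeneg_ge0 f)).
by rewrite funepos_comp funeneg_comp.
Qed.

End CnTransfer.

Section ComplexAux.
Context {R : realType}.
Implicit Types (x y z : R[i]) (e : R).

Lemma normC_normc z : `|z| = (normc z)%:C. Proof. by []. Qed.

Lemma normc_ge0 z : 0 <= normc z.
Proof. by case: z => a b; rewrite /= sqrtr_ge0. Qed.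

Lemma sqr_normc_ReIm z : normc z ^+ 2 = complex.Re z ^+ 2 + complex.Im z ^+ 2.
Proof. by case: z => a b /=; rewrite sqr_sqrtr// addr_ge0 ?sqr_ge0. Qed.

Lemma normRe_le z : `|complex.Re z| <= normc z.
Proof.
rewrite -(@ler_pXn2r _ 2)// ?nnegrE ?normc_ge0// sqr_normc_ReIm.
by rewrite real_normK ?num_real// lerDl sqr_ge0.
Qed.

Lemma normIm_le z : `|complex.Im z| <= normc z.
Proof.
rewrite -(@ler_pXn2r _ 2)// ?nnegrE ?normc_ge0// sqr_normc_ReIm.
by rewrite real_normK ?num_real// lerDr sqr_ge0.
Qed.

Lemma normc_le_ReIm z : normc z <= `|complex.Re z| + `|complex.Im z|.
Proof.
rewrite -(@ler_pXn2r _ 2)// ?nnegrE ?normc_ge0 ?addr_ge0//.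
rewrite sqr_normc_ReIm sqrrD !real_normK ?num_real//.
by rewrite -addrA lerD2l lerDr mulrn_wge0// mulr_ge0.
Qed.

Lemma ReB x y : complex.Re (x - y) = complex.Re x - complex.Re y.
Proof. by case: x y => [a b] [c d]. Qed.

Lemma ImB x y : complex.Im (x - y) = complex.Im x - complex.Im y.
Proof. by case: x y => [a b] [c d]. Qed.

Lemma ReM x y : complex.Re (x * y) =
  complex.Re x * complex.Re y - complex.Im x * complex.Im y.
Proof. by case: x y => [a b] [c d]. Qed.

Lemma ImM x y : complex.Im (x * y) =
  complex.Re x * complex.Im y + complex.Im x * complex.Re y.
Proof. by case: x y => [a b] [c d]. Qed.

Lemma normc_conj z : normc z^* = normc z.
Proof. by case: z => a b /=; rewrite sqrrN. Qed.

(** The crude bound x y <= x^2 + y^2 serves for integrability, in the shape expected by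
    [weighted_L2_dom]. *)
Lemma normRe_mul_conj_le c x y :
  `|complex.Re (c * (x * y^*))| <= normc c * (normc x ^+ 2 + normc y ^+ 2).
Proof.
apply: (le_trans (normRe_le _)); rewrite !normcM normc_conj ler_wpM2l ?normc_ge0//.
by have := normc_ge0 x; have := normc_ge0 y; nra.
Qed.

(** In the partial order of [R[i]], positivity forces the imaginary part to vanish; radii and
    tolerances of the topology of [R[i]] thus become real numbers. *)
Lemma gt0_complex_real x : 0 < x -> exists2 e, 0 < e & x = e%:C.
Proof.
case: x => a b; rewrite ltcE/= => /andP[/eqP -> a0]; exists a => //.
Qed.

(** By linearity over [R[i]] the differential is multiplication by its value at 1. The estimate with
    real tolerances can later be split into real and imaginary parts. *)
Lemma differentiableCP (F : R[i] -> R[i]) z : differentiable F z ->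
  exists d : R[i], forall e, 0 < e -> exists2 r, 0 < r &
   forall y, normc y < r -> normc (F (z + y) - F z - d * y) <= e * normc y.
Proof.
move=> dF; exists ('d F z 1) => e e0.
have := diff_locally dF; move/eqaddoP => /(_ e%:C).
rewrite ltcR => /(_ e0) /nbhs_ballP[_ /gt0_complex_real[r r0 ->]] rF.
exists r => // y yr.
have := rF y; rewrite /ball/= !normC_normc ltcR sub0r normcN => /(_ yr).
rewrite -rmorphM/= lecR; apply: le_trans.
rewrite le_eqVlt; apply/orP; left; apply/eqP; congr normc.
have -> : 'd F z 1 * y = 'd F z y.
  rewrite -[in RHS](mulr1 y) (_ : y * 1 = y *: (1 : R[i]^o))//.
  by rewrite linearZ/= mulrC.
by rewrite !fctE/= opprD addrA (addrC z).
Qed.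

Lemma continuous_cvP n (f : 'cV[R[i]]_n -> R[i])
    (w : 'cV[R[i]]_n) : {for w, continuous f} ->
  forall e, 0 < e -> exists2 r : R, 0 < r &
  forall v : 'cV[R[i]]_n, (forall j, normc (v j 0 - w j 0) < r) ->
    normc (f v - f w) < e.
Proof.
move=> /cvgrPdist_lt cf e e0; have := cf e%:C; rewrite ltcR => /(_ e0).
move=> /nbhs_ballP[_ /gt0_complex_real[r r0 ->]] rF.
exists r => // v yr; have := rF v; rewrite /ball/= /mx_ball/=.
move=> h; rewrite -normcN opprB -ltcR; apply: h; split.
  by rewrite ltcR.
move=> i j; rewrite ord1 /ball/= normC_normc ltcR -normcN opprB.
exact: yr.
Qed.

End ComplexAux.

Section MeasurableContinuous.
Context {R : realType} (n : nat).
Local Notation Rb := (measurableTypeR R).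
Local Notation Tn := (n.-tuple (Rb * Rb)%type).

Definition rat_box (p : n.-tuple (rat * rat) * nat) : set Tn :=
  [set t | forall j,
     `|(tnth t j).1 - ratr (tnth p.1 j).1| < p.2.+1%:R^-1 /\
     `|(tnth t j).2 - ratr (tnth p.1 j).2| < p.2.+1%:R^-1 ].

Lemma measurable_rat_box p : measurable (rat_box p).
Proof.
have -> : rat_box p = \bigcap_(j in [set: 'I_n])
    ((fun t => tnth t j) @^-1`
      ([set x : Rb | `|x - ratr (tnth p.1 j).1| < p.2.+1%:R^-1] `*`
       [set x : Rb | `|x - ratr (tnth p.1 j).2| < p.2.+1%:R^-1])).
  apply/seteqP; split => t /=.
    by move=> tb j _ /=; exact: tb.
  by move=> tb j; exact: (tb j I).
have mI (c e : R) : measurable [set x : Rb | `|x - c| < e].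
  rewrite (_ : [set _ | _] = `]c - e, c + e[%classic).
    exact: measurable_itv.
  by apply/seteqP; split => x /=; rewrite in_itv/= ltr_distl.
apply: fin_bigcap_measurable => // j _.
rewrite -[X in measurable X]setTI; apply: measurable_tnth => //.
exact: measurableX.
Qed.

(** The sigma-algebra on tuples is generated by the coordinates, so an open set is exhibited as a
    countable union of boxes with rational centres. *)
Lemma measurable_open_tuple (U : set Tn) :
  (forall t, U t -> exists2 r : R, 0 < r & forall s : Tn,
    (forall j, `|(tnth s j).1 - (tnth t j).1| < r /\
               `|(tnth s j).2 - (tnth t j).2| < r) -> U s) ->
  measurable U.
Proof.
move=> oU.
pose B p := if `[< rat_box p `<=` U >] then rat_box p else set0.
have -> : U = \bigcup_p B p.
  apply/seteqP; split => [t Ut|t [p _]]; last first.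
    by rewrite /B; case: ifPn => // /asboolP; exact.
  have [r r0 rU] := oU t Ut.
  (* A box of radius 1 / (k + 1) around a rational point close to t contains t, and its points are
     within 2 / (k + 1) < r of t. *)
  pose k := Num.truncn (2 / r).
  have k0 : 0 < k.+1%:R :> R by rewrite ltr0n.
  have k2r : k.+1%:R^-1 * 2 < r.
    rewrite mulrC ltr_pdivrMr// mulrC -ltr_pdivrMr//; exact: truncnS_gt.
  have rt (x : R) : {q : rat | `|x - ratr q| < k.+1%:R^-1}.
    have xx : x - k.+1%:R^-1 < x + k.+1%:R^-1.
      by rewrite ltrD2l gt0_cp// invr_gt0.
    have [q] := cid (rat_in_itvoo xx).
    rewrite in_itv/= => /andP[q1 q2]; exists q.
    by rewrite distrC ltr_distl q1 q2.
  pose p := ([tuple (proj1_sig (rt (tnth t j).1), proj1_sig (rt (tnth t j).2)) | j < n], k).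
  exists p => //; rewrite /B; case: ifPn => [_|/asboolP[]]; last first.
    move=> s /= sb; apply: rU => j; have := sb j; rewrite tnth_mktuple/=.
    case: (rt (tnth t j).1) => q1 /= q1t; case: (rt (tnth t j).2) => q2 /= q2t.
    move=> [s1 s2]; split.
      rewrite -(subrKA (ratr q1)) (le_lt_trans (ler_normD _ _))//.
      by rewrite (lt_trans _ k2r)// mulr_natr mulr2n ltrD// distrC.
    rewrite -(subrKA (ratr q2)) (le_lt_trans (ler_normD _ _))//.
    by rewrite (lt_trans _ k2r)// mulr_natr mulr2n ltrD// distrC.
  move=> j; rewrite tnth_mktuple/=.
  by split; case: (rt _).
apply: countable_bigcupT_measurable; first exact: countableP.
by move=> p; rewrite /B; case: ifPn => // _; exact: measurable_rat_box.
Qed.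

Lemma measurable_Cn_continuous (f : 'cV[R[i]]_n -> R) :
  (forall (w : 'cV[R[i]]_n) (e : R), 0 < e -> exists2 r : R, 0 < r &
    forall v : 'cV[R[i]]_n, (forall j, normc (v j 0 - w j 0) < r) ->
    `|f v - f w| < e) ->
  measurable_fun setT ((f \o @Cn_of_pairs R n) : Tn -> Rb).
Proof.
move=> cf.
apply: (measurability _ (RGenOInfty.measurableE R)) => //.
move=> _ [_ [x ->] <-]; rewrite setTI.
apply: measurable_open_tuple => t /=; rewrite in_itv/= andbT => xf.
have [|r r0 rf] := cf (Cn_of_pairs t) (f (Cn_of_pairs t) - x).
  by rewrite subr_gt0.
(* Half of r for each real coordinate, as the modulus is at most |Re| + |Im|. *)
exists (r / 2); first by rewrite divr_gt0.
move=> s st; rewrite in_itv/= andbT.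
have := rf (Cn_of_pairs s) _; rewrite ltr_distl => h.
suff /h /andP[] : forall j, normc (Cn_of_pairs s j 0 - Cn_of_pairs t j 0) < r.
  by rewrite opprB addrCA subrr addr0.
move=> j; apply: (le_lt_trans (normc_le_ReIm _)).
by rewrite ReB ImB !mxE/= (splitr r) ltrD//; case: (st j).
Qed.

End MeasurableContinuous.

(** * Polar decomposition of homogeneous densities *)

Section Density.
Local Open Scope ereal_scope.
Context d (T : measurableType d) (R : realType).
Variable mu : {measure set T -> \bar R}.
Import HBNNSimple.

(** The measure with density u. Its integration formula holds on level sets by definition, then for
    simple functions by linearity and for all nonnegative g by monotone convergence. *)
Lemma density_measure (u : T -> R) : measurable_fun setT u ->
  (forall x, (0 <= u x)%R) -> exists m : {measure set T -> \bar R},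
  forall g : T -> \bar R, measurable_fun setT g -> (forall x, 0 <= g x) ->
  \int[m]_x g x = \int[mu]_x (g x * (u x)%:E).
Proof.
move=> mu_ u0; pose w x := (u x)%:E.
have mw : measurable_fun setT w by exact/measurable_EFinP.
have w0 x : 0 <= w x by rewrite lee_fin.
pose nu (A : set T) := \int[mu]_(x in A) w x.
have nu0 : nu set0 = 0 by rewrite /nu integral_set0.
have nu_ge0 A : 0 <= nu A by apply: integral_ge0.
have nu_sigma : semi_sigma_additive nu.
  move=> F mF tF mUF; rewrite /nu ge0_integral_bigcup//; last first.
    exact: measurable_funTS.
  by apply: is_cvg_nneseries => n _ _; exact: nu_ge0.
pose m : {measure set T -> \bar R} :=
  HB.pack nu (isMeasure.Build _ _ _ nu nu0 nu_ge0 nu_sigma).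
exists m => g mg g0.
pose g_ := nnsfun_approx measurableT mg.
have gE x : g x = limn (fun n => (g_ n x)%:E).
  apply/esym/cvg_lim => //.
  by apply: cvg_nnsfun_approx => // y _; exact: g0.
have gnd x : nondecreasing_seq (fun n => (g_ n x)%:E).
  by move=> a b ab; rewrite lee_fin; exact/lefP/nd_nnsfun_approx.
transitivity (limn (fun n => \int[m]_x (g_ n x)%:E)).
  rewrite -monotone_convergence//.
  - by apply: eq_integral => x _; exact: gE.
  - by move=> n; exact/measurable_EFinP/measurable_funP.
  - by move=> n y _; rewrite lee_fin.
transitivity (limn (fun n => \int[mu]_x ((g_ n x)%:E * w x))); last first.
  rewrite -monotone_convergence//.
  - apply: eq_integral => x _; rewrite gE.
    rewrite muleC -limeMl//; last exact: ereal_nondecreasing_is_cvgn.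
    by under eq_fun do rewrite muleC.
  - move=> n; apply: emeasurable_funM => //.
    exact/measurable_EFinP/measurable_funP.
  - by move=> n y _; rewrite mule_ge0// lee_fin.
  - by move=> x _ a b ab; rewrite lee_wpmul2r//; exact: gnd.
congr (limn _); apply/funext => n.
transitivity (\sum_(k \in range (g_ n)) k%:E * nu (g_ n @^-1` [set k])).
  rewrite integral_nnsfun// sintegralE.
  by rewrite patch_setT.
transitivity (\sum_(k \in range (g_ n))
    \int[mu]_x (k%:E * (\1_(g_ n @^-1` [set k]) x)%:E * w x)); last first.
  rewrite -ge0_integral_fsum//.
  - apply: eq_integral => x _; rewrite -ge0_mule_fsuml.
      rewrite [in RHS](fimfunE (g_ n) x) -fsumEFin//.
    by move=> i; rewrite -EFinM nnfun_muleindic_ge0.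
  - move=> r; apply: emeasurable_funM => //.
    by apply: measurable_funeM; exact/measurable_EFinP.
  - by move=> r x _; rewrite mule_ge0// -EFinM nnfun_muleindic_ge0.
apply: eq_fsbigr => k; rewrite inE => -[x _ gx].
have k0 : (0 <= k)%R by rewrite -gx.
under [RHS]eq_integral do rewrite -muleA.
rewrite ge0_integralZl_EFin//; last 2 first.
- by move=> y _; rewrite mule_ge0// lee_fin.
- by apply: emeasurable_funM => //; exact/measurable_EFinP.
congr (_ * _); rewrite /nu integral_mkcond; apply: eq_integral => y _.
by rewrite patchE indicE; case: ifPn; rewrite ?mul1e ?mul0e.
Qed.

End Density.

Section Polar.
Context {R : realType} (n : nat).
Hypothesis n_gt0 : (0 < n)%N.
Local Notation Rb := (measurableTypeR R).
Local Notation lambda := (@lebesgue_measure R).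
Local Notation Tn := (n.-tuple (Rb * Rb)%type).
Local Notation mun := (@tuple_lebesgue R n).

Definition tuple_norm (t : Tn) : R :=
  Num.sqrt (\sum_j ((tnth t j).1 ^+ 2 + (tnth t j).2 ^+ 2)).

Lemma enorm_Cn_of_pairs t : enorm (Cn_of_pairs t) = tuple_norm t.
Proof.
rewrite /enorm /tuple_norm; congr Num.sqrt; apply: eq_bigr => j _.
by rewrite !mxE sqr_normc_ReIm.
Qed.

Lemma measurable_tuple_norm : measurable_fun setT (tuple_norm : Tn -> Rb).
Proof.
apply: (@measurableT_comp _ _ _ _ _ _ (@Num.sqrt R : Rb -> Rb)).
  apply: continuous_measurable_fun; exact: sqrt_continuous.
apply: measurable_sum => j.
have mt : measurable_fun setT (fun t : Tn => tnth t j) by exact: measurable_tnth.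
by apply: measurable_funD; apply: measurable_funX;
  [exact: (measurableT_comp measurable_fst)|exact: (measurableT_comp measurable_snd)].
Qed.

Lemma tuple_norm_ge0 t : 0 <= tuple_norm t.
Proof. exact: sqrtr_ge0. Qed.

Lemma tuple_norm_mul a b t :
  tuple_norm (tuple_mul a b t) = Num.sqrt (a ^+ 2 + b ^+ 2) * tuple_norm t.
Proof.
rewrite /tuple_norm -sqrtrM ?addr_ge0 ?sqr_ge0// mulr_sumr; congr Num.sqrt.
by apply: eq_bigr => j _; rewrite tnth_map/=; ring.
Qed.

Lemma Cn_of_pairs_mul a b t :
  Cn_of_pairs (tuple_mul a b t) = (a +i* b) *: Cn_of_pairs t :> 'cV[R[i]]_n.
Proof.
apply/matrixP => i j; rewrite !mxE tnth_map/=.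
by apply/eqP; rewrite eq_complex/=; apply/andP; split; apply/eqP; ring.
Qed.

Lemma integral_exprn0o (k : nat) (x : R) : 0 < x ->
  (\int[lambda]_(r in `[0%R, x[) (r ^+ k)%:E = (x ^+ k.+1 / k.+1%:R)%:E)%E.
Proof.
move=> x0.
have mX : measurable_fun `[0, x[%classic (fun r : R => (r ^+ k)%:E).
  by apply/measurable_EFinP; exact: measurable_funX.
rewrite integral_itv_bndo_bndc//.
have k0 : k.+1%:R != 0 :> R by rewrite pnatr_eq0.
pose F (r : R) := k.+1%:R^-1 * r ^+ k.+1.
have FE : F = k.+1%:R^-1 \*: (fun r : R => r ^+ k.+1) by [].
have dF (r : R) : derivable F r 1.
  by rewrite FE; apply: derivableZ; exact: exprn_derivable.
have F'E (r : R) : 'D_1 F r = r ^+ k.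
  rewrite FE deriveZ; last exact: exprn_derivable.
  rewrite exp_derive /GRing.scale/= mulr1 -mulr_natl mulrA mulVf// mul1r//.
rewrite (@continuous_FTC2 _ (fun r => r ^+ k) F 0 x)//.
- by rewrite /F expr0n/= mulr0 sube0 mulrC.
- apply: continuous_subspaceT => r; exact: exprn_continuous.
- have cF : continuous F.
    move=> r; apply: differentiable_continuous; apply/derivable1_diffP.
    exact: dF.
  split.
  + by move=> r _; exact: dF.
  + apply: cvg_at_right_filter; exact: cF.
  + apply: cvg_at_left_filter; exact: cF.
- by move=> r _; rewrite derive1E F'E.
Qed.

(* A density homogeneous under real dilations pushes forward under the norm to
   a multiple of a power: both measures agree on the rays ]-oo, x[. *)
Lemma polar_homogeneous (d : nat) (u : Tn -> R) :
  measurable_fun setT u -> (forall t, 0 <= u t) ->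
  (forall r t, 0 < r -> u (tuple_mul r 0 t) = r ^+ d * u t) ->
  (\int[mun]_(t in [set t | (tuple_norm t < 1)%R]) (u t)%:E < +oo)%E ->
  exists C : R, [/\ 0 <= C,
   (\int[mun]_(t in [set t | (tuple_norm t < 1)%R]) (u t)%:E =
     (C / (d + 2 * n)%:R)%:E)%E &
   forall G : R -> \bar R, measurable_fun [set: Rb] G ->
   (forall r, (0 <= G r)%E) ->
   (\int[mun]_t (G (tuple_norm t) * (u t)%:E) =
    C%:E * \int[lambda]_(r in `[0%R, +oo[) (G r * (r ^+ (d + 2 * n - 1))%:E))%E].
Proof.
move=> mu_ u0 uhom ufin.
have [m mE] := density_measure mun mu_ u0.
pose I := fine (\int[mun]_(t in [set t | (tuple_norm t < 1)%R]) (u t)%:E)%E.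
have IE : (\int[mun]_(t in [set t | (tuple_norm t < 1)%R]) (u t)%:E)%E = I%:E.
  by rewrite fineK// ge0_fin_numE// integral_ge0// => t _; rewrite lee_fin.
have I0 : 0 <= I by rewrite -lee_fin -IE integral_ge0// => t _; rewrite lee_fin.
pose D := (d + 2 * n)%N.
have D0 : (0 < D)%N by rewrite /D; lia.
have DE : (D - 1).+1 = D by lia.
have C0 : 0 <= D%:R * I by rewrite mulr_ge0.
(* Since r^(D - 1) integrates to 1 / D over [0, 1], the constant has to be D times the mass I of the
   unit ball. *)
exists (D%:R * I); split => //.
  by rewrite IE mulrAC divff ?mul1r// pnatr_eq0 -lt0n.
(* The indicator confines the power to the half-line and keeps it nonnegative on all of R, as
   [density_measure] requires. *)
have mw : measurable_fun setT ((fun r : Rb => \1_(`[0, +oo[) r * (r ^+ (D - 1))) : Rb -> Rb).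
  by apply: measurable_funM; [exact: measurable_indic|exact: measurable_funX].
have w0 (r : R) : 0 <= \1_(`[0, +oo[) r * (r ^+ (D - 1)) :> R.
  rewrite indicE; case: (boolP (r \in _)); rewrite ?mul0r// inE/= in_itv/= andbT => r0.
  by rewrite mul1r exprn_ge0.
have [m' m'E] := density_measure lambda mw w0.
pose k : {nonneg R} := NngNum C0.
pose nu := measure_function_pushforward__canonical__measure_function_Measure m
  measurable_tuple_norm.
have munorm (A : set Rb) : measurable A -> measurable (tuple_norm @^-1` A).
  by move=> mA; rewrite -[X in measurable X]setTI; exact: measurable_tuple_norm.
have densE (A : set Tn) : measurable A -> m A = (\int[mun]_(t in A) (u t)%:E)%E.
  move=> mA; rewrite -(setIT A) -integral_indic// mE//; last first.
    by apply/measurable_EFinP; exact: measurable_indic.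
  rewrite [RHS]integral_mkcond; apply: eq_integral => t _.
  by rewrite setIT patchE indicE; case: ifPn; rewrite ?mul1e ?mul0e.
have densE' (A : set Rb) : measurable A -> m' A =
    (\int[lambda]_(r in A `&` `[0%R, +oo[) (r ^+ (D - 1))%:E)%E.
  move=> mA; rewrite -(setIT A) -integral_indic// m'E//; last first.
    by apply/measurable_EFinP; exact: measurable_indic.
  rewrite [RHS]integral_mkcond; apply: eq_integral => t _.
  rewrite setIT patchE !indicE in_setI.
  by case: (t \in A); case: (t \in _) => /=; rewrite ?mul1e ?mul0e ?mul1r ?mul0r.
have tn1 (x : R) : measurable [set t : Tn | tuple_norm t < x].
  have -> : [set t : Tn | tuple_norm t < x] = tuple_norm @^-1` `]-oo, x[.
    by apply/seteqP; split => t /=; rewrite in_itv.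
  exact: munorm.
(* The substitution t -> x t carries the unit ball onto the ball of radius x: the Jacobian gives
   x^(2n), homogeneity gives x^d. *)
have mball x : 0 < x -> m [set t | tuple_norm t < x] = (x ^+ D * I)%:E.
  move=> x0; rewrite densE//.
  pose f t := ((u t)%:E * (\1_[set t | tuple_norm t < x] t)%:E)%E.
  have mf : measurable_fun setT f.
    apply: emeasurable_funM; first exact/measurable_EFinP.
    exact/measurable_EFinP/measurable_indic.
  have f0 t : (0 <= f t)%E by rewrite mule_ge0 ?lee_fin.
  have xx0 : x ^+ 2 + 0 ^+ 2 != 0 by rewrite expr0n/= addr0 gt_eqF ?exprn_gt0.
  have := ge0_integral_tuple_mul xx0 mf f0.
  have -> : (\int[mun]_t f (tuple_mul x 0 t) = (x ^+ d * I)%:E)%E.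
    rewrite EFinM -IE -ge0_integralZl_EFin//; last 3 first.
    - by move=> t _; rewrite lee_fin.
    - by apply: measurable_funTS; exact/measurable_EFinP.
    - by rewrite exprn_ge0// ltW.
    rewrite [RHS]integral_mkcond; apply: eq_integral => t _.
    rewrite /f uhom// patchE indicE.
    have -> : (tuple_mul x 0 t \in [set t | tuple_norm t < x]) =
              (t \in [set t | tuple_norm t < 1]).
      apply/idP/idP; rewrite !inE/= tuple_norm_mul expr0n/= addr0 sqrtr_sqr;
        by rewrite gtr0_norm// gtr_pMr.
    by case: (t \in _); rewrite ?mule1 ?mule0.
  have -> : (\int[mun]_t f t =
      \int[mun]_(t in [set t | (tuple_norm t < x)%R]) (u t)%:E)%E.
    rewrite [RHS]integral_mkcond; apply: eq_integral => t _.
    by rewrite /f patchE indicE; case: ifPn; rewrite ?mule1 ?mule0.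
  rewrite expr0n/= addr0 => e.
  have -> : (x ^+ D * I)%:E = ((x ^+ 2) ^+ n * (x ^+ d * I))%:E.
    by rewrite mulrA -exprM -exprD addnC.
  rewrite EFinM e muleA -EFinM -exprMn divff ?expr1n ?mul1e//.
  by rewrite gt_eqF// exprn_gt0.
have nuray x : nu `]-oo, x[%classic = if 0 < x then (x ^+ D * I)%:E else 0%E.
  rewrite /nu/= /pushforward.
  have -> : tuple_norm @^-1` `]-oo, x[ = [set t : Tn | tuple_norm t < x].
    by apply/seteqP; split => t /=; rewrite in_itv.
  case: ifPn => [|x0]; first exact: mball.
  rewrite (_ : [set _ | _] = set0) ?measure0//.
  apply/seteqP; split => // t /= tx; move: x0; rewrite -leNgt => x0.
  by have := le_lt_trans (tuple_norm_ge0 t) (lt_le_trans tx x0); rewrite ltxx.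
(* Rays are stable under intersection and generate the Borel sets; those ending at integers exhaust
   the line and have finite mass. *)
have numu A : measurable A -> nu A = mscale k m' A.
  refine (@measure_unique _ R Rb (@RGenInftyO.G R)
    (fun i : nat => `]-oo, i%:R[%classic) _ _ _ _ nu (mscale k m') _ _ A).
  - exact: RGenInftyO.measurableE.
  - move=> _ _ [x ->] [y ->]; exists (Num.min x y).
    by apply/seteqP; split => z /=; rewrite !in_itv/= lt_min;
      [case=> -> ->|case/andP].
  - by move=> i; exists i%:R.
  - apply/seteqP; split => // x _; exists (Num.truncn x).+1 => //=.
    by rewrite in_itv/=; exact: truncnS_gt.
  - move=> _ [x ->]; rewrite nuray.
    transitivity ((D%:R * I)%:E * m' `]-oo, x[%classic)%E; last by [].
    rewrite densE'//.
    have [x0|x0] := ltP 0 x.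
      rewrite (_ : _ `&` _ = `[0, x[%classic); last first.
        by apply/seteqP; split => z /=; rewrite !in_itv/= andbT; [case=> -> ->|case/andP].
      rewrite integral_exprn0o// DE -EFinM; congr EFin.
      by rewrite [RHS]mulrC mulrA divfK ?pnatr_eq0 -?lt0n.
    rewrite (_ : _ `&` _ = set0) ?integral_set0 ?mule0//.
    apply/seteqP; split => // z /=; rewrite !in_itv/= andbT => -[zx z0].
    by have := le_lt_trans z0 (lt_le_trans zx x0); rewrite ltxx.
  - by move=> i; have -> := nuray i%:R; case: ifP; rewrite ltry.
move=> G mG G0.
have mGt : measurable_fun setT (G \o tuple_norm).
  by apply: (measurableT_comp mG); exact: measurable_tuple_norm.
rewrite -mE//.
have /= := @ge0_integral_pushforward _ _ Tn Rb R _
  measurable_tuple_norm m setT G measurableT mG (fun y _ => G0 y).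
rewrite preimage_setT => <-.
transitivity (\int[mscale k m']_r G r)%E.
  apply: eq_measure_integral => [|mp A mA _]; first exact: measurable_tuple_norm.
  exact: numu.
rewrite ge0_integral_mscale// m'E//=; congr (_ * _)%E.
rewrite [RHS]integral_mkcond; apply: eq_integral => r _.
rewrite patchE indicE; case: (r \in _); rewrite ?mul1r// mul0r mule0//.
Qed.

End Polar.

(** * Goursat's theorem and circle averages *)

Section SegmentIntegral.
Context {R : realType}.
Local Notation lambda := (@lebesgue_measure R).

Lemma integrable_segment (f : R -> R) a b : continuous f ->
  lambda.-integrable `[a, b] (EFin \o f).
Proof.
move=> cf; apply: continuous_compact_integrable; first exact: segment_compact.
by move=> x; apply: continuous_subspaceT.
Qed.

Lemma Rintegral_segment_split (f : R -> R) a b c : continuous f ->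
  a <= b -> b <= c ->
  \int[lambda]_(t in `[a, c]) f t =
  \int[lambda]_(t in `[a, b]) f t + \int[lambda]_(t in `[b, c]) f t.
Proof.
move=> cf ab bc.
have intf := integrable_segment a c cf.
rewrite -(Rintegral_itv_obnd_cbnd (r := b)); last first.
  apply: integrableS (integrable_segment b c cf) => //.
  exact: subset_itv_oc_cc.
have /(_ _)/= <- := @Rintegral_itvB R f (BLeft a) (BRight c) b intf.
- by rewrite addrCA subrr addr0.
- by rewrite bnd_simp.
- by rewrite bnd_simp.
Qed.

Lemma Rintegral_segment_cst (a b z : R) : a <= b ->
  \int[lambda]_(t in `[a, b]) (cst z t) = z * (b - a).
Proof.
move=> ab; rewrite Rintegral_cst//= lebesgue_measure_itv/= lte_fin.
have [//|ba] := ltP a b.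
have /eqP -> : b == a by rewrite eq_le ab ba.
by rewrite subrr.
Qed.

Lemma normr_Rintegral_segment_le (f : R -> R) a b M : continuous f -> a <= b ->
  (forall t, a <= t <= b -> `|f t| <= M) ->
  `|\int[lambda]_(t in `[a, b]) f t| <= M * (b - a).
Proof.
move=> cf ab fM.
apply: (le_trans (le_normr_Rintegral _ _)) => //.
  exact: integrable_segment.
rewrite -(Rintegral_segment_cst _ ab).
apply: le_Rintegral => //.
- apply: integrable_segment => t; apply: continuous_comp; first exact: cf.
  exact: norm_continuous.
- by apply: integrable_segment => t; exact: cst_continuous.
Qed.

End SegmentIntegral.

Section Goursat.
Context {R : realType}.
Local Notation lambda := (@lebesgue_measure R).
Variables P Q : R -> R -> R.

(* [P dx + Q dy] is differentiable at every point, with [dP/dy = dQ/dx]; no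
   continuity of the partial derivatives is assumed. *)
Definition pointwise_closed := forall x0 y0, exists a b c : R,
  forall e, 0 < e -> exists2 r : R, 0 < r & forall x y,
    `|x - x0| < r -> `|y - y0| < r ->
    `|P x y - P x0 y0 - (a * (x - x0) + b * (y - y0))| <=
      e * (`|x - x0| + `|y - y0|) /\
    `|Q x y - Q x0 y0 - (b * (x - x0) + c * (y - y0))| <=
      e * (`|x - x0| + `|y - y0|).

Hypothesis closedPQ : pointwise_closed.

Lemma pointwise_closed_continuous :
  [/\ (forall y, continuous (P ^~ y)), (forall x, continuous (P x)),
      (forall y, continuous (Q ^~ y)) & (forall x, continuous (Q x))].
Proof.
have key (f : R -> R) t0 a : (forall e, 0 < e -> exists2 r : R, 0 < r & forall t,
    `|t - t0| < r -> `|f t - f t0 - a * (t - t0)| <= e * `|t - t0|) ->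
    {for t0, continuous f}.
  move=> h; apply/cvgrPdist_lt => e e0.
  (* With tolerance 1 the increment is at most (|a| + 1) |t - t0|; the radius e / (|a| + 2) then
     makes it smaller than e. *)
  have [r r0 hr] := h 1 ltr01.
  near=> t.
  have tr : `|t - t0| < r by rewrite distrC; near: t; apply: cvgr_dist_lt => //; exact: cvg_id.
  have tr2 : `|t - t0| < e / (`|a| + 2).
    rewrite distrC; near: t; apply: cvgr_dist_lt; first exact: cvg_id.
    by rewrite divr_gt0// ltr_wpDl.
  have := hr t tr; rewrite mul1r => h1.
  rewrite distrC.
  have -> : f t - f t0 = (f t - f t0 - a * (t - t0)) + a * (t - t0) by ring.
  apply: (le_lt_trans (ler_normD _ _)); rewrite normrM.
  rewrite ltr_pdivlMr in tr2; last by rewrite ltr_wpDl.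
  have := normr_ge0 a; have := normr_ge0 (t - t0); nra.
split=> z t0.
- have [a [b [c h]]] := closedPQ t0 z; apply: (key _ _ a) => e /h[r r0 hr].
  exists r => // t tr; have [] := hr t z tr; first by rewrite subrr normr0.
  by rewrite subrr normr0 mulr0 !addr0.
- have [a [b [c h]]] := closedPQ z t0; apply: (key _ _ b) => e /h[r r0 hr].
  exists r => // t tr; have [|] := hr z t _ tr; first by rewrite subrr normr0.
  by rewrite subrr normr0 mulr0 !add0r.
- have [a [b [c h]]] := closedPQ t0 z; apply: (key _ _ b) => e /h[r r0 hr].
  exists r => // t tr; have [|_] := hr t z tr; first by rewrite subrr normr0.
  by rewrite subrr normr0 mulr0 !addr0.
- have [a [b [c h]]] := closedPQ z t0; apply: (key _ _ c) => e /h[r r0 hr].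
  exists r => // t tr; have [|_] := hr z t _ tr; first by rewrite subrr normr0.
  by rewrite subrr normr0 mulr0 !add0r.
Unshelve. all: by end_near. Qed.

(* Found in the context by the closing [//] and [exact: cB] below. *)
Let cPx y : continuous (P ^~ y). Proof. by case: pointwise_closed_continuous. Qed.
Let cQy x : continuous (Q x). Proof. by case: pointwise_closed_continuous. Qed.
Let cPy x : continuous (P x). Proof. by case: pointwise_closed_continuous. Qed.
Let cQx y : continuous (Q ^~ y). Proof. by case: pointwise_closed_continuous. Qed.

Let cB (f g : R -> R) : continuous f -> continuous g ->
  continuous (fun t => f t - g t).
Proof. by move=> cf cg t; apply: cvgB; [exact: cf|exact: cg]. Qed.

(** The counterclockwise circulation of P dx + Q dy: bottom minus top, right minus left. *)
Definition boundary_integral (x1 x2 y1 y2 : R) : R :=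
  \int[lambda]_(t in `[x1, x2]) (P t y1 - P t y2) +
  \int[lambda]_(t in `[y1, y2]) (Q x2 t - Q x1 t).

(** The common edge is run through in opposite directions, so its two contributions cancel. *)
Lemma boundary_integral_splitx x1 x x2 y1 y2 : x1 <= x -> x <= x2 ->
  boundary_integral x1 x2 y1 y2 =
  boundary_integral x1 x y1 y2 + boundary_integral x x2 y1 y2.
Proof.
move=> h1 h2; rewrite /boundary_integral.
rewrite (@Rintegral_segment_split _ _ x1 x x2)//; last exact: cB.
have -> : \int[lambda]_(t in `[y1, y2]) (Q x2 t - Q x1 t) =
   \int[lambda]_(t in `[y1, y2]) (Q x t - Q x1 t) +
   \int[lambda]_(t in `[y1, y2]) (Q x2 t - Q x t).
  rewrite -RintegralD//; last 2 first.
  - by apply: integrable_segment; exact: cB.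
  - by apply: integrable_segment; exact: cB.
  by apply: eq_Rintegral => t _; rewrite [RHS]addrC subrKA.
ring.
Qed.

Lemma boundary_integral_splity x1 x2 y1 y y2 : y1 <= y -> y <= y2 ->
  boundary_integral x1 x2 y1 y2 =
  boundary_integral x1 x2 y1 y + boundary_integral x1 x2 y y2.
Proof.
move=> h1 h2; rewrite /boundary_integral.
rewrite (@Rintegral_segment_split _ (fun t => Q x2 t - Q x1 t) y1 y y2)//; last exact: cB.
have -> : \int[lambda]_(t in `[x1, x2]) (P t y1 - P t y2) =
   \int[lambda]_(t in `[x1, x2]) (P t y1 - P t y) +
   \int[lambda]_(t in `[x1, x2]) (P t y - P t y2).
  rewrite -RintegralD//; last 2 first.
  - by apply: integrable_segment; exact: cB.
  - by apply: integrable_segment; exact: cB.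
  by apply: eq_Rintegral => t _; rewrite subrKA.
ring.
Qed.

(** The first-order part of P dx + Q dy at (x0, y0) is a closed form and has zero circulation. Only
    errors of size e times the diameter remain, over edges of that length. *)
Lemma boundary_integral_local x0 y0 e : 0 < e -> exists2 r : R, 0 < r &
  forall x1 x2 y1 y2, x1 <= x0 <= x2 -> y1 <= y0 <= y2 ->
    x2 - x1 < r -> y2 - y1 < r ->
  `|boundary_integral x1 x2 y1 y2| <= e * ((x2 - x1) + (y2 - y1)) ^+ 2.
Proof.
move=> e0; have [a [b [c h]]] := closedPQ x0 y0.
(* Half of e, because each integrand below is a difference of two values. *)
have [r r0 hr] := h (e / 2) (divr_gt0 e0 (ltr0n _ 2)).
exists r => // x1 x2 y1 y2 /andP[x10 x02] /andP[y10 y02] xr yr.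
have x12 := le_trans x10 x02; have y12 := le_trans y10 y02.
pose w := x2 - x1; pose k := y2 - y1.
have inx x : x1 <= x <= x2 -> `|x - x0| < r /\ `|x - x0| <= w.
  by rewrite /w => /andP[? ?]; split; rewrite ?ltr_norml ?ler_norml; apply/andP; split; lra.
have iny y : y1 <= y <= y2 -> `|y - y0| < r /\ `|y - y0| <= k.
  by rewrite /k => /andP[? ?]; split; rewrite ?ltr_norml ?ler_norml; apply/andP; split; lra.
have e2 : 0 < e / 2 by lra.
have hP x y : x1 <= x <= x2 -> y1 <= y <= y2 ->
    `|P x y - P x0 y0 - (a * (x - x0) + b * (y - y0))| <= e / 2 * (w + k).
  move=> /inx[xr' xw] /iny[yr' yk]; have [+ _] := hr x y xr' yr'.
  by move=> /le_trans; apply; rewrite ler_pM2l// lerD.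
have hQ x y : x1 <= x <= x2 -> y1 <= y <= y2 ->
    `|Q x y - Q x0 y0 - (b * (x - x0) + c * (y - y0))| <= e / 2 * (w + k).
  move=> /inx[xr' xw] /iny[yr' yk]; have [_ +] := hr x y xr' yr'.
  by move=> /le_trans; apply; rewrite ler_pM2l// lerD.
have hx1 : x1 <= x1 <= x2 by rewrite lexx.
have hx2 : x1 <= x2 <= x2 by rewrite lexx andbT.
have hy1 : y1 <= y1 <= y2 by rewrite lexx.
have hy2 : y1 <= y2 <= y2 by rewrite lexx andbT.
(* The corrections b k over a width w and - b w over a height k cancel. This is where dP/dy = dQ/dx
   enters. *)
have -> : boundary_integral x1 x2 y1 y2 =
    \int[lambda]_(t in `[x1, x2]) (P t y1 - P t y2 + b * k) +
    \int[lambda]_(t in `[y1, y2]) (Q x2 t - Q x1 t - b * w).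
  have cst_int u v z : lambda.-integrable `[u, v] (EFin \o cst (z : R)).
    by apply: integrable_segment => t; exact: cst_continuous.
  have iP : lambda.-integrable `[x1, x2] (EFin \o (fun t => P t y1 - P t y2)).
    by apply: integrable_segment; exact: cB.
  have iQ : lambda.-integrable `[y1, y2] (EFin \o (fun t => Q x2 t - Q x1 t)).
    by apply: integrable_segment; exact: cB.
  rewrite [X in _ = X + _](RintegralD _ iP (cst_int x1 x2 (b * k)))//.
  rewrite [X in _ = _ + X](RintegralB _ iQ (cst_int y1 y2 (b * w)))//.
  rewrite (Rintegral_segment_cst (b * k) x12) (Rintegral_segment_cst (b * w) y12).
  rewrite /boundary_integral /w /k; ring.
have b1 : `|\int[lambda]_(t in `[x1, x2]) (P t y1 - P t y2 + b * k)| <=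
    (e * (w + k)) * w.
  apply: normr_Rintegral_segment_le => //.
    by move=> t; apply: cvgD; [exact: cB|exact: cst_continuous].
  move=> t ht; have := hP t y1 ht hy1; have := hP t y2 ht hy2.
  by rewrite /k !ler_norml => /andP[? ?] /andP[? ?]; apply/andP; split; lra.
have b2 : `|\int[lambda]_(t in `[y1, y2]) (Q x2 t - Q x1 t - b * w)| <=
    (e * (w + k)) * k.
  apply: normr_Rintegral_segment_le => //.
    by move=> t; apply: cvgB; [exact: cB|exact: cst_continuous].
  move=> t ht; have := hQ x1 t hx1 ht; have := hQ x2 t hx2 ht.
  by rewrite /w !ler_norml => /andP[? ?] /andP[? ?]; apply/andP; split; lra.
apply: (le_trans (ler_normD _ _)); apply: (le_trans (lerD b1 b2)).
by rewrite -/w -/k le_eqVlt; apply/orP; left; apply/eqP; ring.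
Qed.

Let rect := (R * R * (R * R))%type.
Let bint (s : rect) := boundary_integral s.1.1 s.1.2 s.2.1 s.2.2.
Let proper (s : rect) := (s.1.1 <= s.1.2) && (s.2.1 <= s.2.2).

(** One of the four quarters carries at least a quarter of the circulation. [proper s] stands under
    the existential so that choice yields a total function on [rect]. *)
Let bisect (s : rect) : exists s' : rect, proper s ->
  [/\ proper s', (s.1.1 <= s'.1.1) && (s'.1.2 <= s.1.2),
      (s.2.1 <= s'.2.1) && (s'.2.2 <= s.2.2),
      (s'.1.2 - s'.1.1 = (s.1.2 - s.1.1) / 2) /\
      (s'.2.2 - s'.2.1 = (s.2.2 - s.2.1) / 2) & `|bint s| <= 4 * `|bint s'|].
Proof.
case: s => -[x1 x2] [y1 y2]; rewrite /proper/=.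
pose x := (x1 + x2) / 2; pose y := (y1 + y2) / 2.
have [/andP[x12 y12]|] := boolP ((x1 <= x2) && (y1 <= y2)); last first.
  by exists ((x1, x2), (y1, y2)).
have x1x : x1 <= x by rewrite /x; lra.
have xx2 : x <= x2 by rewrite /x; lra.
have y1y : y1 <= y by rewrite /y; lra.
have yy2 : y <= y2 by rewrite /y; lra.
have e : bint ((x1, x2), (y1, y2)) = (bint ((x1, x), (y1, y)) + bint ((x1, x), (y, y2))) +
   (bint ((x, x2), (y1, y)) + bint ((x, x2), (y, y2))).
  by rewrite /bint/= (boundary_integral_splitx _ _ x1x xx2)
   !(boundary_integral_splity _ _ y1y yy2).
have := ler_normD (bint ((x1, x), (y1, y)) + bint ((x1, x), (y, y2)))
   (bint ((x, x2), (y1, y)) + bint ((x, x2), (y, y2))).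
rewrite -e => h.
have h1 := ler_normD (bint ((x1, x), (y1, y))) (bint ((x1, x), (y, y2))).
have h2 := ler_normD (bint ((x, x2), (y1, y))) (bint ((x, x2), (y, y2))).
have [c1|c1] := lerP `|bint ((x1, x2), (y1, y2))| (4 * `|bint ((x1, x), (y1, y))|).
  by exists ((x1, x), (y1, y)) => _; split => //=; rewrite ?lexx ?x1x ?y1y//; split; rewrite /x /y; lra.
have [c2|c2] := lerP `|bint ((x1, x2), (y1, y2))| (4 * `|bint ((x1, x), (y, y2))|).
  by exists ((x1, x), (y, y2)) => _; split => //=; rewrite ?lexx ?x1x ?y1y ?yy2//; split; rewrite /x /y; lra.
have [c3|c3] := lerP `|bint ((x1, x2), (y1, y2))| (4 * `|bint ((x, x2), (y1, y))|).
  by exists ((x, x2), (y1, y)) => _; split => //=; rewrite ?lexx ?x1x ?xx2 ?y1y ?yy2//; split; rewrite /x /y; lra.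
have [c4|c4] := lerP `|bint ((x1, x2), (y1, y2))| (4 * `|bint ((x, x2), (y, y2))|).
  by exists ((x, x2), (y, y2)) => _; split => //=; rewrite ?lexx ?x1x ?xx2 ?y1y ?yy2//; split; rewrite /x /y; lra.
lra.
Qed.

Lemma goursat_rectangle x1 x2 y1 y2 : x1 < x2 -> y1 < y2 ->
  boundary_integral x1 x2 y1 y2 = 0.
Proof.
move=> x12 y12; have [f hf] := choice bisect.
pose s0 : rect := ((x1, x2), (y1, y2)).
pose s n := iter n f s0.
have ps n : proper (s n).
  elim: n => [|n /hf[]//]; by rewrite /proper/= !ltW.
have size n : (s n).1.2 - (s n).1.1 = (x2 - x1) / 2 ^+ n /\
    (s n).2.2 - (s n).2.1 = (y2 - y1) / 2 ^+ n.
  elim: n => [|n [IH1 IH2]]; first by rewrite expr0 !divr1.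
  have [_ _ _ [-> ->] _] := hf _ (ps n); rewrite -/(s n) IH1 IH2 exprSr.
  by split; rewrite invfM mulrA.
have bs n : `|bint s0| <= 4 ^+ n * `|bint (s n)|.
  elim: n => [|n IH]; first by rewrite expr0 mul1r.
  apply: (le_trans IH); rewrite exprSr -mulrA ler_pM2l ?exprn_gt0//.
  by have [] := hf _ (ps n).
have nest m k : [/\ (s m).1.1 <= (s (m + k)%N).1.1, (s (m + k)%N).1.2 <= (s m).1.2,
    (s m).2.1 <= (s (m + k)%N).2.1 & (s (m + k)%N).2.2 <= (s m).2.2].
  elim: k => [|k [i1 i2 i3 i4]]; first by rewrite addn0.
  rewrite addnS; have [_ /andP[j1 j2] /andP[j3 j4] _ _] := hf _ (ps (m + k)%N).
  split; [exact: le_trans i1 j1|exact: le_trans j2 i2|exact: le_trans i3 j3|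
    exact: le_trans j4 i4].
have crossx m k : (s m).1.1 <= (s k).1.2.
  have [h1 _ _ _] := nest m k; have [_ h2 _ _] := nest k m.
  rewrite addnC in h2; apply: (le_trans h1); apply: le_trans h2.
  by have /andP[] := ps (m + k)%N.
have crossy m k : (s m).2.1 <= (s k).2.2.
  have [_ _ h1 _] := nest m k; have [_ _ _ h2] := nest k m.
  rewrite addnC in h2; apply: (le_trans h1); apply: le_trans h2.
  by have /andP[] := ps (m + k)%N.
(* X and Y, suprema of the left and lower ends, form a point common to all the nested rectangles. *)
pose X := sup (range (fun n => (s n).1.1)).
pose Y := sup (range (fun n => (s n).2.1)).
have inX n : (s n).1.1 <= X <= (s n).1.2.
  apply/andP; split.
    apply: ub_le_sup; last by exists n.
    by exists (s 0%N).1.2 => _ [m _ <-].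
  by apply: ge_sup; [exists (s 0%N).1.1; exists 0%N|move=> _ [m _ <-]].
have inY n : (s n).2.1 <= Y <= (s n).2.2.
  apply/andP; split.
    apply: ub_le_sup; last by exists n.
    by exists (s 0%N).2.2 => _ [m _ <-].
  by apply: ge_sup; [exists (s 0%N).2.1; exists 0%N|move=> _ [m _ <-]].
apply/eqP; rewrite -normr_eq0; apply/negPn/negP => B0.
have Bpos : 0 < `|bint s0| by rewrite lt_def B0/=.
pose S := (x2 - x1) + (y2 - y1).
have S0 : 0 < S by rewrite /S; lra.
(* With this tolerance the bound 4^n e (S / 2^n)^2 is half of |bint s0|, which is absurd. *)
have e0 : 0 < `|bint s0| / (2 * S ^+ 2) by rewrite divr_gt0// mulr_gt0// exprn_gt0.
have [r r0 hr] := boundary_integral_local X Y e0.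
(* From 2^n > n > S / r, both sides of the n-th rectangle are shorter than r. *)
pose n := (Num.truncn (S / r)).+1.
have Sn : S / 2 ^+ n < r.
  rewrite ltr_pdivrMr ?exprn_gt0// mulrC -ltr_pdivrMr//.
  apply: (lt_trans (truncnS_gt _)); rewrite -/n -natrX ltr_nat.
  exact: ltn_expl.
have n0 : 0 < 2 ^+ n :> R by rewrite exprn_gt0.
have [zx zy] := size n.
have h1 : (s n).1.2 - (s n).1.1 < r.
  rewrite zx; apply: le_lt_trans Sn; rewrite ler_pM2r ?invr_gt0// /S; lra.
have h2 : (s n).2.2 - (s n).2.1 < r.
  rewrite zy; apply: le_lt_trans Sn; rewrite ler_pM2r ?invr_gt0// /S; lra.
have := hr _ _ _ _ (inX n) (inY n) h1 h2.
rewrite zx zy -mulrDl -/S exprMn => hb.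
have := le_trans (bs n) (ler_wpM2l (exprn_ge0 n (ler0n _ 4)) hb).
have -> : 4 ^+ n * (`|bint s0| / (2 * S ^+ 2) * (S ^+ 2 * (2 ^+ n)^-1 ^+ 2)) =
   `|bint s0| / 2.
  have -> : 4 ^+ n = (2 ^+ n) ^+ 2 :> R.
    by rewrite -exprM mulnC exprM; congr (_ ^+ _); rewrite -natrX.
  field; rewrite !gt_eqF//=.
lra.
Qed.

(** The horizontal sides cancel, so the zero circulation is the difference of the two vertical
    integrals. *)
Lemma goursat_periodic x1 x2 y1 y2 : y1 < y2 -> (forall x, P x y1 = P x y2) ->
  \int[lambda]_(t in `[y1, y2]) Q x1 t = \int[lambda]_(t in `[y1, y2]) Q x2 t.
Proof.
move=> y12 per.
wlog x12 : x1 x2 / x1 < x2.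
  move=> h; have [|/h->//|->//] := ltgtP x1 x2; exact: h.
have := goursat_rectangle x12 y12; rewrite /boundary_integral.
under eq_Rintegral do rewrite per subrr.
rewrite Rintegral_cst// mul0r add0r RintegralB//; last 2 first.
- exact: integrable_segment.
- exact: integrable_segment.
by move/eqP; rewrite subr_eq0 => /eqP.
Qed.

End Goursat.

(** * Complex exponential and periodic holomorphic functions *)

Section ComplexExponential.
Context {R : realType}.

Lemma is_derive_eps (f : R -> R) (x d : R) : is_derive x 1 f d ->
  forall e, 0 < e -> exists2 r : R, 0 < r & forall t, `|t| < r ->
  `|f (x + t) - f x - d * t| <= e * `|t|.
Proof.
move=> [df dE] e e0.
have := derivable_nbhs df; move/eqaddoP => /(_ e e0) /nbhs_ballP[r/= r0 hr].
exists r => // t tr; have := hr t; rewrite /ball/= sub0r normrN => /(_ tr).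
rewrite !fctE/= dE /GRing.scale/= mulr1 (addrC t x) (mulrC d).
by rewrite opprD addrA.
Qed.

Definition cexp (z : R[i]) : R[i] :=
  (expR (complex.Re z) * cos (complex.Im z)) +i*
  (expR (complex.Re z) * sin (complex.Im z)).

Lemma cexpD (z w : R[i]) : cexp (z + w) = cexp z * cexp w.
Proof.
case: z w => a b [c d]; rewrite /cexp/=; apply/eqP; rewrite eq_complex/=.
by rewrite expRD cosD sinD; apply/andP; split; apply/eqP; ring.
Qed.

Lemma cexp0 : cexp 0 = 1.
Proof. by rewrite /cexp/= expR0 cos0 sin0 !mul1r. Qed.

Lemma differentiableC_eps (F : R[i] -> R[i]) (z d : R[i]) :
  (forall e : R, 0 < e -> exists2 r : R, 0 < r &
    forall y, normc y < r -> normc (F (z + y) - F z - d * y) <= e * normc y) ->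
  differentiable F z.
Proof.
move=> h; apply/derivable1_diffP; apply/cvg_ex; exists d.
apply/cvgrPdist_le => _ /gt0_complex_real[e e0 ->].
have [r r0 hr] := h e e0.
rewrite near_withinE; apply/nbhs_ballP; exists r%:C; first by rewrite /= ltcR.
move=> y; rewrite /ball/= normC_normc sub0r normcN ltcR => yr y0.
have yn0 : 0 < normc y.
  rewrite lt_def normc_ge0 andbT; apply: contraNneq y0 => /eq0_normc ->; exact/eqP.
rewrite -normrN opprB -(@ler_pM2l _ (normc y)%:C) ?ltcR//.
rewrite -{1}(normC_normc y) -normrM mulrBr.
have -> : y * (y^-1 *: (F (y *: 1 + z) - F z)) = F (z + y) - F z.
  rewrite /GRing.scale/= mulr1 mulrA mulfV// mul1r//.
  by congr (F _ - F z); exact: addrC.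
rewrite normC_normc -rmorphM/= lecR mulrC (mulrC (normc y)).
exact: hr.
Qed.

(** By [cexpD] only increments at 0 have to be estimated, from the real derivatives of exp, cos and
    sin there. *)
Lemma differentiable_cexp (z : R[i]) : differentiable cexp z.
Proof.
apply: (@differentiableC_eps _ _ (cexp z)) => e e0.
pose K := normc (cexp z) + 1.
have K0 : 0 < K by rewrite ltr_wpDl// normc_ge0.
(* The four error terms add up to at most 6 e' times the modulus of the increment, so 8 leaves room;
   the + 1 in [K] keeps the divisor positive. *)
pose e' := e / (8 * K).
have e'0 : 0 < e' by rewrite divr_gt0// mulr_gt0.
have [r1 r10 h1] := is_derive_eps (is_derive_expR (0 : R)) e'0.
have [r2 r20 h2] := is_derive_eps (is_derive_cos (0 : R)) e'0.
have [r3 r30 h3] := is_derive_eps (is_derive_sin (0 : R)) e'0.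
(* The bound 1 yields exp s <= 2, and e' controls the mixed term (exp s - 1) t. *)
have m0 : 0 < Num.min 1 e' by rewrite lt_min ltr01.
have [r4 r40 h4] : exists2 r : R, 0 < r & forall t, `|t| < r ->
    `|expR t - 1| <= Num.min 1 e'.
  have /cvgrPdist_le := @continuous_expR R 0.
  move=> /(_ _ m0)/nbhs_ballP[r /= r0 hr]; exists r => // t tr.
  have := hr t; rewrite /ball/= sub0r normrN expR0 distrC; exact.
exists (Num.min (Num.min r1 r2) (Num.min r3 r4)).
  by rewrite !lt_min r10 r20 r30.
case=> s t st.
have [ss tt] : `|s| <= normc (s +i* t) /\ `|t| <= normc (s +i* t).
  by split; [exact: (normRe_le (s +i* t))|exact: (normIm_le (s +i* t))].
move: st; rewrite !lt_min => /andP[/andP[st1 st2] /andP[st3 st4]].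
have := h1 s (le_lt_trans ss st1).
have := h2 t (le_lt_trans tt st2).
have := h3 t (le_lt_trans tt st3).
have := h4 s (le_lt_trans ss st4).
rewrite le_min => /andP[k1 k2].
rewrite !add0r expR0 cos0 sin0 oppr0 mul0r !subr0 addr0 !mul1r => k3 k4 k5.
have E : normc (cexp (s +i* t) - 1 - (s +i* t)) <= 8 * e' * normc (s +i* t).
  apply: (le_trans (normc_le_ReIm _)).
  move: (normc (s +i* t)) ss tt (normc_ge0 (s +i* t)) => N ss tt N0.
  rewrite !ReB !ImB /cexp/= subr0.
  have ->: expR s * cos t - 1 - s = expR s * (cos t - 1) + (expR s - 1 - s) by ring.
  have ->: expR s * sin t - t = expR s * (sin t - t) + (expR s - 1) * t by ring.
  have k6 : `|expR s| <= 2.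
    have -> : expR s = (expR s - 1) + 1 by ring.
    by apply: (le_trans (ler_normD _ _)); rewrite normr1; lra.
  have := ler_normD (expR s * (cos t - 1)) (expR s - 1 - s).
  have := ler_normD (expR s * (sin t - t)) ((expR s - 1) * t).
  rewrite !normrM => k7 k8.
  have l1 : `|expR s| * `|cos t - 1| <= 2 * (e' * N).
    apply: ler_pM => //; apply: (le_trans k4); rewrite ler_pM2l//.
  have l2 : `|expR s| * `|sin t - t| <= 2 * (e' * N).
    apply: ler_pM => //; apply: (le_trans k3); rewrite ler_pM2l//.
  have l3 : `|expR s - 1| * `|t| <= e' * N by exact: ler_pM.
  have l4 : `|expR s - 1 - s| <= e' * N.
    by apply: (le_trans k5); rewrite ler_pM2l.
  have := mulr_ge0 (ltW e'0) N0.
  lra.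
rewrite cexpD.
have -> : cexp z * cexp (s +i* t) - cexp z - cexp z * (s +i* t) =
  cexp z * (cexp (s +i* t) - 1 - (s +i* t)) by ring.
rewrite normcM.
have := ler_wpM2l (normc_ge0 (cexp z)) E => /le_trans; apply.
have -> : e * normc (s +i* t) = K * (8 * e' * normc (s +i* t)).
  by rewrite /e'; field; rewrite gt_eqF.
apply: ler_wpM2r; first by rewrite mulr_ge0 ?normc_ge0// mulr_ge0// ltW.
by rewrite /K; lra.
Qed.

End ComplexExponential.

Section HolomorphicPeriodic.
Context {R : realType}.
Local Notation lambda := (@lebesgue_measure R).
Variable F : R[i] -> R[i].
Hypothesis dF : forall z, differentiable F z.

(** The Cauchy-Riemann equations in epsilon form, for the derivative al + i be. *)
Let estimates (x0 y0 : R) : exists al be : R, forall e : R, 0 < e ->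
  exists2 r : R, 0 < r & forall x y, `|x - x0| < r -> `|y - y0| < r ->
  `|complex.Re (F (x +i* y)) - complex.Re (F (x0 +i* y0)) -
     (al * (x - x0) - be * (y - y0))| <= e * (`|x - x0| + `|y - y0|) /\
  `|complex.Im (F (x +i* y)) - complex.Im (F (x0 +i* y0)) -
     (be * (x - x0) + al * (y - y0))| <= e * (`|x - x0| + `|y - y0|).
Proof.
have [[al be] h] := differentiableCP (dF (x0 +i* y0)).
exists al, be => e e0; have [r r0 hr] := h e e0.
exists (r / 2); first by lra.
move=> x y xr yr.
have nle := normc_le_ReIm ((x - x0) +i* (y - y0)).
have nr : normc ((x - x0) +i* (y - y0)) < r.
  by apply: (le_lt_trans nle) => /=; lra.
have := hr _ nr.
have -> : (x0 +i* y0) + ((x - x0) +i* (y - y0)) = x +i* y.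
  by apply/eqP; rewrite eq_complex/= !subrKC !eqxx.
move=> hle.
have hle' := le_trans hle (ler_wpM2l (ltW e0) nle).
split.
  apply: le_trans hle'; apply: le_trans (normRe_le _).
  by rewrite !ReB ReM.
apply: le_trans hle'; apply: le_trans (normIm_le _).
by rewrite !ImB ImM/= (addrC (al * _)).
Qed.

(** F dz = (Re F dx - Im F dy) + i (Im F dx + Re F dy). This is the imaginary part, named after the
    function it integrates along vertical lines; [closed_Im] is the real part. *)
Let closed_Re : pointwise_closed (fun x y => complex.Im (F (x +i* y)))
  (fun x y => complex.Re (F (x +i* y))).
Proof.
move=> x0 y0; have [al [be h]] := estimates x0 y0.
exists be, al, (- be) => e /h[r r0 hr]; exists r => // x y xr yr.
by have [h1 h2] := hr x y xr yr; split => //; rewrite mulNr.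
Qed.

Let closed_Im : pointwise_closed (fun x y => complex.Re (F (x +i* y)))
  (fun x y => - complex.Im (F (x +i* y))).
Proof.
move=> x0 y0; have [al [be h]] := estimates x0 y0.
exists al, (- be), (- al) => e /h[r r0 hr]; exists r => // x y xr yr.
have [h1 h2] := hr x y xr yr; split; first by rewrite mulNr.
rewrite -normrN; apply: le_trans h2; rewrite le_eqVlt; apply/orP; left.
by apply/eqP; congr `|_|; ring.
Qed.

Lemma holomorphic_continuous_vert (x : R) :
  continuous (fun y => complex.Re (F (x +i* y))) /\
  continuous (fun y => complex.Im (F (x +i* y))).
Proof.
have [_ cI _ cR] := pointwise_closed_continuous closed_Re.
by split; [exact: cR|exact: cI].
Qed.

Lemma holomorphic_periodic (T x1 x2 : R) : 0 < T ->
  (forall x, F (x +i* 0) = F (x +i* T)) ->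
  \int[lambda]_(t in `[0, T]) complex.Re (F (x1 +i* t)) =
  \int[lambda]_(t in `[0, T]) complex.Re (F (x2 +i* t)) /\
  \int[lambda]_(t in `[0, T]) complex.Im (F (x1 +i* t)) =
  \int[lambda]_(t in `[0, T]) complex.Im (F (x2 +i* t)).
Proof.
move=> T0 per; split.
  have := goursat_periodic closed_Re x1 x2 T0; apply => x.
  by rewrite per.
have ci x : lambda.-integrable `[0, T] (EFin \o (fun t => complex.Im (F (x +i* t)))).
  by apply: integrable_segment; have [] := holomorphic_continuous_vert x.
have neg x : \int[lambda]_(t in `[0, T]) - complex.Im (F (x +i* t)) =
    - \int[lambda]_(t in `[0, T]) complex.Im (F (x +i* t)).
  rewrite -mulN1r -RintegralZl//; apply: eq_Rintegral => t _.
  by rewrite mulN1r.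
have e := goursat_periodic closed_Im x1 x2 T0.
by apply: oppr_inj; rewrite -!neg; apply: e => x; rewrite per.
Qed.

End HolomorphicPeriodic.

Lemma differentiable_exprn {R : realType} (V : normedModType R[i])
    (f : V -> R[i]) (x : V) m :
  differentiable f x -> differentiable (fun y => f y ^+ m) x.
Proof.
move=> df; elim: m => [|m IH].
  by under eq_fun do rewrite expr0; exact: differentiable_cst.
under eq_fun do rewrite exprS.
exact: differentiableM.
Qed.

Section RotationAverage.
Context {R : realType} (n m : nat).
Local Notation lambda := (@lebesgue_measure R).
Variables k p : 'cV[R[i]]_n -> R[i].
Hypothesis dk : forall z : 'cV[R[i]]_n, differentiable k z.
Hypothesis phom : forall c (z : 'cV[R[i]]_n), p (c *: z) = c ^+ m * p z.

Lemma mulc_conj (c : R[i]) : c * c^* = (normc c ^+ 2)%:C.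
Proof.
case: c => a b; rewrite sqr_normc_ReIm; apply/eqP; rewrite eq_complex/=.
by apply/andP; split; apply/eqP; ring.
Qed.

Lemma normc_cexp (z : R[i]) : normc (cexp z) = expR (complex.Re z).
Proof.
apply/eqP; rewrite -(@eqrXn2 _ 2)// ?normc_ge0 ?expR_ge0// sqr_normc_ReIm/=.
by rewrite !exprMn -mulrDr cos2Dsin2 mulr1.
Qed.

(** Dilating by r amounts to translating zeta by ln r. The arbitrary factor w makes a statement on
    real parts cover imaginary parts as well. *)
Lemma rotation_average_dilation (w : R[i]) (z : 'cV[R[i]]_n) (r : R) : 0 < r ->
  \int[lambda]_(t in `[0, pi *+ 2])
    complex.Re (w * (p ((cos t +i* sin t) *: (r%:C *: z)) *
                    (k ((cos t +i* sin t) *: (r%:C *: z)))^*)) =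
  r ^+ (2 * m) * \int[lambda]_(t in `[0, pi *+ 2])
    complex.Re (w * (p ((cos t +i* sin t) *: z) * (k ((cos t +i* sin t) *: z))^*)).
Proof.
move=> r0.
pose F (x : R[i]) := k (cexp x *: z) * cexp (- x) ^+ m.
have dF x : differentiable F x.
  apply: differentiableM.
    apply: differentiable_comp; last exact: dk.
    apply: (@differentiable_comp _ _ _ _ cexp (fun c : R[i] => c *: z)).
      exact: differentiable_cexp.
    exact: differentiableZl.
  apply: differentiable_exprn.
  apply: (@differentiable_comp _ _ _ _ (fun x : R[i] => - x) cexp).
    exact: differentiableN.
  exact: differentiable_cexp.
have pi20 : 0 < pi *+ 2 :> R by rewrite pmulrn_lgt0// pi_gt0.
have per x : F (x +i* 0) = F (x +i* (pi *+ 2)).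
  rewrite /F /cexp/= !oppr0 !cosN !sinN cos0 sin0 cos2pi sin2pi oppr0.
  by [].
(* For c = e^(s + it) one has k(c z) = F c^m, so p(c z) times the conjugate of k(c z) is |c|^(2m)
   p(z) conj(F). Up to e^(2ms), its product with w has a real part linear in Re F and Im F with
   coefficients free of s and t. *)
have E (s t : R) : complex.Re (w * (p (cexp (s +i* t) *: z) *
       (k (cexp (s +i* t) *: z))^*)) = expR s ^+ (2 * m) *
    (complex.Re (w * p z) * complex.Re (F (s +i* t)) +
     complex.Im (w * p z) * complex.Im (F (s +i* t))).
  set c := cexp (s +i* t).
  have cc : cexp (- (s +i* t)) * c = 1 by rewrite -cexpD addNr cexp0.
  have kE : k (c *: z) = F (s +i* t) * c ^+ m.
    by rewrite /F -mulrA -exprMn cc expr1n mulr1.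
  rewrite kE phom rmorphM rmorphXn/=.
  have -> : w * (c ^+ m * p z * ((F (s +i* t))^* * c^* ^+ m)) =
     (c * c^*) ^+ m * (w * p z * (F (s +i* t))^*) by rewrite exprMn; ring.
  rewrite mulc_conj normc_cexp/= -rmorphXn/= -exprM.
  case: (w * p z) (F (s +i* t)) => a b [u v] /=; ring.
have cR x := (holomorphic_continuous_vert dF x).1.
have cI x := (holomorphic_continuous_vert dF x).2.
have intE (s : R) : \int[lambda]_(t in `[0, pi *+ 2])
    complex.Re (w * (p (cexp (s +i* t) *: z) * (k (cexp (s +i* t) *: z))^*)) =
  expR s ^+ (2 * m) *
   (complex.Re (w * p z) * \int[lambda]_(t in `[0, pi *+ 2]) complex.Re (F (s +i* t)) +
    complex.Im (w * p z) * \int[lambda]_(t in `[0, pi *+ 2]) complex.Im (F (s +i* t))).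
  have iR := integrable_segment 0 (pi *+ 2) (cR s).
  have iI := integrable_segment 0 (pi *+ 2) (cI s).
  have iRl (c : R) : lambda.-integrable `[0, pi *+ 2]
      (EFin \o (fun t => c * complex.Re (F (s +i* t)))).
    apply: integrable_segment => t; apply: cvgM; first exact: cvg_cst.
    exact: cR.
  have iIl (c : R) : lambda.-integrable `[0, pi *+ 2]
      (EFin \o (fun t => c * complex.Im (F (s +i* t)))).
    apply: integrable_segment => t; apply: cvgM; first exact: cvg_cst.
    exact: cI.
  rewrite -(RintegralZl _ _ iR)// -(RintegralZl _ _ iI)// -RintegralD//.
  rewrite -RintegralZl//; last first.
    apply: integrable_segment => t.
    by apply: cvgD; (apply: cvgM; first exact: cvg_cst); [exact: cR|exact: cI].
  by apply: eq_Rintegral => t _; rewrite E.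
have c1 t : cexp (0 +i* t) = cos t +i* sin t by rewrite /cexp/= expR0 !mul1r.
have cr t : cexp (ln r +i* t) *: z = (cos t +i* sin t) *: (r%:C *: z).
  rewrite scalerA /cexp/= lnK//; congr (_ *: _).
  by apply/eqP; rewrite eq_complex/=; apply/andP; split; apply/eqP; ring.
transitivity (\int[lambda]_(t in `[0, pi *+ 2])
    complex.Re (w * (p (cexp (ln r +i* t) *: z) * (k (cexp (ln r +i* t) *: z))^*))).
  by apply: eq_Rintegral => t _; rewrite cr.
rewrite intE lnK//.
have [-> ->] := holomorphic_periodic dF (ln r) 0 pi20 per.
congr (_ * _); rewrite -[LHS]mul1r -[X in X * _](expr1n _ (2 * m)) -expR0 -intE.
by apply: eq_Rintegral => t _; rewrite c1.
Qed.

End RotationAverage.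

Lemma measurable_tuple_norm_lt {R : realType} n (x : R) :
  measurable [set t : n.-tuple (measurableTypeR R * measurableTypeR R)%type |
    tuple_norm t < x].
Proof.
have -> : [set t : n.-tuple (measurableTypeR R * measurableTypeR R)%type |
    tuple_norm t < x] = @tuple_norm R n @^-1` `]-oo, x[.
  by apply/seteqP; split => t /=; rewrite in_itv.
by rewrite -[X in measurable X]setTI; exact: measurable_tuple_norm.
Qed.

(** * Radial integrals against rotation averages *)

Section PolarSigned.
Context {R : realType} (n : nat).
Local Notation Rb := (measurableTypeR R).
Local Notation lambda := (@lebesgue_measure R).
Local Notation Tn := (n.-tuple (Rb * Rb)%type).
Local Notation mun := (@tuple_lebesgue R n).

(** The last clause of [polar_homogeneous], detached from the hypotheses that produce it. *)
Definition polar_density (d : nat) (C : R) (u : Tn -> R) :=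
  forall G : R -> \bar R, measurable_fun [set: Rb] G ->
   (forall r, (0 <= G r)%E) ->
   (\int[mun]_t (G (tuple_norm t) * (u t)%:E) =
    C%:E * \int[lambda]_(r in `[0%R, +oo[) (G r * (r ^+ (d + 2 * n - 1))%:E))%E.

(** The nonnegative formula is applied to the two parts of G; through it, integrability on the
    half-line passes to the tuples. *)
Lemma integral_polar_signed (d : nat) (C : R) (u : Tn -> R) (G : R -> R) :
  0 <= C -> polar_density d C u -> measurable_fun setT u -> (forall t, 0 <= u t) ->
  measurable_fun [set: Rb] (G : Rb -> Rb) ->
  lambda.-integrable `[0, +oo[ (fun r => (G r * r ^+ (d + 2 * n - 1))%:E) ->
  mun.-integrable setT (fun t => (G (tuple_norm t) * u t)%:E) /\
  (\int[mun]_t (G (tuple_norm t) * u t)%:E =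
   C%:E * \int[lambda]_(r in `[0%R, +oo[) (G r * r ^+ (d + 2 * n - 1))%:E)%E.
Proof.
move=> C0 pu mu_ u0 mG iG.
set D := (d + 2 * n - 1)%N in iG *.
have mnorm := @measurable_tuple_norm R n.
have mGu (H : R -> R) : measurable_fun [set: Rb] (H : Rb -> Rb) ->
    measurable_fun setT (fun t => (H (tuple_norm t) * u t)%:E).
  move=> mH; apply/measurable_EFinP; apply: measurable_funM => //.
  exact: (measurableT_comp mH mnorm).
have mX : measurable_fun [set: Rb] (fun r : Rb => r ^+ D : Rb).
  exact: measurable_funX.
have nonneg (H : R -> R) : measurable_fun [set: Rb] (H : Rb -> Rb) ->
   (forall r, 0 <= H r) -> (forall r, H r <= `|G r|) ->
   [/\ mun.-integrable setT (fun t => (H (tuple_norm t) * u t)%:E),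
    lambda.-integrable `[0, +oo[ (fun r => (H r * r ^+ D)%:E) &
   (\int[mun]_t (H (tuple_norm t) * u t)%:E =
   C%:E * \int[lambda]_(r in `[0%R, +oo[) (H r * r ^+ D)%:E)%E].
  move=> mH H0 HG.
  have e : (\int[mun]_t (H (tuple_norm t) * u t)%:E =
     C%:E * \int[lambda]_(r in `[0%R, +oo[) (H r * r ^+ D)%:E)%E.
    have := pu (fun r => (H r)%:E) _ (fun r => _); rewrite -/D.
    under eq_integral do rewrite -EFinM.
    under [X in _ -> _ -> _ = (_ * X)%E]eq_integral do rewrite -EFinM.
    by apply; [exact/measurable_EFinP|move=> r; rewrite lee_fin].
  have iH : lambda.-integrable `[0, +oo[ (fun r => (H r * r ^+ D)%:E).
    apply: le_integrable iG => //.
      apply/measurable_EFinP; apply: measurable_funTS; exact: measurable_funM.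
    move=> r _; rewrite /= lee_fin !normrM ler_wpM2r//.
    by rewrite (ger0_norm (H0 r)).
  split => //; apply/integrableP; split; first exact: mGu.
  under eq_integral => t _ do rewrite /= ger0_norm ?mulr_ge0//.
  rewrite e; apply: lte_mul_pinfty => //.
  move/integrableP : iH => [_]; apply: le_lt_trans; apply: ge0_le_integral => //.
  - by move=> r/=; rewrite in_itv/= andbT => r0; rewrite lee_fin mulr_ge0 ?exprn_ge0.
  - by apply/measurable_EFinP; apply: measurable_funTS; exact: measurable_funM.
  - apply: measurableT_comp => //.
    by apply/measurable_EFinP; apply: measurable_funTS; exact: measurable_funM.
  - by move=> r _; exact: lee_abs.
pose Gp r := Num.max (G r) 0; pose Gn r := Num.max (- G r) 0.
have mGp : measurable_fun [set: Rb] (Gp : Rb -> Rb) by exact: measurable_maxr.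
have mGn : measurable_fun [set: Rb] (Gn : Rb -> Rb).
  by apply: measurable_maxr => //; exact: measurable_funN.
have GE r : G r = Gp r - Gn r.
  rewrite /Gp /Gn; have [h|h] := lerP 0 (G r).
    by rewrite (max_idPr _) ?oppr_le0// subr0.
  by rewrite (max_idPl _) ?oppr_ge0 ?ltW// sub0r opprK.
have Gp0 r : 0 <= Gp r by rewrite /Gp le_max lexx orbT.
have Gn0 r : 0 <= Gn r by rewrite /Gn le_max lexx orbT.
have GpG r : Gp r <= `|G r| by rewrite /Gp ge_max normr_ge0 ler_norm.
have GnG r : Gn r <= `|G r|.
  by rewrite /Gn ge_max normr_ge0 andbT -normrN ler_norm.
have [iup irp ep] := nonneg Gp mGp Gp0 GpG.
have [iun irn en] := nonneg Gn mGn Gn0 GnG.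
have GuE t : (G (tuple_norm t) * u t)%:E =
    ((Gp (tuple_norm t) * u t)%:E - (Gn (tuple_norm t) * u t)%:E)%E.
  by rewrite -EFinB GE mulrBl.
have GrE r : (G r * r ^+ D)%:E = ((Gp r * r ^+ D)%:E - (Gn r * r ^+ D)%:E)%E.
  by rewrite -EFinB GE mulrBl.
split.
  have -> : (fun t => (G (tuple_norm t) * u t)%:E) =
      (fun t => (Gp (tuple_norm t) * u t)%:E - (Gn (tuple_norm t) * u t)%:E)%E.
    by apply/funext => t; rewrite GuE.
  exact: integrableB.
under eq_integral do rewrite GuE.
rewrite integralB_EFin// ep en.
under [in RHS]eq_integral do rewrite GrE.
rewrite integralB_EFin//.
rewrite -(fineK (integrable_fin_num _ irp))// -(fineK (integrable_fin_num _ irn))//.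
by rewrite [RHS]muleBr.
Qed.

End PolarSigned.

Section RotationPolar.
Context {R : realType} (n : nat).
Hypothesis n_gt0 : (0 < n)%N.
Local Notation Rb := (measurableTypeR R).
Local Notation lambda := (@lebesgue_measure R).
Local Notation Tn := (n.-tuple (Rb * Rb)%type).
Local Notation mun := (@tuple_lebesgue R n).

Definition tuple_rot (t : Tn) (a : R) : Tn := tuple_mul (cos a) (sin a) t.

Lemma tuple_norm_rot t a : tuple_norm (tuple_rot t a) = tuple_norm t.
Proof. by rewrite tuple_norm_mul cos2Dsin2 sqrtr1 mul1r. Qed.

Lemma measurable_tuple_rot :
  measurable_fun [set: (Tn * Rb)%type] (fun z => tuple_rot z.1 z.2).
Proof.
apply/measurable_fun_tnthP => j.
have m1 : measurable_fun [set: (Tn * Rb)%type] (fun z : Tn * Rb => tnth z.1 j).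
  by apply: (measurableT_comp (measurable_tnth j)).
have mx : measurable_fun [set: (Tn * Rb)%type] (fun z : Tn * Rb => (tnth z.1 j).1 : Rb).
  exact: (measurableT_comp measurable_fst).
have my : measurable_fun [set: (Tn * Rb)%type] (fun z : Tn * Rb => (tnth z.1 j).2 : Rb).
  exact: (measurableT_comp measurable_snd).
have mc : measurable_fun [set: (Tn * Rb)%type] (fun z : Tn * Rb => cos z.2 : Rb).
  apply: (@measurableT_comp _ _ _ _ _ _ (@cos R : Rb -> Rb)) => //.
  by apply: continuous_measurable_fun; exact: continuous_cos.
have ms : measurable_fun [set: (Tn * Rb)%type] (fun z : Tn * Rb => sin z.2 : Rb).
  apply: (@measurableT_comp _ _ _ _ _ _ (@sin R : Rb -> Rb)) => //.
  by apply: continuous_measurable_fun; exact: continuous_sin.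
have mp : measurable_fun [set: (Tn * Rb)%type] (fun z : Tn * Rb =>
   ((cos z.2 * (tnth z.1 j).1 - sin z.2 * (tnth z.1 j).2 : Rb),
    (sin z.2 * (tnth z.1 j).1 + cos z.2 * (tnth z.1 j).2 : Rb))).
  apply: measurable_fun_pair.
    by apply: measurable_funB; exact: measurable_funM.
  by apply: measurable_funD; exact: measurable_funM.
apply: eq_measurable_fun mp => z _ /=.
by rewrite tnth_map.
Qed.

Lemma integral_tuple_rot (a : R) (f : Tn -> \bar R) : measurable_fun setT f ->
  (\int[mun]_t f (tuple_rot t a) = \int[mun]_t f t)%E.
Proof.
move=> mf.
have ge0 (g : Tn -> \bar R) : measurable_fun setT g -> (forall t, 0 <= g t)%E ->
    (\int[mun]_t g (tuple_rot t a) = \int[mun]_t g t)%E.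
  move=> mg g0; rewrite /tuple_rot ge0_integral_tuple_mul ?cos2Dsin2 ?oner_eq0//.
  by rewrite invr1 expr1n mul1e.
rewrite -[LHS]/(\int[mun]_t (f \o tuple_rot^~ a) t)%E.
rewrite integralE [RHS]integralE funepos_comp funeneg_comp; congr (_ - _)%E.
  apply: (ge0 f^\+%E) => //; exact: measurable_funepos.
apply: (ge0 f^\-%E) => //; exact: measurable_funeneg.
Qed.

Variable Psi : Tn -> R.
Hypothesis mPsi : measurable_fun setT Psi.
Hypothesis cPsi : forall t, continuous (fun a => Psi (tuple_rot t a)).

Let T : R := pi *+ 2.
Let T0 : 0 < T. Proof. by rewrite pmulrn_lgt0// pi_gt0. Qed.

(** Not divided by the period: the factor [T] appears in [integrable_rot_average] and is removed in
    the constant of [integral_radial_mul]. *)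
Definition rot_average (t : Tn) : R :=
  \int[lambda]_(a in `[0, T]) Psi (tuple_rot t a).

Lemma measurable_Psi_rot :
  measurable_fun [set: (Tn * Rb)%type] (fun z => Psi (tuple_rot z.1 z.2)).
Proof. by apply: (measurableT_comp mPsi); exact: measurable_tuple_rot. Qed.

Lemma rot_averageE t :
  (rot_average t)%:E = (\int[lambda]_(a in `[0%R, T]) (Psi (tuple_rot t a))%:E)%E.
Proof.
rewrite /rot_average /Rintegral fineK//.
by apply: integrable_fin_num => //; exact: integrable_segment.
Qed.

(** Integrability on the product is not assumed, so the measurability of parametric integrals is
    taken from Tonelli, for each part of the integrand. *)
Lemma measurable_rot_average : measurable_fun setT rot_average.
Proof.
apply/measurable_EFinP.
pose f (z : Tn * Rb) := ((\1_(`[0, T]) z.2 * Psi (tuple_rot z.1 z.2))%:E)%E.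
have mf : measurable_fun setT f.
  apply/measurable_EFinP; apply: measurable_funM; last exact: measurable_Psi_rot.
  by apply: (@measurableT_comp _ _ _ _ _ _ (\1_(`[0, T]) : Rb -> R)) => //;
    exact: measurable_indic.
have mp : measurable_fun setT f^\+%E by exact: measurable_funepos.
have mn : measurable_fun setT f^\-%E by exact: measurable_funeneg.
have := emeasurable_funB
  (measurable_fun_fubini_tonelli_F (m2 := lambda) _ mp (funepos_ge0 f))
  (measurable_fun_fubini_tonelli_F (m2 := lambda) _ mn (funeneg_ge0 f)).
apply: eq_measurable_fun => t _.
rewrite /= rot_averageE integral_mkcond.
transitivity (\int[lambda]_a f (t, a))%E; last first.
  apply: eq_integral => a _; rewrite patchE /f indicE/=.
  by case: ifPn => _; rewrite ?mul1r ?mul0r.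
rewrite -[RHS]/(\int[lambda]_a (f \o pair t) a)%E [RHS]integralE.
rewrite (funepos_comp f (pair t)) (funeneg_comp f (pair t)).
by rewrite /fubini_F; congr (_ - _)%E.
Qed.

(** A radial factor is constant on rotation orbits and rotations preserve the measure, so by Fubini
    every angle contributes the same integral. *)
Lemma integrable_rot_average (G : R -> R) :
  measurable_fun [set: Rb] (G : Rb -> Rb) ->
  mun.-integrable setT (fun t => (G (tuple_norm t) * Psi t)%:E) ->
  mun.-integrable setT (fun t => (G (tuple_norm t) * rot_average t)%:E) /\
  (\int[mun]_t (G (tuple_norm t) * rot_average t)%:E =
   T%:E * \int[mun]_t (G (tuple_norm t) * Psi t)%:E)%E.
Proof.
move=> mG iG.
pose g t := G (tuple_norm t) * Psi t.
have mg : measurable_fun setT (EFin \o g) by exact: measurable_int iG.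
have mg' : measurable_fun setT g by exact/measurable_EFinP.
pose f (z : Tn * Rb) := (\1_(`[0, T]) z.2 * g (tuple_rot z.1 z.2))%:E.
have mf : measurable_fun setT f.
  apply/measurable_EFinP; apply: measurable_funM.
    by apply: (@measurableT_comp _ _ _ _ _ _ (\1_(`[0, T]) : Rb -> R)) => //;
      exact: measurable_indic.
  by apply: (measurableT_comp mg'); exact: measurable_tuple_rot.
have indic_ge0 a : 0 <= \1_(`[0, T]%classic) a :> R by rewrite indicE ler0n.
have lT : (\int[lambda]_a (\1_(`[0, T]) a)%:E = T%:E)%E.
  rewrite integral_indic// setIT.
  transitivity (lambda `[0, T]%classic); first by [].
  rewrite lebesgue_measure_itv/= lte_fin T0.
  by rewrite oppr0 adde0.
have lgoo : (\int[mun]_t `|(g t)%:E| < +oo)%E by case/integrableP : iG.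
have lg_fin : (\int[mun]_t `|(g t)%:E|)%E \is a fin_num.
  by rewrite ge0_fin_numE// integral_ge0.
(* Tonelli in the other order: at a fixed angle the integral of |f| is that of |g|, and the angles
   have total length T. *)
have intf : (mun \x lambda)%E.-integrable setT f.
  apply: (@integrable21ltyP _ _ _ _ R mun lambda f mf).2.
  have inner a : (\int[mun]_t `|f (t, a)| =
      (\1_(`[0, T]) a)%:E * \int[mun]_t `|(g t)%:E|)%E.
    have mga : measurable_fun setT (fun t => `|(g t)%:E|%E).
      exact: measurableT_comp.
    have mgr : measurable_fun setT (fun t => `|(g (tuple_rot t a))%:E|%E).
      by apply: (measurableT_comp mga); exact: measurable_tuple_mul.
    rewrite -(integral_tuple_rot a mga).
    rewrite -(@ge0_integralZl_EFin _ _ _ mun setT measurableT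
      (fun t => `|(g (tuple_rot t a))%:E|%E))//.
    by apply: eq_integral => t _; rewrite /f EFinM abseM /= (ger0_norm (indic_ge0 _)).
  under eq_integral do rewrite inner.
  rewrite ge0_integralZr//; last 2 first.
  - by apply/measurable_EFinP; exact: measurable_indic.
  - exact: integral_ge0.
  by rewrite lT lte_mul_pinfty// lee_fin ltW.
have FE t : fubini_F lambda f t = (G (tuple_norm t) * rot_average t)%:E.
  rewrite EFinM rot_averageE /fubini_F.
  rewrite -integralZl//; last exact: integrable_segment.
  rewrite [RHS]integral_mkcond; apply: eq_integral => a _.
  rewrite patchE /f /g indicE/= tuple_norm_rot.
  by case: ifPn => _; rewrite ?mul1r ?mul0r.
have -> : (fun t => (G (tuple_norm t) * rot_average t)%:E) = fubini_F lambda f.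
  by apply/funext => t; rewrite FE.
split; first exact: (@integrable_fubini_F _ _ _ _ R mun lambda f intf).
have := @Fubini _ _ _ _ R mun lambda f intf; rewrite -/(fubini_F lambda f) => ->.
have Ifin : (\int[mun]_t (g t)%:E)%E \is a fin_num by exact: integrable_fin_num.
transitivity (\int[lambda]_a ((\1_(`[0, T]) a)%:E * \int[mun]_t (g t)%:E))%E.
  apply: eq_integral => a _; rewrite /f/=.
  under eq_integral do rewrite EFinM.
  rewrite integralZl//; first by rewrite (integral_tuple_rot a mg).
  apply/integrableP; split.
    apply/measurable_EFinP; apply: (measurableT_comp mg').
    exact: measurable_tuple_mul.
  rewrite (@integral_tuple_rot a (fun t => `|(g t)%:E|)%E)//.
  exact: measurableT_comp.
rewrite -(fineK Ifin) integralZr//; last first.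
  apply/integrableP; split; first exact/measurable_EFinP/measurable_indic.
  under eq_integral => a _ do rewrite /= ger0_norm ?indic_ge0//.
  by rewrite lT ltry.
by rewrite lT.
Qed.

(* Averaging over rotations makes [Psi] homogeneous, so that its positive and
   negative parts have polar densities. *)
Lemma integral_radial_mul (d : nat) :
  (forall r t, 0 < r -> rot_average (tuple_mul r 0 t) = r ^+ d * rot_average t) ->
  (\int[mun]_(t in [set t | (tuple_norm t < 1)%R]) `|(Psi t)%:E| < +oo)%E ->
  exists C : R, forall G : R -> R, measurable_fun [set: Rb] (G : Rb -> Rb) ->
  mun.-integrable setT (fun t => (G (tuple_norm t) * Psi t)%:E) ->
  lambda.-integrable `[0, +oo[ (fun r => (G r * r ^+ (d + 2 * n - 1))%:E) ->
  (\int[mun]_t (G (tuple_norm t) * Psi t)%:E =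
   C%:E * \int[lambda]_(r in `[0%R, +oo[) (G r * r ^+ (d + 2 * n - 1))%:E)%E.
Proof.
move=> hom fin.
have mnorm := @measurable_tuple_norm R n.
have mu_ := measurable_rot_average.
have mball := @measurable_tuple_norm_lt R n 1.
have avgfin : (\int[mun]_(t in [set t | (tuple_norm t < 1)%R])
    `|(rot_average t)%:E| < +oo)%E.
  (* With the indicator of the radii below 1 as radial factor, finiteness on the unit ball passes
     from Psi to its average. *)
  pose G : R -> R := \1_(`]-oo, 1[).
  have mG : measurable_fun [set: Rb] (G : Rb -> Rb) by exact: measurable_indic.
  have GE (f : Tn -> R) : (\int[mun]_t `|(G (tuple_norm t) * f t)%:E| =
     \int[mun]_(t in [set t | (tuple_norm t < 1)%R]) `|(f t)%:E|)%E.
    rewrite [RHS]integral_mkcond; apply: eq_integral => t _.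
    rewrite patchE /G indicE.
    have -> : (tuple_norm t \in `]-oo, 1[%classic) =
              (t \in [set t : Tn | tuple_norm t < 1]).
      by apply/idP/idP => /set_mem h; apply/mem_set; move: h; rewrite /= in_itv.
    by case: (t \in _); rewrite ?mul1r// mul0r abse0.
  have [|iG _] := integrable_rot_average mG.
    apply/integrableP; split; last by rewrite GE.
    apply/measurable_EFinP; apply: measurable_funM => //.
    exact: (measurableT_comp mG mnorm).
  by move/integrableP : iG => [_]; rewrite GE.
pose up t := Num.max (rot_average t) 0; pose un t := Num.max (- rot_average t) 0.
have mup : measurable_fun setT up by exact: measurable_maxr.
have mun_ : measurable_fun setT un.
  by apply: measurable_maxr => //; exact: measurable_funN.
have up0 t : 0 <= up t by rewrite /up le_max lexx orbT.
have un0 t : 0 <= un t by rewrite /un le_max lexx orbT.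
have upu t : up t <= `|rot_average t| by rewrite /up ge_max normr_ge0 ler_norm.
have unu t : un t <= `|rot_average t|.
  by rewrite /un ge_max normr_ge0 andbT -normrN ler_norm.
have uE t : rot_average t = up t - un t.
  rewrite /up /un; have [h|h] := lerP 0 (rot_average t).
    by rewrite (max_idPr _) ?oppr_le0// subr0.
  by rewrite (max_idPl _) ?oppr_ge0 ?ltW// sub0r opprK.
have fin_le (v : Tn -> R) : measurable_fun setT v -> (forall t, 0 <= v t) ->
    (forall t, v t <= `|rot_average t|) ->
    (\int[mun]_(t in [set t | (tuple_norm t < 1)%R]) (v t)%:E < +oo)%E.
  move=> mv v0 vu; apply: le_lt_trans avgfin; apply: ge0_le_integral => //.
  - by move=> t _; rewrite lee_fin.
  - by apply: measurable_funTS; exact/measurable_EFinP.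
  - apply: measurableT_comp => //; apply: measurable_funTS.
    exact/measurable_EFinP.
  - by move=> t _; rewrite lee_fin.
have homp r t : 0 < r -> up (tuple_mul r 0 t) = r ^+ d * up t.
  by move=> r0; rewrite /up hom// maxr_pMr ?mulr0// exprn_ge0// ltW.
have homn r t : 0 < r -> un (tuple_mul r 0 t) = r ^+ d * un t.
  by move=> r0; rewrite /un hom// maxr_pMr ?mulr0 ?mulrN// exprn_ge0// ltW.
have [Cp [Cp0 _ pp]] := polar_homogeneous n_gt0 mup up0 homp (fin_le _ mup up0 upu).
rewrite -/(polar_density d Cp up) in pp.
have [Cn [Cn0 _ pn]] := polar_homogeneous n_gt0 mun_ un0 homn (fin_le _ mun_ un0 unu).
rewrite -/(polar_density d Cn un) in pn.
(* The constant is chosen before G and depends on Psi alone; the factor 1 / T makes up for the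
   normalisation of the average. *)
exists (T^-1 * (Cp - Cn)) => G mG iG iGr.
have [iGu eGu] := integrable_rot_average mG iG.
have [ip ep] := integral_polar_signed Cp0 pp mup up0 mG iGr.
have [in_ en] := integral_polar_signed Cn0 pn mun_ un0 mG iGr.
have Jfin : (\int[lambda]_(r in `[0%R, +oo[) (G r * r ^+ (d + 2 * n - 1))%:E)%E
  \is a fin_num by exact: integrable_fin_num.
have Ifin : (\int[mun]_t (G (tuple_norm t) * Psi t)%:E)%E \is a fin_num.
  exact: integrable_fin_num.
have : (\int[mun]_t (G (tuple_norm t) * rot_average t)%:E =
    (Cp - Cn)%:E * \int[lambda]_(r in `[0%R, +oo[)
      (G r * r ^+ (d + 2 * n - 1))%:E)%E.
  transitivity (\int[mun]_t ((G (tuple_norm t) * up t)%:E -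
     (G (tuple_norm t) * un t)%:E))%E.
    by apply: eq_integral => t _; rewrite -EFinB uE mulrBr.
  rewrite integralB_EFin// ep en -(fineK Jfin) -!EFinM -EFinB.
  by rewrite mulrBl.
rewrite eGu -(fineK Jfin) -(fineK Ifin) -!EFinM => -[e]; congr EFin.
by rewrite -mulrA -e mulKf// gt_eqF.
Qed.

End RotationPolar.

(** * Borel representatives of radial symbols *)

Section CompletedLebesgue.
Context {R : realType}.
Local Notation Rb := (measurableTypeR R).
Local Notation Rl := (lebesgueTypeR R).
Local Notation lambda := (@lebesgue_measure R).
Local Notation clambda := (@completed_lebesgue_measure R).

Lemma measurable_lebesgueTypeR (A : set R) :
  measurable (A : set Rb) -> measurable (A : set Rl).
Proof. by move=> mA; exact: (sub_caratheodory (@wlength R idfun)). Qed.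

Lemma measurable_id_lebesgueTypeR : measurable_fun [set: Rl] (id : Rl -> Rb).
Proof. by move=> _ A mA; rewrite setTI; exact: measurable_lebesgueTypeR. Qed.

(** The identity is measurable from Lebesgue to Borel sets, and the two measures agree on Borel
    sets. *)
Lemma integral_completed_lebesgue (D : set R) (f : R -> \bar R) :
  measurable (D : set Rb) -> measurable_fun (D : set Rb) f ->
  (\int[clambda]_(x in D) f x = \int[lambda]_(x in D) f x)%E.
Proof.
move=> mD mf.
have ge0 (g : R -> \bar R) : measurable_fun (D : set Rb) g -> (forall x, 0 <= g x)%E ->
    (\int[clambda]_(x in D) g x = \int[lambda]_(x in D) g x)%E.
  move=> mg g0.
  have /= := @ge0_integral_pushforward _ _ Rl Rb R id
    measurable_id_lebesgueTypeR clambda D g mD mg (fun y _ => g0 y).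
  rewrite preimage_id => <-.
  apply: eq_measure_integral => [|mp A mA _]; first exact: measurable_id_lebesgueTypeR.
  by [].
rewrite integralE [RHS]integralE; congr (_ - _)%E.
  by apply: ge0 => //; exact: measurable_funepos.
by apply: ge0 => //; exact: measurable_funeneg.
Qed.

(* A Lebesgue measurable function is Borel off a Borel null set containing the
   non-Borel parts of the countably many sets [f > q], [q] rational. *)
Lemma borel_modification (f : R -> R) :
  measurable_fun (`[0, +oo[ : set Rl) f ->
  exists N : set R, [/\ measurable (N : set Rb), lambda N = 0%E &
   forall N' : set R, measurable (N' : set Rb) -> N `<=` N' ->
   measurable_fun [set: Rb] (f \_ (`[0, +oo[ `\` N') : Rb -> R)].
Proof.
move=> mf.
have mI : measurable (`[0, +oo[ : set Rl) by apply: measurable_lebesgueTypeR; exact: measurable_itv.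
pose E (q : rat) : set R := `[0, +oo[ `&` f @^-1` `]ratr q, +oo[.
have mE q : (completed_algebra_gen lambda) (E q).
  rewrite -g_sigma_completed_algebra_genE completed_caratheodory_measurable.
  by apply: mf => //; exact: measurable_itv.
have [B hB] : exists B : rat -> set R * set R, forall q,
    [/\ measurable ((B q).1 : set Rb), measurable ((B q).2 : set Rb),
     lambda (B q).2 = 0%E, (B q).1 `<=` E q & E q `<=` (B q).1 `|` (B q).2].
  suff /choice[B hB] : forall q, exists p : set R * set R,
     [/\ measurable (p.1 : set Rb), measurable (p.2 : set Rb),
     lambda p.2 = 0%E, p.1 `<=` E q & E q `<=` p.1 `|` p.2] by exists B.
  move=> q; have [A mA [M [N [mN N0 MN]] AME]] := mE q.
  exists (A, N); split => //=.
  - by rewrite -AME; exact: subsetUl.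
  - by rewrite -AME; exact: setUS.
pose N := \bigcup_q (B q).2.
have mN : measurable (N : set Rb).
  by apply: bigcupT_measurable_rat => q; case: (hB q).
have N0 : lambda N = 0%E.
  apply/(@negligibleP _ _ _ lambda _ mN).1.
  pose F k := if unpickle k is Some q then (B q).2 else set0 : set Rb.
  have -> : N = \bigcup_k F k.
    apply/seteqP; split => x.
      move=> [q _ Bx]; exists (pickle q); first exact: I.
      by rewrite /F pickleK.
    move=> [k _]; rewrite /F; case: unpickle => // q Bx; by exists q.
  apply: negligible_bigcup => k; rewrite /F; case: unpickle => [q|]; last exact: negligible_set0.
  by have [_ m z _ _] := hB q; apply/negligibleP.
exists N; split => // N' mN' NN'.
set D := `[0, +oo[ `\` N'.
have mD : measurable (D : set Rb) by apply: measurableD => //; exact: measurable_itv.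
apply: (measurability _ (RGenOInfty.measurableE R)) => //.
move=> _ [_ [x ->] <-]; rewrite setTI.
(* Off D the extension is 0 and exceeds q exactly when q < 0. On D the set E q coincides with (B
   q).1, since the null parts lie in N'. *)
pose S (q : rat) : set R := if x < ratr q then ((B q).1 `&` D) `|` (if ratr q < 0 :> R then ~` D else set0) else set0.
have -> : (f \_ D) @^-1` `]x, +oo[ = \bigcup_q S q.
  apply/seteqP; split => y /=; rewrite ?in_itv/= ?andbT.
    move=> /rat_in_itvoo[q]; rewrite in_itv/= => /andP[xq qy].
    exists q => //; rewrite /S xq; move: qy; rewrite patchE.
    case: ifPn => [/set_mem yD qf|/negP yD q0].
      left; split => //; have [_ _ _ _ EB] := hB q.
      have : E q y by split; [case: yD|rewrite /= in_itv/= qf].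
      move=> /EB[//|By]; case: yD => _ yN; exfalso; apply: yN; apply: NN'.
      by exists q.
    by right; rewrite q0 => /mem_set.
  move=> [q _]; rewrite /S; case: ifPn => // xq [[By yD]|].
    have [_ _ _ BE _] := hB q.
    have [_] := BE _ By; rewrite /= in_itv/= andbT => qf.
    by rewrite patchE mem_set//; exact: lt_trans qf.
  case: ifPn => // q0 yD; rewrite patchE ifF; first exact: lt_trans q0.
  by apply/negP => /set_mem.
apply: bigcupT_measurable_rat => q; rewrite /S; case: ifP => // _.
have [mB _ _ _ _] := hB q.
apply: measurableU; first exact: measurableI.
by case: ifP => // _; exact: measurableC.
Qed.

End CompletedLebesgue.

Section RadialNull.
Context {R : realType} (n : nat).
Hypothesis n_gt0 : (0 < n)%N.
Local Notation Rb := (measurableTypeR R).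
Local Notation lambda := (@lebesgue_measure R).
Local Notation Tn := (n.-tuple (Rb * Rb)%type).
Local Notation mun := (@tuple_lebesgue R n).

(** The ball contains the cube of half side 1 / (4n) and is contained in that of half side 1. The
    two bounds give the positivity and the existence of the constant in [polar_volume]. *)
Lemma tuple_lebesgue_ball_gt0 :
  (0 < \int[mun]_(t in [set t | (tuple_norm t < 1)%R]) (1 : R)%:E < +oo)%E.
Proof.
have mball := @measurable_tuple_norm_lt R n 1.
rewrite integral_cst//= mul1e; apply/andP; split.
  have d0 : 0 < (4 * n%:R)^-1 :> R by rewrite invr_gt0 mulr_gt0// ltr0n.
  apply: (@lt_le_trans _ _ (mun (tuple_box (tuple_origin n) (4 * n%:R)^-1))).
    rewrite tuple_lebesgue_box ?ltW// lte_fin !exprn_gt0// pmulrn_lgt0//.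
  apply: le_measure; rewrite ?inE//; first exact: measurable_tuple_box.
  move=> t tb; rewrite /= /tuple_norm -[X in _ < X]sqrtr1 ltr_sqrt//.
  have n1 : 1 <= n%:R :> R by rewrite ler1n.
  have e : (4 * n%:R)^-1 * (4 * n%:R) = 1 :> R by rewrite mulVf// mulf_neq0// pnatr_eq0 -?lt0n.
  (* Coordinates are at most d = 1 / (4n) <= 1 in modulus, so x^2 + y^2 <= 2 d and the n terms add
     up to at most 1 / 2. *)
  apply: (@le_lt_trans _ _ (\sum_(j < n) (2 * (4 * n%:R)^-1))).
    apply: ler_sum => j _; have := tb j; rewrite tnth_nseq/= !sub0r !add0r -!ler_norml.
    set x := (tnth t j).1; set y := (tnth t j).2 => -[hx hy].
    rewrite -(real_normK (num_real x)) -(real_normK (num_real y)).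
    have := normr_ge0 x; have := normr_ge0 y; nra.
  rewrite sumr_const card_ord -mulr_natr; lra.
apply: (@le_lt_trans _ _ (mun (tuple_box (tuple_origin n) 1))).
  apply: le_measure; rewrite ?inE//; first exact: measurable_tuple_box.
  move=> t /= t1 j; rewrite tnth_nseq/= !sub0r !add0r -!ler_norml.
  have : (tnth t j).1 ^+ 2 + (tnth t j).2 ^+ 2 <= 1.
    have : \sum_i ((tnth t i).1 ^+ 2 + (tnth t i).2 ^+ 2) <= 1.
      rewrite -[X in _ <= X](expr1n _ 2) -[X in X <= _]sqr_sqrtr; last first.
        by apply: sumr_ge0 => i _; rewrite addr_ge0// sqr_ge0.
      by rewrite ler_pXn2r// ?nnegrE ?sqrtr_ge0// ltW.
    apply: le_trans; rewrite (bigD1 j)//= lerDl sumr_ge0// => i _.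
    by rewrite addr_ge0// sqr_ge0.
  rewrite -(real_normK (num_real (tnth t j).1)) -(real_normK (num_real (tnth t j).2)).
  have := normr_ge0 (tnth t j).1; have := normr_ge0 (tnth t j).2.
  by move=> h1 h2 h3; split; nra.
by rewrite tuple_lebesgue_box ?ltry.
Qed.

(** C / (2n) is the volume of the unit ball, so C is the area of the unit sphere. *)
Lemma polar_volume : exists2 C : R, 0 < C & polar_density 0 C (fun _ : Tn => 1).
Proof.
have /andP[b0 boo] := tuple_lebesgue_ball_gt0.
have [||r t r0|C [C0 CE pC]] := @polar_homogeneous R n n_gt0 0 (fun=> 1) _ _ _ boo => //.
  by rewrite expr0 mul1r.
exists C => //; move: b0; rewrite CE lte_fin pmulr_lgt0// invr_gt0 ltr0n.
by rewrite add0n muln_gt0/=.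
Qed.

(** The density r^(2n - 1) vanishes on the half-line only at 0. One direction allows a to be changed
    on a null set of radii, the other turns the essential bound on phi into one on a. *)
Lemma tuple_lebesgue_radial_null (S : set R) : measurable (S : set Rb) ->
  S `<=` `[0, +oo[ ->
  mun (@tuple_norm R n @^-1` S) = 0%E <-> lambda S = 0%E.
Proof.
move=> mS S0; have [C C0 pC] := polar_volume.
have := pC (fun r => (\1_S r)%:E) _ (fun r => _).
have mnS : measurable (@tuple_norm R n @^-1` S).
  by rewrite -[X in measurable X]setTI; exact: measurable_tuple_norm.
have -> : (\int[mun]_t ((\1_S (tuple_norm t))%:E * 1%:E) = mun (@tuple_norm R n @^-1` S))%E.
  transitivity (mun (@tuple_norm R n @^-1` S `&` setT)); last by rewrite setIT.
  by rewrite -integral_indic//; apply: eq_integral => t _; rewrite mule1.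
have -> : (\int[lambda]_(r in `[0%R, +oo[) ((\1_S r)%:E * (r ^+ (0 + 2 * n - 1))%:E) =
    \int[lambda]_(r in S) (r ^+ (2 * n - 1))%:E)%E.
  rewrite [RHS]integral_mkcond [LHS]integral_mkcond; apply: eq_integral => r _.
  rewrite !patchE indicE; have [rS|rS] := boolP (r \in S).
    by rewrite mem_set ?mul1e//; apply: S0; exact: set_mem.
  by rewrite mul0e; case: ifP.
move=> h; rewrite h; last first.
- by move=> r; rewrite lee_fin indicE ler0n.
- by apply/measurable_EFinP; exact: measurable_indic.
have mX : measurable_fun S (fun r : R => (r ^+ (2 * n - 1))%:E).
  by apply/measurable_EFinP; apply: measurable_funTS; exact: measurable_funX.
split => [/eqP|l0]; last by rewrite null_set_integral ?mule0.
rewrite mule_eq0 eqe gt_eqF//= => /eqP i0.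
have abs0 : (\int[lambda]_(r in S) `|(r ^+ (2 * n - 1))%:E| = 0)%E.
  rewrite -i0; apply: eq_integral => r /set_mem /S0; rewrite /= in_itv/= andbT => r0.
  by rewrite ger0_norm ?exprn_ge0.
have /(ae_eq_integral_abs lambda mS mX)[N [mN N0 sN]] := abs0.
have : S `<=` N `|` [set 0].
  move=> r rS; have [->|r0] := eqVneq r 0; [by right|left].
  apply: sN => /= /(_ rS)[] /eqP; rewrite expf_eq0 (negbTE r0) andbF//.
move=> SN; have nS : lambda.-negligible (N `|` [set 0] : set Rb).
  apply: negligibleU; first exact/negligibleP.
  by apply/negligibleP => //; exact: lebesgue_measure_set1.
apply/(@negligibleP _ _ _ lambda _ mS).1; have [B [mB B0 sB]] := nS.
by exists B; split => // r /SN/sB.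
Qed.

End RadialNull.

Section RadialSymbol.
Context {R : realType} (n : nat).
Hypothesis n_gt0 : (0 < n)%N.
Local Notation Rb := (measurableTypeR R).
Local Notation Rl := (lebesgueTypeR R).
Local Notation lambda := (@lebesgue_measure R).
Local Notation mun := (@tuple_lebesgue R n).
Local Notation muC := (lebesgue_Cn R n).

Lemma enorm_ge0 (z : 'cV[R[i]]_n) : 0 <= enorm z.
Proof. exact: sqrtr_ge0. Qed.

Lemma tuple_norm_pairs (z : 'cV[R[i]]_n) : tuple_norm (pairs_of_Cn z) = enorm z.
Proof. by rewrite -enorm_Cn_of_pairs pairs_of_CnK. Qed.

Lemma negligible_radial (N : set R) : measurable (N : set Rb) -> lambda N = 0%E ->
  muC.-negligible [set z | N (enorm z)].
Proof.
move=> mN N0; pose S := N `&` `[0, +oo[.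
have mS : measurable (S : set Rb).
  by apply: measurableI => //; exact: measurable_itv.
have lS : lambda S = 0%E.
  by apply: subset_measure0 N0 => //; exact: subIsetl.
have := (tuple_lebesgue_radial_null n_gt0 mS (@subIsetr _ _ _)).2 lS.
have mnS : measurable (@tuple_norm R n @^-1` S).
  by rewrite -[X in measurable X]setTI; exact: measurable_tuple_norm.
rewrite -(lebesgue_Cn_pairs mnS) => mu0.
exists (@pairs_of_Cn R n @^-1` (@tuple_norm R n @^-1` S)); split => //.
  by rewrite -[X in measurable X]setTI; exact: measurable_pairs_of_Cn.
move=> z /= Nz; rewrite /S tuple_norm_pairs; split => //=.
by rewrite in_itv/= enorm_ge0.
Qed.

(** The polar formula takes Borel functions of the radius, and domination takes a bound at every
    radius; both are achieved by setting a to 0 on a null set and on negative radii. *)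
Lemma radial_symbol (phi : 'cV[R[i]]_n -> R[i]) (a : R -> R[i]) :
  Linfty phi ->
  cmeasurable_fun (`[0, +oo[ : set (lebesgueTypeR R)) a ->
  {ae muC, forall z, phi z = a (enorm z)} ->
  exists b1 b2 : R -> R, exists M : R,
  [/\ measurable_fun [set: Rb] (b1 : Rb -> R) /\
      measurable_fun [set: Rb] (b2 : Rb -> R),
      (forall r, `|b1 r| <= M) /\ (forall r, `|b2 r| <= M),
      {ae muC, forall z, phi z = b1 (enorm z) +i* b2 (enorm z)} &
      exists N : set R, [/\ measurable (N : set Rb), lambda N = 0%E &
        forall r, 0 <= r -> ~ N r -> a r = b1 r +i* b2 r]].
Proof.
move=> [mphi phioo] [mRe mIm] phia.
have [N1 [mN1 N10 bN1]] := borel_modification mRe.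
have [N2 [mN2 N20 bN2]] := borel_modification mIm.
pose N0 := N1 `|` N2.
have mN0 : measurable (N0 : set Rb) by exact: measurableU.
have mg1 := bN1 N0 mN0 (@subsetUl _ _ _).
have mg2 := bN2 N0 mN0 (@subsetUr _ _ _).
set g1 := _ \_ _ in mg1; set g2 := _ \_ _ in mg2.
(* An essential supremum is an extended real; 0 is a bound in the formal case -oo. *)
have [M0 hM0] : exists M : R, (ess_sup muC (fun z => (normc (phi z))%:E) <= M%:E)%E.
  move: phioo; case: (ess_sup _ _) => [r _|//|_]; first by exists r.
  by exists 0; rewrite leNye.
pose M := Num.max M0 0.
have M_ge0 : 0 <= M by rewrite /M le_max lexx orbT.
have phiM : {ae muC, forall z, normc (phi z) <= M}.
  have := ess_sup_ge muC (fun z => (normc (phi z))%:E).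
  apply: filterS => z hz; rewrite -lee_fin; apply: (le_trans hz).
  by apply: (le_trans hM0); rewrite lee_fin /M le_max lexx.
(* The radii at which the Borel version exceeds M. Above them phi differs from a(|z|) or exceeds M,
   so they form a null set. *)
pose S := `[0, +oo[ `&` ([set r | M < `|g1 r|] `|` [set r | M < `|g2 r|]).
have mS : measurable (S : set Rb).
  have mabs (g : R -> R) : measurable_fun [set: Rb] (g : Rb -> R) ->
      measurable ([set r | M < `|g r|] : set Rb).
    move=> mg; have -> : [set r | M < `|g r|] = (fun r => `|g r|) @^-1` `]M, +oo[.
      by apply/seteqP; split => r /=; rewrite in_itv/= andbT.
    rewrite -[X in measurable X]setTI.
    by apply: (measurableT_comp _ mg) => //; exact: measurable_itv.
  apply: measurableI; first exact: measurable_itv.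
  by apply: measurableU; exact: mabs.
have S0 : lambda S = 0%E.
  apply/(tuple_lebesgue_radial_null n_gt0 mS (@subIsetl _ _ _)).1.
  have mnS : measurable (@tuple_norm R n @^-1` S).
    by rewrite -[X in measurable X]setTI; exact: measurable_tuple_norm.
  rewrite -(lebesgue_Cn_pairs mnS).
  have mpS : measurable (@pairs_of_Cn R n @^-1` (@tuple_norm R n @^-1` S) : set (Cn R n)).
    by rewrite -[X in measurable X]setTI; exact: measurable_pairs_of_Cn.
  apply/(@negligibleP _ _ _ muC _ mpS).1.
  apply: (negligibleS _ (negligibleU phia phiM)) => z /=.
  rewrite tuple_norm_pairs => -[r0 hS].
  have [e|ne] := pselect (phi z = a (enorm z)); last by left.
  right => le.
  case: hS => /=; rewrite ltNge => /negP; apply.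
    rewrite /g1 patchE; case: ifPn => _; last by rewrite normr0.
    by rewrite -e; apply: le_trans le; exact: normRe_le.
  rewrite /g2 patchE; case: ifPn => _; last by rewrite normr0.
  by rewrite -e; apply: le_trans le; exact: normIm_le.
pose N := N0 `|` S.
have mN : measurable (N : set Rb) by exact: measurableU.
have lN : lambda N = 0%E.
  apply/(@negligibleP _ _ _ lambda _ mN).1.
  by apply: negligibleU; [apply: negligibleU|]; apply/negligibleP.
have sN1 : N1 `<=` N by move=> r ?; left; left.
have sN2 : N2 `<=` N by move=> r ?; left; right.
exists ((fun r => complex.Re (a r)) \_ (`[0, +oo[ `\` N)).
exists ((fun r => complex.Im (a r)) \_ (`[0, +oo[ `\` N)), M.
have aE r : 0 <= r -> ~ N r -> a r =
    ((fun r => complex.Re (a r)) \_ (`[0, +oo[ `\` N)) r +i*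
    ((fun r => complex.Im (a r)) \_ (`[0, +oo[ `\` N)) r.
  move=> r0 Nr; rewrite !patchE mem_set; first by case: (a r).
  by split => //=; rewrite in_itv/= r0.
split.
- by split; [exact: bN1|exact: bN2].
- split=> r; rewrite patchE; case: ifPn => [/set_mem[r0 Nr]|]; rewrite ?normr0//.
    rewrite leNgt; apply/negP => Mr; apply: (Nr); right; split => //; left.
    rewrite /= /g1 patchE; case: ifPn => // /negP; case; apply/mem_set; split => //.
    by move=> N0r; apply: Nr; left.
  rewrite leNgt; apply/negP => Mr; apply: (Nr); right; split => //; right.
  rewrite /= /g2 patchE; case: ifPn => // /negP; case; apply/mem_set; split => //.
  by move=> N0r; apply: Nr; left.
- apply: (negligibleS _ (negligibleU phia (negligible_radial mN lN))) => z /= h.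
  have [Nz|Nz] := pselect (N (enorm z)); first by right.
  by left => e; apply: h; rewrite -aE// enorm_ge0.
- by exists N.
Qed.

End RadialSymbol.

(** * Fock space *)

Section HomogeneousPolynomials.
Context {R : realType} (n m : nat).
Variable p : 'cV[R[i]]_n -> R[i].
Hypothesis hp : homog_poly m p.

Lemma homog_polyZ (c : R[i]) (z : 'cV[R[i]]_n) : p (c *: z) = c ^+ m * p z.
Proof.
have [q hq ->] := hp; rewrite !mevalE mulr_sumr.
rewrite !big_seq; apply: eq_bigr => mm mmq.
have := dhomog_mf hq mmq => <-.
rewrite mulrCA; congr (_ * _).
under eq_bigr do rewrite mxE exprMn.
rewrite big_split/=; congr (_ * _).
by rewrite mdegE prodrXr.
Qed.

Lemma normc_coord_le (z : 'cV[R[i]]_n) j : normc (z j 0) <= enorm z.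
Proof.
rewrite -(@ler_pXn2r _ 2)// ?nnegrE ?normc_ge0 ?sqrtr_ge0// sqr_sqrtr; last first.
  by apply: sumr_ge0 => i _; rewrite sqr_ge0.
by rewrite (bigD1 j)//= lerDl sumr_ge0// => i _; rewrite sqr_ge0.
Qed.

Lemma normc_prod (I : Type) (s : seq I) (P : pred I) (F : I -> R[i]) :
  normc (\prod_(i <- s | P i) F i) = \prod_(i <- s | P i) normc (F i).
Proof. by elim/big_rec2: _ => [|i x y _ <-]; [exact: normc1|rewrite normcM]. Qed.

Lemma normcX (c : R[i]) k : normc (c ^+ k) = normc c ^+ k.
Proof. by elim: k => [|k IH]; [exact: normc1|rewrite !exprS normcM IH]. Qed.

Lemma normc_sum_le (I : Type) (s : seq I) (F : I -> R[i]) :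
  normc (\sum_(i <- s) F i) <= \sum_(i <- s) normc (F i).
Proof.
elim/big_rec2: _ => [|i x y _ h]; first by rewrite normc0.
by apply: (le_trans (le_normcD _ _)); rewrite lerD2l.
Qed.

(** On the unit ball every monomial has modulus at most 1, so the moduli of the coefficients add up
    to a bound. *)
Lemma homog_poly_bounded : exists M : R, forall z, enorm z <= 1 -> normc (p z) <= M.
Proof.
have [q hq ->] := hp; exists (\sum_(mm <- msupp q) normc (mcoeff mm q)).
move=> z z1; rewrite mevalE; apply: (le_trans (normc_sum_le _ _)).
apply: ler_sum => mm _; rewrite normcM normc_prod.
rewrite -[X in _ <= X]mulr1 ler_wpM2l ?normc_ge0//.
apply: prodr_ile1 => j _; rewrite normcX exprn_ge0 ?normc_ge0//=.
by rewrite exprn_ile1 ?normc_ge0// (le_trans (normc_coord_le _ _)).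
Qed.

End HomogeneousPolynomials.

Lemma differentiable_sumr {R : realType} (V : normedModType R[i]) (I : Type) (s : seq I)
    (F : I -> V -> R[i]) (x : V) : (forall i, differentiable (F i) x) ->
  differentiable (fun y => \sum_(i <- s) F i y) x.
Proof.
move=> dF; elim: s => [|i s IH].
  by under eq_fun do rewrite big_nil; exact: differentiable_cst.
under eq_fun do rewrite big_cons.
exact: differentiableD.
Qed.

Lemma differentiable_prodr {R : realType} (V : normedModType R[i]) (I : Type) (s : seq I)
    (F : I -> V -> R[i]) (x : V) : (forall i, differentiable (F i) x) ->
  differentiable (fun y => \prod_(i <- s) F i y) x.
Proof.
move=> dF; elim: s => [|i s IH].
  by under eq_fun do rewrite big_nil; exact: differentiable_cst.
under eq_fun do rewrite big_cons.
exact: differentiableM.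
Qed.

Lemma differentiable_homog_poly {R : realType} (n m : nat) (p : 'cV[R[i]]_n -> R[i]) :
  homog_poly m p -> forall z : 'cV[R[i]]_n, differentiable p z.
Proof.
move=> [q hq ->] z; under eq_fun do rewrite mevalE.
apply: differentiable_sumr => mm; apply: differentiableM; first exact: differentiable_cst.
apply: differentiable_prodr => j; apply: differentiable_exprn.
exact: differentiable_coord.
Qed.

(** * Weighted L2 spaces over an abstract measure *)

Section WeightedL2.
Context d (T : measurableType d) (R : realType).
Variable mu : {measure set T -> \bar R}.
Variable w : T -> R.
Hypothesis mw : measurable_fun setT w.
Hypothesis w_gt0 : forall z, 0 < w z.

Let w_ge0 z : 0 <= w z. Proof. exact: ltW. Qed.

Implicit Types f g k : T -> R[i].

(** Abstract in the measure and the weight: it is [L2h] by conversion over C^n, and it is used again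
    on tuples with the product measure. *)
Definition weighted_L2 f : Prop := cmeasurable_fun setT f /\
  (\int[mu]_z (normc (f z) ^+ 2 * w z)%:E < +oo)%E.

Lemma measurable_sqr_normc f : cmeasurable_fun setT f ->
  measurable_fun setT (fun z => normc (f z) ^+ 2).
Proof.
move=> [m1 m2]; under eq_fun do rewrite sqr_normc_ReIm.
by apply: measurable_funD; exact: measurable_funX.
Qed.

Lemma measurable_weighted_sqr f : cmeasurable_fun setT f ->
  measurable_fun setT (fun z => (normc (f z) ^+ 2 * w z)%:E).
Proof.
move=> mf; apply/measurable_EFinP; apply: measurable_funM => //.
exact: measurable_sqr_normc.
Qed.

Lemma cmeasurableM f g : cmeasurable_fun setT f -> cmeasurable_fun setT g ->
  cmeasurable_fun setT (fun z => f z * g z).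
Proof.
move=> [f1 f2] [g1 g2]; split.
  under eq_fun do rewrite ReM.
  by apply: measurable_funB; exact: measurable_funM.
under eq_fun do rewrite ImM.
by apply: measurable_funD; exact: measurable_funM.
Qed.

Lemma cmeasurableB f g : cmeasurable_fun setT f -> cmeasurable_fun setT g ->
  cmeasurable_fun setT (fun z => f z - g z).
Proof.
move=> [f1 f2] [g1 g2]; split.
  by under eq_fun do rewrite ReB; exact: measurable_funB.
by under eq_fun do rewrite ImB; exact: measurable_funB.
Qed.

Lemma cmeasurable_conj f : cmeasurable_fun setT f ->
  cmeasurable_fun setT (fun z => (f z)^*).
Proof.
move=> [f1 f2]; split.
  by have -> : (fun z => complex.Re (f z)^*) = (fun z => complex.Re (f z));
    [apply/funext => z; case: (f z)|].
have -> : (fun z => complex.Im (f z)^*) = (fun z => - complex.Im (f z)).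
  by apply/funext => z; case: (f z).
exact: measurable_funN.
Qed.

(* Everything is dominated by |f|^2 w + |g|^2 w. *)
Lemma weighted_L2_dom f g (u : T -> R) : weighted_L2 f -> weighted_L2 g ->
  measurable_fun setT u -> (exists c : R, 0 <= c /\
  forall z, `|u z| <= c * ((normc (f z) ^+ 2 + normc (g z) ^+ 2) * w z)) ->
  mu.-integrable setT (fun z => (u z)%:E).
Proof.
move=> [mf fi] [mg gi] m_u [c [c0 uc]].
have mfw := measurable_weighted_sqr mf; have mgw := measurable_weighted_sqr mg.
have int0 k : cmeasurable_fun setT k ->
    (\int[mu]_z (normc (k z) ^+ 2 * w z)%:E < +oo)%E ->
    mu.-integrable setT (fun z => (normc (k z) ^+ 2 * w z)%:E).
  move=> mk ki; apply/integrableP; split; first exact: measurable_weighted_sqr.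
  rewrite (_ : (\int[mu]_z `|(normc (k z) ^+ 2 * w z)%:E| =
    \int[mu]_z (normc (k z) ^+ 2 * w z)%:E)%E)//.
  by apply: eq_integral => z _; rewrite gee0_abs// lee_fin mulr_ge0 ?sqr_ge0 ?w_ge0.
apply: (@le_integrable _ _ _ mu setT measurableT _
  (fun z => c%:E * ((normc (f z) ^+ 2 * w z)%:E + (normc (g z) ^+ 2 * w z)%:E))%E).
- exact/measurable_EFinP.
- move=> z _; rewrite -EFinD -EFinM !abse_EFin lee_fin -mulrDl.
  by apply: (le_trans (uc z)); exact: ler_norm.
- apply: integrableZl => //; apply: integrableD => //; exact: int0.
Qed.

Lemma weighted_L2B f g : weighted_L2 f -> weighted_L2 g ->
  weighted_L2 (fun z => f z - g z).
Proof.
move=> Lf Lg; have mfg := cmeasurableB Lf.1 Lg.1; split => //.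
have /integrableP[_] : mu.-integrable setT
    (fun z => (normc (f z - g z) ^+ 2 * w z)%:E).
  apply: (weighted_L2_dom Lf Lg).
    by apply: measurable_funM => //; exact: measurable_sqr_normc.
  (* The parallelogram law: 2 |f|^2 + 2 |g|^2 - |f - g|^2 = |f + g|^2. *)
  exists 2; split => // z.
  rewrite (ger0_norm (mulr_ge0 (sqr_ge0 _) (w_ge0 z))) mulrA ler_pM2r//.
  rewrite !sqr_normc_ReIm ReB ImB -subr_ge0.
  have := addr_ge0 (sqr_ge0 (complex.Re (f z) + complex.Re (g z)))
    (sqr_ge0 (complex.Im (f z) + complex.Im (g z))).
  by congr (_ <= _); ring.
apply: le_lt_trans; apply: ge0_le_integral => //.
- by move=> z _; rewrite lee_fin mulr_ge0 ?sqr_ge0 ?w_ge0.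
- exact: measurable_weighted_sqr.
- by apply: measurableT_comp => //; exact: measurable_weighted_sqr.
- by move=> z _; exact: lee_abs.
Qed.

Lemma weighted_L2M b f (M : R) : cmeasurable_fun setT b -> (forall z, normc (b z) <= M) ->
  weighted_L2 f -> weighted_L2 (fun z => b z * f z).
Proof.
move=> mb bM Lf; have mbf := cmeasurableM mb Lf.1; split => //.
have /integrableP[_] : mu.-integrable setT
    (fun z => (normc (b z * f z) ^+ 2 * w z)%:E).
  apply: (weighted_L2_dom Lf Lf).
    by apply: measurable_funM => //; exact: measurable_sqr_normc.
  exists (M ^+ 2); split => [|z]; first exact: sqr_ge0.
  rewrite (ger0_norm (mulr_ge0 (sqr_ge0 _) (w_ge0 z))) mulrA ler_pM2r// normcM exprMn.
  have := bM z; have := normc_ge0 (b z) => h0 h1.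
  apply: ler_pM; rewrite ?sqr_ge0// ?lerDl ?sqr_ge0//.
  by rewrite ler_pXn2r// nnegrE (le_trans h0).
apply: le_lt_trans; apply: ge0_le_integral => //.
- by move=> z _; rewrite lee_fin mulr_ge0 ?sqr_ge0 ?w_ge0.
- exact: measurable_weighted_sqr.
- by apply: measurableT_comp => //; exact: measurable_weighted_sqr.
- by move=> z _; exact: lee_abs.
Qed.

Lemma integrable_weighted_inner f g : weighted_L2 f -> weighted_L2 g ->
  mu.-integrable setT
    (EFin \o (fun z => complex.Re (f z * (g z)^* * (w z)%:C))) /\
  mu.-integrable setT
    (EFin \o (fun z => complex.Im (f z * (g z)^* * (w z)%:C))).
Proof.
move=> Lf Lg; have [m1 m2] : cmeasurable_fun setT
    (fun z => f z * (g z)^* * (w z)%:C).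
  apply: cmeasurableM => //; apply: cmeasurableM; first exact: Lf.1.
  exact: cmeasurable_conj Lg.1.
have bound z : normc (f z * (g z)^* * (w z)%:C) <=
    1 * ((normc (f z) ^+ 2 + normc (g z) ^+ 2) * w z).
  rewrite !normcM mul1r.
  have -> : normc (w z)%:C = w z by rewrite /= expr0n/= addr0 sqrtr_sqr gtr0_norm.
  rewrite normc_conj ler_pM2r//.
  by have := normc_ge0 (f z); have := normc_ge0 (g z); nra.
split.
  apply: (weighted_L2_dom Lf Lg m1); exists 1; split => // z.
  by apply: le_trans (bound z); exact: normRe_le.
apply: (weighted_L2_dom Lf Lg m2); exists 1; split => // z.
by apply: le_trans (bound z); exact: normIm_le.
Qed.

Lemma weighted_innerB f g k : weighted_L2 f -> weighted_L2 g -> weighted_L2 k ->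
  cintegral mu setT (fun z => (f z - g z) * (k z)^* * (w z)%:C) =
  cintegral mu setT (fun z => f z * (k z)^* * (w z)%:C) -
  cintegral mu setT (fun z => g z * (k z)^* * (w z)%:C).
Proof.
move=> Lf Lg Lk.
have [f1 f2] := integrable_weighted_inner Lf Lk.
have [g1 g2] := integrable_weighted_inner Lg Lk.
rewrite /cintegral.
under eq_Rintegral do rewrite !mulrBl ReB.
under [X in _ +i* X]eq_Rintegral do rewrite !mulrBl ImB.
by rewrite !RintegralB.
Qed.

Lemma weighted_inner_self0 f : weighted_L2 f ->
  cintegral mu setT (fun z => f z * (f z)^* * (w z)%:C) = 0 ->
  {ae mu, forall z, f z = 0}.
Proof.
move=> Lf [i0 _].
have eF z : complex.Re (f z * (f z)^* * (w z)%:C) = normc (f z) ^+ 2 * w z.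
  by rewrite mulc_conj ReM/= mulr0 subr0.
have {}i0 : (\int[mu]_z `|(normc (f z) ^+ 2 * w z)%:E| = 0)%E.
  transitivity (\int[mu]_z (normc (f z) ^+ 2 * w z)%:E)%E.
    by apply: eq_integral => z _; rewrite gee0_abs// lee_fin mulr_ge0 ?sqr_ge0 ?w_ge0.
  move: i0; under eq_Rintegral do rewrite eF.
  (* [fine] sends +oo to 0, so membership in L2 is what makes the extended integral itself 0. *)
  rewrite /Rintegral => i0; rewrite -[LHS]fineK ?i0//.
  rewrite ge0_fin_numE ?Lf.2//; apply: integral_ge0 => z _.
  by rewrite lee_fin mulr_ge0 ?sqr_ge0 ?w_ge0.
have /(ae_eq_integral_abs mu measurableT (measurable_weighted_sqr Lf.1)) := i0.
apply: filterS => z /= /(_ I) [] /eqP.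
rewrite mulf_eq0 [w z == 0]gt_eqF// orbF sqrf_eq0 => /eqP.
exact: eq0_normc.
Qed.

End WeightedL2.

(** * Entire functions, the radial weight and polynomials in the Fock space *)

Section EntireFunctions.
Context {R : realType} (n : nat).
Local Notation Rb := (measurableTypeR R).
Local Notation Tn := (n.-tuple (Rb * Rb)%type).
Local Notation mun := (@tuple_lebesgue R n).
Local Notation muC := (lebesgue_Cn R n).
Variable f : 'cV[R[i]]_n -> R[i].
Hypothesis ef : entire f.

Let cont_eps (w : 'cV[R[i]]_n) (e : R) : 0 < e -> exists2 r : R, 0 < r &
  forall v : 'cV[R[i]]_n, (forall j, normc (v j 0 - w j 0) < r) ->
    normc (f v - f w) < e.
Proof. by apply: continuous_cvP; exact: differentiable_continuous. Qed.

Lemma measurable_entire_tuple :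
  measurable_fun setT ((fun t => complex.Re (f (Cn_of_pairs t))) : Tn -> R) /\
  measurable_fun setT ((fun t => complex.Im (f (Cn_of_pairs t))) : Tn -> R).
Proof.
split.
  apply: (@measurable_Cn_continuous R n (fun z => complex.Re (f z))) => w e e0.
  have [r r0 hr] := cont_eps w e0; exists r => // v /hr; apply: le_lt_trans.
  by rewrite -ReB normRe_le.
apply: (@measurable_Cn_continuous R n (fun z => complex.Im (f z))) => w e e0.
have [r r0 hr] := cont_eps w e0; exists r => // v /hr; apply: le_lt_trans.
by rewrite -ImB normIm_le.
Qed.

Lemma cmeasurable_entire : cmeasurable_fun [set: Cn R n] f.
Proof.
have [m1 m2] := measurable_entire_tuple; split.
  have -> : (fun z : Cn R n => complex.Re (f z)) =
    (fun t => complex.Re (f (Cn_of_pairs t))) \o @pairs_of_Cn R n.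
    by apply/funext => z /=; rewrite pairs_of_CnK.
  exact: (measurableT_comp m1 (@measurable_pairs_of_Cn R n)).
have -> : (fun z : Cn R n => complex.Im (f z)) =
  (fun t => complex.Im (f (Cn_of_pairs t))) \o @pairs_of_Cn R n.
  by apply/funext => z /=; rewrite pairs_of_CnK.
exact: (measurableT_comp m2 (@measurable_pairs_of_Cn R n)).
Qed.

(** A nonzero value persists, by continuity, on a cube around the point, and cubes have positive
    measure. *)
Lemma entire_ae0 : {ae muC, forall z, f z = 0} -> forall z, f z = 0.
Proof.
move=> f0 z; have [//|fz0] := eqVneq (f z) 0.
have e0 : 0 < normc (f z).
  rewrite lt_neqAle normc_ge0 andbT eq_sym; apply/negP => /eqP /eq0_normc.
  by move/eqP; rewrite (negbTE fz0).
have [r r0 hr] := cont_eps z e0.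
pose B := tuple_box (pairs_of_Cn z) (r / 4).
have mB : measurable B := measurable_tuple_box _ _.
have mpB : measurable (@pairs_of_Cn R n @^-1` B : set (Cn R n)).
  by rewrite -[X in measurable X]setTI; exact: measurable_pairs_of_Cn.
have r4 : 0 < r / 4 by rewrite divr_gt0.
have : mun B = 0%E.
  rewrite -(lebesgue_Cn_pairs mB); apply/(@negligibleP _ _ _ muC _ mpB).1.
  move: f0 => [N [mN N0 sN]]; exists N; split => // v hv; apply: sN => /= fv.
  suff /hr : forall j, normc (v j 0 - z j 0) < r by rewrite fv sub0r normcN ltxx.
  move=> j.
  have [/andP[a1 a2] /andP[b1 b2]] := hv j.
  move: a1 a2 b1 b2; rewrite !tnth_mktuple/= => a1 a2 b1 b2.
  apply: (le_lt_trans (normc_le_ReIm _)); rewrite ReB ImB.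
  have h1 : `|complex.Re (v j 0) - complex.Re (z j 0)| <= r / 4.
    by rewrite ler_norml; apply/andP; split; lra.
  have h2 : `|complex.Im (v j 0) - complex.Im (z j 0)| <= r / 4.
    by rewrite ler_norml; apply/andP; split; lra.
  lra.
rewrite tuple_lebesgue_box ?ltW// => /eqP; rewrite eqe gt_eqF//.
by rewrite !exprn_gt0// pmulrn_lgt0.
Qed.

End EntireFunctions.

Section RadialWeight.
Context {R : realType} (n : nat) (h : R -> R).
Hypothesis h_continuous : {within `[0, +oo[, continuous h}.
Local Notation Rb := (measurableTypeR R).
Local Notation Tn := (n.-tuple (Rb * Rb)%type).
Local Notation mun := (@tuple_lebesgue R n).
Local Notation muC := (lebesgue_Cn R n).

(** Continuity of h is given on [0, +oo[ only; extension by 0 yields a Borel function on the line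
    that has the right value at every norm. *)
Definition radial_weight : R -> R := (fun r => expR (- 2 * h r)) \_ `[0, +oo[.

Lemma radial_weightE r : 0 <= r -> radial_weight r = expR (- 2 * h r).
Proof. by move=> r0; rewrite /radial_weight patchE mem_set//= in_itv/= r0. Qed.

Lemma radial_weight_ge0 r : 0 <= radial_weight r.
Proof. by rewrite /radial_weight patchE; case: ifP => // _; exact: expR_ge0. Qed.

Lemma measurable_radial_weight : measurable_fun [set: Rb] (radial_weight : Rb -> Rb).
Proof.
apply/(measurable_restrict _ _ _) => //; rewrite setTI.
apply: measurableT_comp => //; apply: measurable_funM => //.
exact: subspace_continuous_measurable_fun.
Qed.

(** h attains a maximum on [0, 1]. The bound compares weighted with unweighted integrals over the
    unit ball and makes the moments positive. *)
Lemma radial_weight_lower :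
  exists2 w0 : R, 0 < w0 & forall r, 0 <= r <= 1 -> w0 <= radial_weight r.
Proof.
have ch : {within `[0, 1], continuous h}.
  apply: continuous_subspaceW h_continuous => r /=; rewrite !in_itv/= => /andP[-> _].
  by [].
have [c _ hc] := EVT_max ler01 ch.
exists (expR (- 2 * h c)); first exact: expR_gt0.
move=> r r01; have /andP[r0 _] := r01; rewrite radial_weightE// ler_expR.
by have := hc r; rewrite in_itv/= => /(_ r01); lra.
Qed.

Lemma weightE (z : 'cV[R[i]]_n) : weight h z = radial_weight (enorm z).
Proof. by rewrite radial_weightE// enorm_ge0. Qed.

Lemma weight_gt0 (z : 'cV[R[i]]_n) : 0 < weight h z.
Proof. exact: expR_gt0. Qed.

Lemma measurable_enorm : measurable_fun [set: Cn R n] (@enorm R n : Cn R n -> Rb).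
Proof.
have -> : @enorm R n = (@tuple_norm R n) \o @pairs_of_Cn R n.
  by apply/funext => z /=; rewrite tuple_norm_pairs.
by apply: measurableT_comp; [exact: measurable_tuple_norm|exact: measurable_pairs_of_Cn].
Qed.

Lemma measurable_weight : measurable_fun [set: Cn R n] (weight h : Cn R n -> R).
Proof.
have -> : weight h = radial_weight \o @enorm R n by apply/funext => z; exact: weightE.
by apply: measurableT_comp; [exact: measurable_radial_weight|exact: measurable_enorm].
Qed.

Lemma integral_sqr_entire (f : 'cV[R[i]]_n -> R[i]) : entire f ->
  (\int[muC]_z (normc (f z) ^+ 2 * weight h z)%:E =
   \int[mun]_t (normc (f (Cn_of_pairs t)) ^+ 2 * radial_weight (tuple_norm t))%:E)%E.
Proof.
move=> ef; rewrite -ge0_integral_Cn.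
- by apply: eq_integral => z _; rewrite pairs_of_CnK tuple_norm_pairs weightE.
- have [m1 m2] := measurable_entire_tuple ef.
  apply/measurable_EFinP; apply: measurable_funM.
    exact: (@measurable_sqr_normc _ Tn R (fun t => f (Cn_of_pairs t))).
  apply: measurableT_comp; [exact: measurable_radial_weight|exact: measurable_tuple_norm].
- by move=> t; rewrite lee_fin mulr_ge0 ?sqr_ge0 ?radial_weight_ge0.
Qed.

End RadialWeight.

Section FockPolynomials.
Context {R : realType} (n : nat) (h : R -> R).
Hypothesis n_gt0 : (0 < n)%N.
Hypothesis h_continuous : {within `[0, +oo[, continuous h}.
Local Notation Rb := (measurableTypeR R).
Local Notation Tn := (n.-tuple (Rb * Rb)%type).
Local Notation lambda := (@lebesgue_measure R).
Local Notation mun := (@tuple_lebesgue R n).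
Local Notation muC := (lebesgue_Cn R n).
Hypothesis h_moments : forall m : nat,
  (\int[@completed_lebesgue_measure R]_(r in `[0%R, +oo[)
     (r ^+ (2 * m + 2 * n - 1) * expR (- 2 * h r))%:E < +oo)%E.

Lemma measurable_moment (d : nat) :
  measurable_fun (`[0, +oo[ : set Rb) (fun r : R => r ^+ d * expR (- 2 * h r)).
Proof.
apply: measurable_funM; first by apply: measurable_funTS; exact: measurable_funX.
apply: measurableT_comp => //; apply: measurable_funM => //.
exact: subspace_continuous_measurable_fun.
Qed.

Lemma lebesgue_moments (m : nat) :
  (\int[lambda]_(r in `[0%R, +oo[)
     (r ^+ (2 * m + 2 * n - 1) * expR (- 2 * h r))%:E < +oo)%E.
Proof.
have := h_moments m; rewrite integral_completed_lebesgue//.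
by apply/measurable_EFinP; exact: measurable_moment.
Qed.

Lemma integrable_moment (m : nat) : lambda.-integrable `[0, +oo[
  (fun r : R => (r ^+ (2 * m + 2 * n - 1) * expR (- 2 * h r))%:E).
Proof.
apply/integrableP; split; first by apply/measurable_EFinP; exact: measurable_moment.
rewrite (_ : integral _ _ _ = \int[lambda]_(r in `[0%R, +oo[)
  (r ^+ (2 * m + 2 * n - 1) * expR (- 2 * h r))%:E)%E; first exact: lebesgue_moments.
apply: eq_integral => r; rewrite inE/= in_itv/= andbT => r0.
by rewrite /= ger0_norm// mulr_ge0 ?exprn_ge0 ?expR_ge0.
Qed.

(** The denominator of the eigenvalue is at least the integral of w0 r^d over [0, 1[, that is w0 /
    (d + 1). *)
Lemma moment_gt0 (m : nat) : 0 < \int[lambda]_(r in `[0, +oo[)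
  (r ^+ (2 * m + 2 * n - 1) * expR (- 2 * h r)).
Proof.
set d := (2 * m + 2 * n - 1)%N.
have [w0 w00 hw] := radial_weight_lower h_continuous.
have mX : measurable_fun (`[0, 1[ : set Rb) (fun r : R => (r ^+ d)%:E).
  by apply/measurable_EFinP; apply: measurable_funTS; exact: measurable_funX.
have sub : `[0, 1[ `<=` (`[0, +oo[ : set R).
  by move=> r /=; rewrite !in_itv/= => /andP[-> _].
have le : ((w0 / d.+1%:R)%:E <= \int[lambda]_(r in `[0%R, +oo[)
    (r ^+ d * expR (- 2 * h r))%:E)%E.
  have -> : ((w0 / d.+1%:R)%:E = \int[lambda]_(r in `[0%R, 1%R[) (w0%:E * (r ^+ d)%:E))%E.
    rewrite (@ge0_integralZl_EFin _ _ _ lambda `[0%R, 1%R[ _ (fun r => (r ^+ d)%:E) _ mX w0)//.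
      by rewrite integral_exprn0o// expr1n mul1r EFinM.
      by move=> r /=; rewrite in_itv/= => /andP[r0 _]; rewrite lee_fin exprn_ge0.
    exact: ltW.
  apply: (@le_trans _ _ (\int[lambda]_(r in `[0%R, 1%R[) (r ^+ d * expR (- 2 * h r))%:E)%E).
    apply: ge0_le_integral => //.
    - move=> r /=; rewrite in_itv/= => /andP[r0 _].
      by rewrite -EFinM lee_fin mulr_ge0 ?exprn_ge0// ltW.
    - exact: measurable_funeM.
    - apply/measurable_EFinP; apply: measurable_funS (measurable_moment d) => //.
    - move=> r /=; rewrite in_itv/= => /andP[r0 r1].
      rewrite -EFinM lee_fin mulrC ler_wpM2l ?exprn_ge0// -radial_weightE//.
      by apply: hw; rewrite r0 ltW.
  apply: ge0_subset_integral => //.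
    by apply/measurable_EFinP; exact: measurable_moment.
  move=> r /=; rewrite in_itv/= andbT => r0.
  by rewrite lee_fin mulr_ge0 ?exprn_ge0 ?expR_ge0.
have fin : (\int[lambda]_(r in `[0%R, +oo[) (r ^+ d * expR (- 2 * h r))%:E \is a fin_num)%E.
  by apply: integrable_fin_num => //; exact: integrable_moment.
rewrite -lte_fin /Rintegral fineK//; apply: lt_le_trans le.
by rewrite lte_fin divr_gt0.
Qed.

(** |p|^2 is homogeneous of degree 2m under real dilations, so the polar formula turns the squared
    norm into a constant times the m-th moment. *)
Lemma fock_homog_poly (m : nat) (p : 'cV[R[i]]_n -> R[i]) :
  homog_poly m p -> fock h p.
Proof.
move=> hp; have ep : entire p by move=> z; exact: differentiable_homog_poly hp z.
split; [exact: ep|split; first exact: cmeasurable_entire].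
rewrite integral_sqr_entire//.
have [m1 m2] := measurable_entire_tuple ep.
pose u (t : Tn) := normc (p (Cn_of_pairs t)) ^+ 2.
have mu_ : measurable_fun setT u.
  exact: (@measurable_sqr_normc _ Tn R (fun t => p (Cn_of_pairs t))).
have u0 t : 0 <= u t by exact: sqr_ge0.
have uhom r t : 0 < r -> u (tuple_mul r 0 t) = r ^+ (2 * m) * u t.
  move=> r0; rewrite /u Cn_of_pairs_mul (homog_polyZ hp) normcM exprMn normcX.
  by rewrite /= expr0n/= addr0 sqrtr_sqr gtr0_norm// -exprM mulnC.
have ufin : (\int[mun]_(t in [set t | (tuple_norm t < 1)%R]) (u t)%:E < +oo)%E.
  have [M hM] := homog_poly_bounded hp.
  have /andP[_ vfin] := @tuple_lebesgue_ball_gt0 R n n_gt0.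
  apply: (@le_lt_trans _ _
    (\int[mun]_(t in [set t | (tuple_norm t < 1)%R]) ((M ^+ 2)%:E * 1%:E))%E).
    apply: ge0_le_integral => //.
    - exact: measurable_tuple_norm_lt.
    - by move=> t _; rewrite lee_fin.
    - by apply/measurable_EFinP; exact: measurable_funTS.
    - move=> t /= t1; rewrite -EFinM lee_fin mulr1.
      have le := hM (Cn_of_pairs t); rewrite enorm_Cn_of_pairs in le.
      have {}le := le (ltW t1).
      by rewrite ler_pXn2r// nnegrE ?normc_ge0// (le_trans (normc_ge0 _) le).
  rewrite (@ge0_integralZl_EFin _ _ _ mun _ _ (fun=> 1%:E) _ _ (M ^+ 2))//;
    [|exact: measurable_tuple_norm_lt|exact: sqr_ge0].
  by rewrite lte_mul_pinfty// lee_fin sqr_ge0.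
have [C [C0 _ hC]] := polar_homogeneous n_gt0 mu_ u0 uhom ufin.
have mW := measurable_radial_weight h_continuous.
have -> : (\int[mun]_t (normc (p (Cn_of_pairs t)) ^+ 2 * radial_weight h (tuple_norm t))%:E =
    \int[mun]_t ((radial_weight h (tuple_norm t))%:E * (u t)%:E))%E.
  by apply: eq_integral => t _; rewrite -EFinM mulrC.
rewrite (hC (fun r => (radial_weight h r)%:E)).
- rewrite lte_mul_pinfty// ?lee_fin//.
  apply: le_lt_trans (lebesgue_moments m).
  rewrite le_eqVlt; apply/orP; left; apply/eqP; apply: eq_integral => r.
  rewrite inE/= in_itv/= andbT => r0.
  by rewrite radial_weightE// -EFinM mulrC.
- exact/measurable_EFinP.
- by move=> r; rewrite lee_fin radial_weight_ge0.
Qed.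

End FockPolynomials.

(** Rotation is multiplication by [cexp] on the imaginary axis, so this is continuity of a
    holomorphic function along a vertical line. *)
Lemma continuous_entire_rot {R : realType} (n : nat) (f : 'cV[R[i]]_n -> R[i])
    (t : n.-tuple (measurableTypeR R * measurableTypeR R)%type) : entire f ->
  continuous (fun a => complex.Re (f (Cn_of_pairs (tuple_rot t a)))) /\
  continuous (fun a => complex.Im (f (Cn_of_pairs (tuple_rot t a)))).
Proof.
move=> ef; pose F (x : R[i]) := f (cexp x *: Cn_of_pairs t).
have dF x : differentiable F x.
  apply: differentiable_comp; last exact: ef.
  apply: (@differentiable_comp _ _ _ _ cexp (fun c : R[i] => c *: Cn_of_pairs t)).
    exact: differentiable_cexp.
  exact: differentiableZl.
have E a : f (Cn_of_pairs (tuple_rot t a)) = F (0 +i* a).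
  by rewrite /F Cn_of_pairs_mul /cexp/= expR0 !mul1r.
have [c1 c2] := holomorphic_continuous_vert dF 0.
by split; under eq_fun do rewrite E.
Qed.

(** * Eigenvalues of radial Toeplitz operators *)

Section RadialOrthogonality.
Context {R : realType} (n : nat) (h : R -> R).
Hypothesis n_gt0 : (0 < n)%N.
Hypothesis h_continuous : {within `[0, +oo[, continuous h}.
Local Notation Rb := (measurableTypeR R).
Local Notation Tn := (n.-tuple (Rb * Rb)%type).
Local Notation lambda := (@lebesgue_measure R).
Local Notation mun := (@tuple_lebesgue R n).
Local Notation muC := (lebesgue_Cn R n).
Hypothesis h_moments : forall m : nat,
  (\int[@completed_lebesgue_measure R]_(r in `[0%R, +oo[)
     (r ^+ (2 * m + 2 * n - 1) * expR (- 2 * h r))%:E < +oo)%E.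
Variables (m : nat) (p k : 'cV[R[i]]_n -> R[i]).
Hypothesis hp : homog_poly m p.
Hypothesis fk : fock h k.

Let W (t : Tn) : R := radial_weight h (tuple_norm t).
Let W_gt0 t : 0 < W t.
Proof. by rewrite /W radial_weightE ?tuple_norm_ge0// expR_gt0. Qed.
Let mW : measurable_fun setT W.
Proof.
apply: measurableT_comp; [exact: measurable_radial_weight|exact: measurable_tuple_norm].
Qed.

Let fp : fock h p. Proof. exact: fock_homog_poly hp. Qed.

Lemma fock_weighted_tuple (f : 'cV[R[i]]_n -> R[i]) : fock h f ->
  weighted_L2 mun W (fun t => f (Cn_of_pairs t)).
Proof.
move=> [ef [_ If]]; split; first exact: measurable_entire_tuple.
by rewrite -integral_sqr_entire.
Qed.

(** G is a bounded radial factor times the weight. Its bound supplies both integrability conditions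
    of [integral_radial_mul], whose constant is then multiplied by 0. *)
Lemma integral_radial_homog_fock (c : R[i]) (G : R -> R) (M : R) : 0 <= M ->
  measurable_fun [set: Rb] (G : Rb -> Rb) ->
  (forall r, 0 <= r -> `|G r| <= M * radial_weight h r) ->
  (\int[lambda]_(r in `[0%R, +oo[) (G r * r ^+ (2 * m + 2 * n - 1))%:E = 0)%E ->
  (\int[mun]_t (G (tuple_norm t) *
     complex.Re (c * (p (Cn_of_pairs t) * (k (Cn_of_pairs t))^*)))%:E = 0)%E.
Proof.
move=> M0 mG GM G0.
pose Psi (t : Tn) := complex.Re (c * (p (Cn_of_pairs t) * (k (Cn_of_pairs t))^*)).
have Lp := fock_weighted_tuple fp; have Lk := fock_weighted_tuple fk.
have mPsi : measurable_fun setT Psi.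
  suff [] : cmeasurable_fun [set: Tn]
    (fun t => c * (p (Cn_of_pairs t) * (k (Cn_of_pairs t))^*)) by [].
  apply: cmeasurableM; first by split; exact: measurable_cst.
  by apply: cmeasurableM; [exact: Lp.1|exact: cmeasurable_conj Lk.1].
have cPsi t : continuous (fun a => Psi (tuple_rot t a)).
  have [p1 p2] := continuous_entire_rot t fp.1.
  have [k1 k2] := continuous_entire_rot t fk.1.
  have -> : (fun a => Psi (tuple_rot t a)) = (fun a =>
     complex.Re c * (complex.Re (p (Cn_of_pairs (tuple_rot t a))) *
       complex.Re (k (Cn_of_pairs (tuple_rot t a))) +
       complex.Im (p (Cn_of_pairs (tuple_rot t a))) *
       complex.Im (k (Cn_of_pairs (tuple_rot t a)))) +
     complex.Im c * (complex.Re (p (Cn_of_pairs (tuple_rot t a))) *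
       complex.Im (k (Cn_of_pairs (tuple_rot t a))) -
       complex.Im (p (Cn_of_pairs (tuple_rot t a))) *
       complex.Re (k (Cn_of_pairs (tuple_rot t a))))).
    apply/funext => a; rewrite /Psi.
    by case: (k _) => y1 y2; case: (p _) => x1 x2; rewrite !(ReM, ImM)/=; ring.
  move=> a; apply: cvgD; apply: cvgM; try exact: cvg_cst.
    by apply: cvgD; apply: cvgM; [exact: p1|exact: k1|exact: p2|exact: k2].
  by apply: cvgB; apply: cvgM; [exact: p1|exact: k2|exact: p2|exact: k1].
have PsiM t : `|Psi t| <= normc c * (normc (p (Cn_of_pairs t)) ^+ 2 +
    normc (k (Cn_of_pairs t)) ^+ 2).
  exact: normRe_mul_conj_le.
have hom r t : 0 < r ->
    rot_average Psi (tuple_mul r 0 t) = r ^+ (2 * m) * rot_average Psi t.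
  move=> r0; rewrite /rot_average.
  have := rotation_average_dilation fk.1 (homog_polyZ hp) c (Cn_of_pairs t) r0.
  under eq_Rintegral => a _ do rewrite -(Cn_of_pairs_mul r 0) -Cn_of_pairs_mul.
  move=> ->; congr (_ * _); apply: eq_Rintegral => a _.
  by rewrite -Cn_of_pairs_mul.
have fin : (\int[mun]_(t in [set t | (tuple_norm t < 1)%R]) `|(Psi t)%:E| < +oo)%E.
  pose B := [set t : Tn | tuple_norm t < 1].
  have mB : measurable B := measurable_tuple_norm_lt _.
  have mu_ : measurable_fun setT (Psi \_ B).
    apply/(measurable_restrict Psi mB measurableT); rewrite setTI.
    exact: measurable_funTS.
  have /integrableP[_ ifin] : mun.-integrable setT (fun t => ((Psi \_ B) t)%:E).
    have [w0 w00 hw] := radial_weight_lower h_continuous.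
    apply: (weighted_L2_dom mW W_gt0 Lp Lk mu_).
    (* On the unit ball the weight is at least w0, so division by w0 inserts the weight into the
       bound on Psi. *)
    exists (normc c / w0); split; first by rewrite divr_ge0 ?normc_ge0 ?ltW.
    move=> t; rewrite patchE; case: ifPn => [/set_mem tB|_]; last first.
      by rewrite normr0 mulr_ge0 ?divr_ge0 ?normc_ge0 ?mulr_ge0 ?addr_ge0 ?sqr_ge0 ?ltW.
    apply: (le_trans (PsiM t)); rewrite -mulrA ler_wpM2l ?normc_ge0//.
    rewrite mulrCA ler_peMr ?addr_ge0 ?sqr_ge0// mulrC ler_pdivlMr// mul1r.
    by apply: hw; rewrite tuple_norm_ge0 ltW.
  apply: le_lt_trans ifin.
  have -> : (\int[mun]_(t in B) `|(Psi t)%:E| = \int[mun]_(t in B) `|((Psi \_ B) t)%:E|)%E.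
    by apply: eq_integral => t tB; rewrite patchE tB.
  apply: ge0_subset_integral => //.
  by apply: measurableT_comp => //; exact/measurable_EFinP.
have [C hC] := integral_radial_mul n_gt0 mPsi cPsi hom fin.
have -> : (\int[mun]_t (G (tuple_norm t) * Psi t)%:E =
   C%:E * \int[lambda]_(r in `[0%R, +oo[) (G r * r ^+ (2 * m + 2 * n - 1))%:E)%E.
  apply: hC => //.
    apply: (weighted_L2_dom mW W_gt0 Lp Lk).
      apply: measurable_funM => //.
      by apply: measurableT_comp mG _; exact: measurable_tuple_norm.
    exists (M * normc c); split; first by rewrite mulr_ge0 ?normc_ge0.
    move=> t; rewrite normrM.
    apply: (le_trans (ler_pM (normr_ge0 _) (normr_ge0 _)
      (GM _ (tuple_norm_ge0 t)) (PsiM t))).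
    by rewrite le_eqVlt; apply/orP; left; apply/eqP; rewrite /W; ring.
  have := integrable_moment h_continuous h_moments m.
  move=> /(@integrableZl _ _ _ lambda _ (measurable_itv _) M).
  apply: le_integrable => //.
    apply/measurable_EFinP; apply: measurable_funTS; exact: measurable_funM.
  move=> r /=; rewrite in_itv/= andbT => r0.
  rewrite lee_fin normrM.
  rewrite (ger0_norm (exprn_ge0 _ r0)).
  apply: le_trans (ler_norm _); rewrite mulrA [leRHS]mulrAC ler_wpM2r ?exprn_ge0//.
  by apply: (le_trans (GM r r0)); rewrite radial_weightE.
by rewrite G0 mule0.
Qed.

Lemma weighted_inner_radial (B1 B2 : R -> R) (M : R) :
  measurable_fun [set: Rb] (B1 : Rb -> Rb) -> measurable_fun [set: Rb] (B2 : Rb -> Rb) ->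
  (forall r, `|B1 r| <= M) -> (forall r, `|B2 r| <= M) ->
  (\int[lambda]_(r in `[0%R, +oo[)
    (B1 r * (r ^+ (2 * m + 2 * n - 1) * expR (- 2 * h r)))%:E = 0)%E ->
  (\int[lambda]_(r in `[0%R, +oo[)
    (B2 r * (r ^+ (2 * m + 2 * n - 1) * expR (- 2 * h r)))%:E = 0)%E ->
  inner_h h (fun z => (B1 (enorm z) +i* B2 (enorm z)) * p z) k = 0.
Proof.
move=> mB1 mB2 bB1 bB2 i1 i2.
have mrW := measurable_radial_weight h_continuous.
have Lp := fp.2; have Lk := fk.2.
have M0 : 0 <= M by apply: le_trans (bB1 0).
pose G (B : R -> R) r := B r * radial_weight h r.
have key (c : R[i]) (B : R -> R) : measurable_fun [set: Rb] (B : Rb -> Rb) ->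
    (forall r, `|B r| <= M) -> (\int[lambda]_(r in `[0%R, +oo[)
    (B r * (r ^+ (2 * m + 2 * n - 1) * expR (- 2 * h r)))%:E = 0)%E ->
    muC.-integrable setT
      (EFin \o (fun z => G B (enorm z) * complex.Re (c * (p z * (k z)^*)))) /\
    \int[muC]_z (G B (enorm z) * complex.Re (c * (p z * (k z)^*))) = 0.
  move=> mB bB iB.
  have mG : measurable_fun [set: Rb] (G B : Rb -> Rb) by exact: measurable_funM.
  split.
    have dom := @weighted_L2_dom _ (Cn R n) R muC _ (@measurable_weight R n h h_continuous)
      (@weight_gt0 R n h) p k (fun z => G B (enorm z) * complex.Re (c * (p z * (k z)^*)))
      Lp Lk.
    apply: dom.
      apply: measurable_funM.
        by apply: measurableT_comp mG _; exact: measurable_enorm.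
      suff [] : cmeasurable_fun [set: Cn R n] (fun z => c * (p z * (k z)^*)) by [].
      apply: cmeasurableM; first by split; exact: measurable_cst.
      by apply: cmeasurableM; [exact: Lp.1|exact: cmeasurable_conj Lk.1].
    exists (M * normc c); split; first by rewrite mulr_ge0 ?normc_ge0.
    move=> z; rewrite normrM.
    have h1 : `|G B (enorm z)| <= M * weight h z.
      rewrite /G normrM weightE (ger0_norm (radial_weight_ge0 _ _)).
      by rewrite ler_wpM2r// radial_weight_ge0.
    have h2 : `|complex.Re (c * (p z * (k z)^*))| <=
        normc c * (normc (p z) ^+ 2 + normc (k z) ^+ 2).
      exact: normRe_mul_conj_le.
    apply: (le_trans (ler_pM (normr_ge0 _) (normr_ge0 _) h1 h2)).
    by rewrite le_eqVlt; apply/orP; left; apply/eqP; ring.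
  have h0 : (\int[mun]_t (G B (tuple_norm t) *
     complex.Re (c * (p (Cn_of_pairs t) * (k (Cn_of_pairs t))^*)))%:E = 0)%E.
    apply: (integral_radial_homog_fock c M0 mG).
      move=> r r0; rewrite /G normrM (ger0_norm (radial_weight_ge0 _ _)).
      by rewrite ler_wpM2r// radial_weight_ge0.
    rewrite -[RHS]iB; apply: eq_integral => r.
    rewrite inE/= in_itv/= andbT => r0; rewrite /G radial_weightE//.
    by congr (_%:E); ring.
  rewrite /Rintegral -[RHS]/(fine 0%E) -h0 -integral_Cn.
    by congr fine; apply: eq_integral => z _; rewrite tuple_norm_pairs pairs_of_CnK.
  apply/measurable_EFinP; apply: measurable_funM.
    by apply: measurableT_comp mG _; exact: measurable_tuple_norm.
  suff [] : cmeasurable_fun [set: Tn]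
    (fun t => c * (p (Cn_of_pairs t) * (k (Cn_of_pairs t))^*)) by [].
  apply: cmeasurableM; first by split; exact: measurable_cst.
  have Lpt := fock_weighted_tuple fp; have Lkt := fock_weighted_tuple fk.
  by apply: cmeasurableM; [exact: Lpt.1|exact: cmeasurable_conj Lkt.1].
(* With q = p conj(k), the real part of (B1 + i B2) q is B1 Re(q) + B2 Re(i q), and the imaginary
   part is B1 Re(- i q) + B2 Re(q). *)
have [a1 a1E] := key 1 B1 mB1 bB1 i1.
have [a2 a2E] := key (0 +i* 1) B2 mB2 bB2 i2.
have [a3 a3E] := key (0 +i* -1) B1 mB1 bB1 i1.
have [a4 a4E] := key 1 B2 mB2 bB2 i2.
rewrite /inner_h /cintegral; apply/eqP; rewrite eq_complex/=; apply/andP; split.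
  apply/eqP; rewrite -[RHS]addr0 -[X in _ = X + _]a1E -[X in _ = _ + X]a2E.
  rewrite -RintegralD//; apply: eq_Rintegral => z _; rewrite weightE /G.
  by case: (p z) (k z) => [x1 x2] [y1 y2] /=; ring.
apply/eqP; rewrite -[RHS]addr0 -[X in _ = X + _]a3E -[X in _ = _ + X]a4E.
rewrite -RintegralD//; apply: eq_Rintegral => z _; rewrite weightE /G.
by case: (p z) (k z) => [x1 x2] [y1 y2] /=; ring.
Qed.

End RadialOrthogonality.

Lemma cintegral_ae_eq d (T : measurableType d) (R : realType)
    (mu : {measure set T -> \bar R}) (f g : T -> R[i]) :
  cmeasurable_fun setT f -> cmeasurable_fun setT g -> {ae mu, forall z, f z = g z} ->
  cintegral mu setT f = cintegral mu setT g.
Proof.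
move=> [f1 f2] [g1 g2] fg; rewrite /cintegral /Rintegral.
congr (fine _ +i* fine _); apply: ae_eq_integral => //;
  by [exact/measurable_EFinP|apply: filterS fg => z -> ].
Qed.

Lemma weighted_L2_ae_eq d (T : measurableType d) (R : realType)
    (mu : {measure set T -> \bar R}) (w : T -> R) (f g : T -> R[i]) :
  measurable_fun setT w -> (forall z, 0 <= w z) ->
  weighted_L2 mu w f -> cmeasurable_fun setT g -> {ae mu, forall z, g z = f z} ->
  weighted_L2 mu w g.
Proof.
move=> mw w0 [mf If] mg gf; split => //; apply: le_lt_trans If.
rewrite le_eqVlt; apply/orP; left; apply/eqP; apply: ge0_ae_eq_integral => //.
- exact: measurable_weighted_sqr.
- exact: measurable_weighted_sqr.
- by move=> z _; rewrite lee_fin mulr_ge0 ?sqr_ge0.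
- by move=> z _; rewrite lee_fin mulr_ge0 ?sqr_ge0.
- by apply: filterS gf => z ->.
Qed.

Section FockProjection.
Context {R : realType} (n : nat) (h : R -> R).
Hypothesis h_continuous : {within `[0, +oo[, continuous h}.
Local Notation muC := (lebesgue_Cn R n).

Let mwt := @measurable_weight R n h h_continuous.
Let wt_gt0 := @weight_gt0 R n h.

Lemma fockB f g : fock h f -> fock h g ->
  fock h (fun z : 'cV[R[i]]_n => f z - g z).
Proof.
move=> [ef Lf] [eg Lg]; split; last exact: (weighted_L2B mwt wt_gt0 Lf Lg).
by move=> z; exact: differentiableB.
Qed.

Lemma fockZ c f : fock h f -> fock h (fun z : 'cV[R[i]]_n => c * f z).
Proof.
move=> [ef Lf]; split.
  by move=> z; apply: differentiableM; [exact: differentiable_cst|exact: ef].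
apply: (@weighted_L2M _ (Cn R n) R muC (weight h) mwt wt_gt0 (fun=> c) f (normc c)) => //.
Qed.

(** If g' is another solution, then g' - g = (F - g) - (F - g') lies in the Fock space and is
    orthogonal to itself, so it vanishes almost everywhere, hence everywhere. *)
Lemma fock_projection_eq F g : weighted_L2 muC (weight h) F -> fock h g ->
  (forall k, fock h k -> inner_h h (fun z : 'cV[R[i]]_n => F z - g z) k = 0) ->
  fock_projection h F = g.
Proof.
move=> LF fg Fg; apply: xget_unique => // g' [fg' Fg'].
have fe := fockB fg' fg; set e := fun z => _ in fe.
have e0 : inner_h h e e = 0.
  have := weighted_innerB mwt wt_gt0 (weighted_L2B mwt wt_gt0 LF fg.2)
    (weighted_L2B mwt wt_gt0 LF fg'.2) fe.2.
  rewrite -[X in _ = X - _ -> _]/(inner_h h (fun z => F z - g z) e) (Fg e fe).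
  rewrite -[X in _ = _ - X -> _]/(inner_h h (fun z => F z - g' z) e) (Fg' e fe) subr0.
  move=> <-; congr cintegral; apply/funext => z.
  by congr (_ * _ * _); rewrite /e; ring.
apply/funext => z; apply/eqP; rewrite -subr_eq0; apply/eqP.
exact: (entire_ae0 fe.1 (weighted_inner_self0 mwt wt_gt0 fe.2 e0)).
Qed.

End FockProjection.

Section Eigenvalue.
Context {R : realType} (n : nat) (h : R -> R).
Hypothesis h_continuous : {within `[0, +oo[, continuous h}.
Local Notation Rb := (measurableTypeR R).
Local Notation Rl := (lebesgueTypeR R).
Local Notation lambda := (@lebesgue_measure R).
Local Notation clambda := (@completed_lebesgue_measure R).
Variable m : nat.

Let w (r : R) : R := r ^+ (2 * m + 2 * n - 1) * expR (- 2 * h r).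

Let mw : measurable_fun (`[0, +oo[ : set Rb) w.
Proof. exact: measurable_moment. Qed.

(** On the half-line f and b differ only on N, which is null for the completed measure too; with the
    Borel function b the completed integral becomes the Borel one. *)
Lemma Rintegral_completed_modification (f b : R -> R) (N : set R) :
  measurable_fun (`[0, +oo[ : set Rl) f -> measurable_fun [set: Rb] (b : Rb -> R) ->
  measurable (N : set Rb) -> lambda N = 0%E ->
  (forall r, 0 <= r -> ~ N r -> f r = b r) ->
  \int[clambda]_(r in `[0, +oo[) (f r * w r) = \int[lambda]_(r in `[0, +oo[) (b r * w r).
Proof.
move=> mf mb mN N0 fb.
have mbw : measurable_fun (`[0, +oo[ : set Rb) (fun r => (b r * w r)%:E).
  apply/measurable_EFinP; apply: measurable_funM => //; exact: measurable_funTS.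
have tr (g : R -> \bar R) : measurable_fun (`[0, +oo[ : set Rb) g ->
    measurable_fun (`[0, +oo[ : set Rl) g.
  move=> mg _ Y mY; apply: measurable_lebesgueTypeR; exact: mg.
rewrite /Rintegral -integral_completed_lebesgue//; congr fine.
apply: ae_eq_integral.
- by apply: measurable_lebesgueTypeR; exact: measurable_itv.
- apply/measurable_EFinP; apply: measurable_funM => //.
  by apply/measurable_EFinP; apply: tr; exact/measurable_EFinP.
- exact: tr.
- exists N; split => //; first exact: measurable_lebesgueTypeR.
  move=> r /=; apply: contra_notP => Nr; rewrite in_itv/= andbT => r0.
  by rewrite fb.
Qed.

(** The denominator is real, so the quotient is formed componentwise and [b1], [b2] can be treated
    as real radial factors. *)
Lemma eigenvalue_hE (a : R -> R[i]) (b1 b2 : R -> R) (N : set R) :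
  cmeasurable_fun (`[0, +oo[ : set Rl) a ->
  measurable_fun [set: Rb] (b1 : Rb -> R) -> measurable_fun [set: Rb] (b2 : Rb -> R) ->
  measurable (N : set Rb) -> lambda N = 0%E ->
  (forall r, 0 <= r -> ~ N r -> a r = b1 r +i* b2 r) ->
  eigenvalue_h n h a m =
  (\int[lambda]_(r in `[0, +oo[) (b1 r * w r) / \int[lambda]_(r in `[0, +oo[) w r) +i*
  (\int[lambda]_(r in `[0, +oo[) (b2 r * w r) / \int[lambda]_(r in `[0, +oo[) w r).
Proof.
move=> [m1 m2] mb1 mb2 mN N0 ab.
rewrite /eigenvalue_h -/w /cintegral.
have wE : \int[clambda]_(r in `[0, +oo[) w r = \int[lambda]_(r in `[0, +oo[) w r.
  by rewrite /Rintegral integral_completed_lebesgue//; exact/measurable_EFinP.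
rewrite wE.
have -> : \int[clambda]_(r in `[0, +oo[) complex.Re (a r * (w r)%:C) =
    \int[lambda]_(r in `[0, +oo[) (b1 r * w r).
  rewrite -(@Rintegral_completed_modification (fun r => complex.Re (a r)) b1 N)//.
    by apply: eq_Rintegral => r _; case: (a r) => x y /=; rewrite mulr0 subr0.
  by move=> r r0 Nr; rewrite ab.
have -> : \int[clambda]_(r in `[0, +oo[) complex.Im (a r * (w r)%:C) =
    \int[lambda]_(r in `[0, +oo[) (b2 r * w r).
  rewrite -(@Rintegral_completed_modification (fun r => complex.Im (a r)) b2 N)//.
    by apply: eq_Rintegral => r _; case: (a r) => x y /=; rewrite mulr0 add0r.
  by move=> r r0 Nr; rewrite ab.
rewrite -fmorphV/=; set x := _^-1.
by apply/eqP; rewrite eq_complex/=; apply/andP; split; apply/eqP; ring.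
Qed.

Hypothesis h_moments : forall m : nat,
  (\int[clambda]_(r in `[0%R, +oo[)
     (r ^+ (2 * m + 2 * n - 1) * expR (- 2 * h r))%:E < +oo)%E.

(** The quotient is the mean of b for the density w, and a function minus its mean has mean 0;
    [moment_gt0] justifies the division. *)
Lemma integral_centred_moment (b : R -> R) (M : R) :
  measurable_fun [set: Rb] (b : Rb -> R) -> (forall r, `|b r| <= M) ->
  (\int[lambda]_(r in `[0%R, +oo[) ((b r -
     (\int[lambda]_(r in `[0%R, +oo[) (b r * w r)) /
     (\int[lambda]_(r in `[0%R, +oo[) w r))%R * w r)%:E = 0)%E.
Proof.
move=> mb bM; set A := _ / _.
have w_int : lambda.-integrable `[0, +oo[ (EFin \o w).
  exact: (integrable_moment h_continuous h_moments m).
have w_gt0 := moment_gt0 h_continuous h_moments m.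
have bw_int : lambda.-integrable `[0, +oo[ (EFin \o (fun r => b r * w r)).
  have := @integrableZl _ _ _ lambda _ (measurable_itv _) M _ w_int.
  apply: le_integrable => //.
    by apply/measurable_EFinP; apply: measurable_funM => //; exact: measurable_funTS.
  move=> r _; rewrite /= lee_fin !normrM ler_wpM2r//.
  by apply: le_trans (ler_norm _).
have Aw_int : lambda.-integrable `[0, +oo[ (EFin \o (fun r => A * w r)).
  exact: (@integrableZl _ _ _ lambda _ (measurable_itv _) A _ w_int).
have E : (\int[lambda]_(r in `[0%R, +oo[) ((b r - A)%R * w r)%:E =
    \int[lambda]_(r in `[0%R, +oo[) ((b r * w r)%:E - (A * w r)%:E))%E.
  by apply: eq_integral => r _; rewrite -EFinB mulrBl.
rewrite E (@integralB_EFin _ _ _ lambda _ _ _ (measurable_itv _) bw_int Aw_int).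
rewrite -[X in (X - _)%E]fineK; last exact: integrable_fin_num bw_int.
rewrite -[X in (_ - X)%E]fineK; last exact: integrable_fin_num Aw_int.
rewrite -EFinB -[X in _ - X]/(Rintegral lambda _ (fun r => A * w r)).
rewrite RintegralZl// /A divfK ?subrr//.
by rewrite gt_eqF.
Qed.

End Eigenvalue.

Theorem theorem6p2 (R : realType) (n : nat) (n_ge1 : (1 <= n)%N)
  (h : R -> R)
  (h_continuous : {within `[0, +oo[, continuous h})
  (h_ge0 : forall r : R, 0 <= r -> 0 <= h r)
  (h_moments : forall m : nat,
    (\int[@completed_lebesgue_measure R]_(r in `[0%R, +oo[)
       (r ^+ (2 * m + 2 * n - 1) * expR (- 2 * h r))%:E < +oo)%E)
  (phi : 'cV[R[i]]_n -> R[i])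
  (phi_bounded : Linfty phi)
  (phi_invariant : unitary_invariant phi)
  (a : R -> R[i])
  (a_measurable : cmeasurable_fun (`[0, +oo[ : set (lebesgueTypeR R)) a)
  (phi_radial : {ae lebesgue_Cn R n, forall z, phi z = a (enorm z)}) :
  forall (m : nat) (p : 'cV[R[i]]_n -> R[i]), homog_poly m p ->
    forall z, toeplitz h phi p z = eigenvalue_h n h a m * p z.
Proof.
move=> m p hp z.
have [b1 [b2 [M [[mb1 mb2] [bM1 bM2] phib [N [mN N0 ab]]]]]] :=
  radial_symbol n_ge1 phi_bounded a_measurable phi_radial.
have fp : fock h p := fock_homog_poly n_ge1 h_continuous h_moments hp.
have mwt := @measurable_weight R n h h_continuous.
have wt_gt0 := @weight_gt0 R n h.
have i1 := integral_centred_moment h_continuous m h_moments mb1 bM1.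
have i2 := integral_centred_moment h_continuous m h_moments mb2 bM2.
have lamE := eigenvalue_hE n h_continuous m a_measurable mb1 mb2 mN N0 ab.
set A1 := (_ / _) in i1; set A2 := (_ / _) in i2; rewrite -/A1 -/A2 in lamE.
set lam := eigenvalue_h n h a m in lamE *.
(* b is bounded at every point, phi only essentially: membership in L2 is proved for b p and carried
   over to phi p. *)
pose b (x : 'cV[R[i]]_n) : R[i] := b1 (enorm x) +i* b2 (enorm x).
have mb : cmeasurable_fun [set: Cn R n] b.
  by split; [exact: (measurableT_comp mb1 (@measurable_enorm R n))|
    exact: (measurableT_comp mb2 (@measurable_enorm R n))].
have bM x : normc (b x) <= M + M.
  by apply: (le_trans (normc_le_ReIm _)); apply: lerD; [exact: bM1|exact: bM2].
have Lbp : weighted_L2 (lebesgue_Cn R n) (weight h) (fun z => b z * p z).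
  exact: (weighted_L2M mwt wt_gt0 mb bM fp.2).
have mphip : cmeasurable_fun [set: Cn R n] (fun z => phi z * p z).
  by apply: cmeasurableM; [exact: phi_bounded.1|exact: fp.2.1].
have Lphip : weighted_L2 (lebesgue_Cn R n) (weight h) (fun z => phi z * p z).
  apply: (weighted_L2_ae_eq mwt _ Lbp mphip); first by move=> x; exact: ltW.
  by apply: (negligibleS _ phib) => x; apply: contra_not => /= ->.
(* With lam p as candidate for the projection, its orthogonality relation remains. *)
rewrite /toeplitz (fock_projection_eq h_continuous Lphip (fockZ h_continuous lam fp))//.
move=> k fk.
have mfull (F : 'cV[R[i]]_n -> R[i]) : cmeasurable_fun [set: Cn R n] F ->
    cmeasurable_fun [set: Cn R n]
      (fun z => (F z - lam * p z) * (k z)^* * (weight h z)%:C).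
  move=> mF; apply: cmeasurableM; last by split.
  apply: cmeasurableM; last exact: cmeasurable_conj fk.2.1.
  exact: cmeasurableB (fockZ h_continuous lam fp).2.1.
transitivity (inner_h h (fun z => b z * p z - lam * p z) k).
  apply: (@cintegral_ae_eq _ (Cn R n)); [exact: mfull|exact: mfull Lbp.1|].
  by apply: (negligibleS _ phib) => x; apply: contra_not => /= ->.
rewrite (_ : (fun z => _) =
  (fun z => ((b1 (enorm z) - A1) +i* (b2 (enorm z) - A2)) * p z)); last first.
  by apply/funext => x; rewrite -mulrBl lamE.
(* One bound M + |A1| + |A2| dominates both components. *)
apply: (weighted_inner_radial n_ge1 h_continuous h_moments hp fk
  (M := M + `|A1| + `|A2|) (B1 := fun r => b1 r - A1) (B2 := fun r => b2 r - A2)) => //.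
- exact: measurable_funB.
- exact: measurable_funB.
- move=> r; apply: (le_trans (ler_normB _ _)); rewrite -addrA.
  by rewrite lerD// lerDl.
- move=> r; apply: (le_trans (ler_normB _ _)); rewrite addrAC -addrA.
  by rewrite lerD// lerDl.
Qed.
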